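(* Let $r>1$, $\mu>0$, and let $\phi\le\mu$ be an even, $2\pi$-periodic, bounded, zero-mean solution of \[ \tfrac12(\mu-\phi)^2=\tfrac12\mu^2-L_r\phi+\tfrac12\widehat{\phi^2}(0) \] which is nondecreasing on $[-\pi,0]$. If $\phi$ attains its maximum at $x=0$ with $\phi(0)=\mu$, then the following holds: \begin{itemize} \item[(i)] $\phi\in C^\infty(\mathbb T\setminus\{0\})$ and $\phi$ is strictly increasing on $(-\pi,0)$. \item[(ii)] $\phi$ is Lipschitz continuous on $\mathbb T$. \item[(iii)] $\phi$ is precisely Lipschitz continuous at $x=0$, that is, $\mu-\phi(x)\simeq|x|$ for $|x|\ll1$: there are constants $0<c\le C$ and $\delta>0$ such that $c|x|\le\mu-\phi(x)\le C|x|$ for all $|x|<\delta$. \end{itemize}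
   Context: $\mathbb T=[-\pi,\pi]$ with $-\pi$ and $\pi$ identified; $\hat f(k)=\frac1{2\pi}\int_{-\pi}^{\pi}f(x)e^{-ikx}\,dx$, so $\widehat{\phi^2}(0)$ is the mean of $\phi^2$. For a $2\pi$-periodic function $f$ with zero mean, $L_rf(x)=\sum_{k\ne0}|k|^{-r}\hat f(k)e^{ikx}$. The equation is equivalent to $-\mu\phi+L_r\phi+\frac12\phi^2-\frac12\widehat{\phi^2}(0)=0$. All functions are real-valued. *)

(* Defs.v *)
From HB Require Import structures.
From mathcomp Require Import all_boot all_order all_algebra.
From mathcomp Require Import complex.
From mathcomp Require Import all_classical all_reals all_analysis.
Set Implicit Arguments.
Unset Strict Implicit.
Unset Printing Implicit Defensive.
Import Order.TTheory GRing.Theory Num.Theory.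
Import numFieldNormedType.Exports.
Local Open Scope classical_set_scope.
Local Open Scope complex_scope.
Local Open Scope ring_scope.

(* Functions on the torus T = R / 2 pi Z are represented by 2 pi-periodic
   functions on R. *)

(* exp (i t) *)
Definition expi {R : realType} (t : R) : R[i] := (cos t +i* sin t)%C.

Definition cintegral {R : realType} (D : set R) (g : R -> R[i]) : R[i] :=
  ((\int[@lebesgue_measure R]_(x in D) complex.Re (g x)) +i*
   (\int[@lebesgue_measure R]_(x in D) complex.Im (g x)))%C.

Definition fourier_coef {R : realType} (f : R -> R) (k : int) : R[i] :=
  ((2 * pi)^-1)%:C *
  cintegral `[- pi, pi] (fun x => (f x)%:C * expi (- (k%:~R * x))).

Definition Lterm {R : realType} (r : R) (f : R -> R) (x : R) (k : int) : R[i] :=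
  (`|k%:~R| `^ (- r))%:C * fourier_coef f k * expi (k%:~R * x).

(* The sum over k <> 0 is the limit, in the normed topology of R[i], of the
   symmetric partial sums over 0 < |k| <= N.  For r > 1 and f bounded and
   measurable it converges absolutely, so the order of summation is
   immaterial; limn is a junk value only if the partial sums diverge. *)
Definition Lop {R : realType} (r : R) (f : R -> R) (x : R) : R[i] :=
  limn (fun N : nat =>
    \sum_(1 <= k < N.+1) (Lterm r f x k%:Z + Lterm r f x (- k%:Z)) : R[i]^o).

(* C^oo on A, meant for open A: there f^`(n) is the genuine n-th derivative as
   soon as all lower derivatives exist on A. *)
Definition smooth_on {R : realType} (A : set R) (f : R -> R) : Prop :=
  forall (n : nat) (x : R), A x -> derivable (f^`(n))%classic x 1.

(* The preimage in R of T \ {0} *)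
Definition off_zero {R : realType} : set R :=
  [set x | forall m : int, x != m%:~R * (2 * pi)].

(* Main.v *)
Require Import Defs.
From HB Require Import structures.
From mathcomp Require Import all_boot all_order all_algebra.
From mathcomp Require Import complex.
From mathcomp Require Import all_classical all_reals all_analysis.
From mathcomp Require Import measurable_realfun.
From mathcomp Require Import ring lra zify.
Import Order.TTheory GRing.Theory Num.Theory.
Import numFieldNormedType.Exports.
Local Open Scope classical_set_scope.
Local Open Scope complex_scope.
Local Open Scope ring_scope.

(** The proof works with the depth u = mu - phi >= 0. It vanishes at 0, is even
    and 2 pi-periodic, and is nondecreasing on [0, pi]. Subtracting the equation
    at 0 from the equation at x removes all constants and leaves
      u(x)^2 / 2 = (K * u)(x) - (K * u)(0),
      K(z) = (1 / pi) sum_(k >= 1) k^(-r) cos(k z),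
    where the convolution is taken over one period.

    Size of u. A nondecreasing function is a superposition of indicators of
    intervals [a, pi], so the integral of D u over [0, pi] is controlled by the
    integrals of D over these intervals ([comparison]). For the function D that
    expresses (u(x)^2 - u(x')^2) / 2, the integral over [a, pi] equals the
    integral of K(t - a) - K(t + a) for t between x' and x. That difference is
    at least c sin t sin a, because K - c cos is still nonincreasing on [0, pi]
    ([Lkernel_positive]); and it is at most C x (x + a)^(th - 1) for some
    0 < th < 1, because |K'(z)| <= C |z|^(th - 1) ([Lkernel_upper]).
    The lower bound gives u(x)^2 - u(x')^2 >= c (cos x' - cos x), hence strict
    monotonicity and u(x) >= c |x|. The upper bound gives
      (u(x)^2 - u(x')^2) / 2 <= x (x - x') (C1 M + C2)
    as soon as u(y) <= M (x + y) on [0, pi]. At a point x that maximises u(y) / y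
    on [eps, pi], with maximum M and x' = 0, this reads M^2 <= 2 (C1 M + C2), so
    M is bounded independently of eps and u(x) <= M |x|. Feeding this bound back
    and dividing by u(x) + u(x') >= c x gives the Lipschitz estimate.

    The kernel. Two summations by parts turn K into (1 / pi) sum_n d_n Phi_n,
    where d_n > 0 is the second difference of n^(1 - r) and - Phi_n' is a
    conjugate Fejer kernel, which is nonnegative on [0, pi] ([Lkernel_fejer]).
    The sign gives the monotonicity of K, and elementary bounds on the Fejer
    kernels give the bound on K' and the integrability of K'.

    Smoothness. Multiplying the series of K by 2 - 2 cos z replaces the
    coefficients by their second differences, which decay faster; so K is smooth
    off 2 pi Z ([Lkernel_off]). Since K' is integrable, convolution over [a, b]
    with K gains one derivative inside ]a, b[ ([Cn_conv_near]), while the part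
    of u living away from x contributes a smooth function ([Cn_conv_far]). As
    u > 0 off 2 pi Z, the identity u' = (K * u)' / u upgrades C^n to C^(n + 1)
    there ([bootstrap]). *)

(** * Derivatives and termwise differentiation of series *)

Section Calculus.
Set Implicit Arguments.
Unset Strict Implicit.
Context {R : realType}.
Implicit Types (f g F G : R -> R) (a b x y l e : R).

(** The difference quotient cleared of its denominator: this is the form in
    which finite parts and tails of a series can be estimated together. *)
Lemma is_derive_eps f x l :
  (forall e, 0 < e -> exists2 d, 0 < d &
     forall h, `|h| < d -> `|f (x + h) - f x - h * l| <= e * `|h|) ->
  is_derive x 1 f l.
Proof.
move=> H.
have C : h^-1 *: ((f \o shift x) (h *: (1:R)) - f x) @[h --> 0^'] --> l.
  apply/cvgrPdist_le => /= e e0.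
  have [d d0 Hd] := H e e0.
  near=> h.
  have h0 : h != 0 by near: h; exact: nbhs_dnbhs_neq.
  have hd : `|h| < d.
    near: h; apply: dnbhs0_lt; exact: d0.
  have := Hd h hd.
  rewrite /= scaler1 [h + x]addrC => Hh.
  have -> : l - h^-1 *: (f (x + h) - f x) = - h^-1 * (f (x + h) - f x - h * l).
    rewrite /GRing.scale /=; field. exact: h0.
  by rewrite normrM normrN normfV mulrC ler_pdivrMr ?normr_gt0.
split.
  by apply/cvg_ex; exists l; exact: C.
exact: cvg_lim C.
Unshelve. all: by end_near. Qed.


Lemma is_derive_cvg f x l : is_derive x 1 f l ->
  h^-1 *: ((f \o shift x) (h *: (1:R)) - f x) @[h --> 0^'] --> l.
Proof. by move=> [D E]; rewrite -E; exact: D. Qed.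

Lemma is_derive_epsP f x l : is_derive x 1 f l ->
  forall e, 0 < e -> exists2 d, 0 < d &
     forall h, `|h| < d -> `|f (x + h) - f x - h * l| <= e * `|h|.
Proof.
move=> /is_derive_cvg /cvgrPdist_le /= + e e0 => /(_ e e0).
rewrite /dnbhs /within /= => -[d /= d0 Hd].
exists d => // h hd.
have [->|h0] := eqVneq h 0; first by rewrite addr0 subrr mul0r subr0 normr0 mulr0.
have := Hd h; rewrite /ball_ /= sub0r normrN => /(_ hd h0).
rewrite scaler1 [h + x]addrC.
have -> : l - h^-1 *: (f (x + h) - f x) = - h^-1 * (f (x + h) - f x - h * l).
  rewrite /GRing.scale /=; field. exact: h0.
by rewrite normrM normrN normfV mulrC ler_pdivrMr ?normr_gt0.
Qed.

Lemma is_derive_cont {f x l} : is_derive x 1 f l -> {for x, continuous f}.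
Proof. by move=> [D _]; apply: differentiable_continuous; apply/derivable1_diffP. Qed.

(** Two-sided continuity at every point of the segment, endpoints included;
    derivatives at the endpoints are then two-sided as well, which the
    fundamental theorem below uses. *)
Definition cont_on a b f := forall x, a <= x <= b -> {for x, continuous f}.

Lemma cont_on_within a b f : cont_on a b f -> {within `[a, b], continuous f}.
Proof.
move=> H; apply: continuous_in_subspaceT => x /set_mem /=.
by rewrite in_itv /=; exact: H.
Qed.

Lemma contW a b f : continuous f -> cont_on a b f.
Proof. by move=> H x _; exact: H. Qed.

Lemma cont_sub a b c d f : a <= c -> d <= b -> cont_on a b f -> cont_on c d f.
Proof. by move=> ac db H x /andP[cx xd]; apply: H; rewrite (le_trans ac)//= (le_trans xd). Qed.

Lemma MVT_is_derive f df a b : a < b ->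
  (forall x, a <= x <= b -> is_derive x 1 f (df x)) ->
  exists2 c, a < c < b & f b - f a = df c * (b - a).
Proof.
move=> ab H.
have [c|| c cab E] := @MVT R f df a b ab.
- by rewrite in_itv /= => /andP[/ltW ac /ltW cb]; apply: H; rewrite ac.
- by apply: cont_on_within => x /H /is_derive_cont.
by exists c => //; move: cab; rewrite in_itv.
Qed.

Lemma derive_nondecr f df a b :
  (forall x, a <= x <= b -> is_derive x 1 f (df x)) ->
  (forall x, a <= x <= b -> 0 <= df x) ->
  forall x y, a <= x -> x <= y -> y <= b -> f x <= f y.
Proof.
move=> H P x y ax; rewrite le_eqVlt => /predU1P[->//|xy yb].
have I z : x <= z <= y -> a <= z <= b.
  by move=> /andP[xz zy]; rewrite (le_trans ax)//= (le_trans zy).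
have [z xzy E] := @MVT_is_derive f df x y xy (fun z h => H z (I z h)).
rewrite -subr_ge0 E mulr_ge0 ?subr_ge0 ?(ltW xy)// P// I//.
by case/andP: xzy => /ltW -> /ltW ->.
Qed.

Lemma derive_lip f df a b B :
  (forall x, a <= x <= b -> is_derive x 1 f (df x)) ->
  (forall x, a <= x <= b -> `|df x| <= B) ->
  forall x y, a <= x -> x <= y -> y <= b -> `|f y - f x| <= B * (y - x).
Proof.
move=> H P x y ax; rewrite le_eqVlt => /predU1P[->|xy yb].
  by rewrite !subrr normr0 mulr0.
have I z : x <= z <= y -> a <= z <= b.
  by move=> /andP[xz zy]; rewrite (le_trans ax)//= (le_trans zy).
have [z xzy E] := @MVT_is_derive f df x y xy (fun z h => H z (I z h)).
rewrite E normrM [`|y - x|]gtr0_norm ?subr_gt0// ler_pM2r ?subr_gt0// P// I//.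
by case/andP: xzy => /ltW -> /ltW ->.
Qed.

Lemma summable_le (f M : nat -> R) : (forall n, `|f n| <= M n) ->
  cvgn (series M) -> cvgn (series f).
Proof.
move=> fM cM; apply: normed_cvg; apply: series_le_cvg cM => n /=.
- exact: normr_ge0.
- exact: le_trans (normr_ge0 _) (fM n).
- exact: fM.
Qed.

Lemma sum_le (f M : nat -> R) : (forall n, `|f n| <= M n) ->
  cvgn (series M) -> `|limn (series f)| <= limn (series M).
Proof.
move=> fM cM.
have cn : cvgn [normed series f].
  apply: series_le_cvg cM => n /=; [exact: normr_ge0| |exact: fM].
  exact: le_trans (normr_ge0 _) (fM n).
apply: le_trans (@lim_series_norm _ R^o _ cn) _.
by apply: lim_series_le.
Qed.

(** The tails of a dominated series are bounded by those of the majorant,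
    uniformly in any parameter: all uniform convergence below rests on this. *)
Lemma series_tail_le (f M : nat -> R) N : (forall n, `|f n| <= M n) ->
  cvgn (series M) ->
  `|limn (series f) - series f N| <= limn (series M) - series M N.
Proof.
move=> fM cM.
have cf := summable_le fM cM.
have L1 : `|series f n - series f N| @[n --> \oo] --> `|limn (series f) - series f N|.
  by apply: cvg_norm; apply: cvgB => //; apply: cvg_cst.
have L2 : series M n - series M N @[n --> \oo] --> limn (series M) - series M N.
  by apply: cvgB => //; apply: cvg_cst.
apply: (ler_cvg_to L1 L2); near=> n.
have Nn : (N <= n)%N by near: n; exists N.
rewrite !sub_series_geq//; apply: le_trans (ler_norm_sum _ _ _) _.
by apply: ler_sum.
Unshelve. all: by end_near. Qed.

Lemma summable_tail (M : nat -> R) e : cvgn (series M) -> 0 < e ->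
  exists N, limn (series M) - series M N <= e.
Proof.
move=> cM e0.
have /cvgrPdist_le /(_ e e0) [N _ /(_ N)] := cM.
by move=> /(_ (leqnn N)) H; exists N; apply: le_trans (ler_norm _) H.
Qed.

Lemma cont_partial (f : nat -> R -> R) x N : (forall n, {for x, continuous (f n)}) ->
  {for x, continuous (fun y => series (f^~ y) N)}.
Proof.
move=> cf.
  elim: N => [|N IH].
    rewrite (_ : (fun y => _) = cst 0); first exact: cvg_cst.
    by apply/funext => y; rewrite /series /= big_geq.
  rewrite (_ : (fun y => _) = (fun y => series (f^~ y) N + f N y)).
    by apply: continuousD; [exact: IH|exact: cf].
  by apply/funext => y; rewrite /series /= big_nat_recr.
Qed.

Lemma Mtest_cont (f : nat -> R -> R) (M : nat -> R) x :
  (forall n, {for x, continuous (f n)}) ->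
  (forall n y, `|f n y| <= M n) -> cvgn (series M) ->
  {for x, continuous (fun y => limn (series (f ^~ y)))}.
Proof.
move=> cf fM cM; apply/cvgrPdist_le => /= e e0.
have e3 : 0 < e / 3 by rewrite divr_gt0.
have [N HN] := summable_tail cM e3.
have T y := series_tail_le N (fM^~ y) cM.
have C : {for x, continuous (fun y => series (f^~ y) N)}.
  exact: cont_partial.
move/cvgrPdist_le : C => /= /(_ _ e3) C.
near=> y.
have H : `|series (f^~ x) N - series (f^~ y) N| <= e / 3 by near: y.
have := T x; have := T y; move: H HN.
set a := limn _; set b := limn _; set c := limn _.
set a' := series _ _; set b' := series _ _; set c' := series _ _.
move=> H HN H1 H2.
have -> : c - b = (c - a') + (a' - b') - (b - b') by ring.
apply: le_trans (ler_normB _ _) _.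
apply: le_trans (lerD (ler_normD _ _) (lexx _)) _.
lra.
Unshelve. all: by end_near. Qed.

(** Each difference f_n(x + h) - f_n(x) is at most |h| M_n by the mean value
    inequality, so beyond a large rank the increments and the derivatives
    are both O(e |h|); the finite part is handled by its own derivative. *)
Lemma Mtest_derive (f df : nat -> R -> R) (M : nat -> R) x :
  (forall n y, is_derive y 1 (f n) (df n y)) ->
  (forall n y, `|df n y| <= M n) -> cvgn (series M) ->
  (forall y, cvgn (series (f^~ y))) ->
  is_derive x 1 (fun y => limn (series (f^~ y))) (limn (series (df^~ x))).
Proof.
move=> Df dM cM cf; apply: is_derive_eps => e e0.
have e3 : 0 < e / 3 by rewrite divr_gt0.
have [N HN] := summable_tail cM e3.
have /is_derive_epsP /(_ _ e3) [d d0 Hd] :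
  is_derive x 1 (fun y => series (f^~ y) N) (series (df^~ x) N).
  have -> : (fun y : R => series (f^~ y) N) = \sum_(k < N) f k.
    by apply/funext => y; rewrite /series /= big_mkord fct_sumE.
  rewrite /series /= big_mkord.
  by apply: is_derive_sum => i; exact: Df.
exists d => // h hd.
have Hh := Hd h hd.
have lipf n : `|f n (x + h) - f n x| <= `|h| * M n.
  have [h0|h0] := leP 0 h.
    have := @derive_lip (f n) (df n) x (x + h) (M n) (fun y _ => Df n y) (fun y _ => dM n y) x (x+h).
    rewrite lexx lerDl h0 (addrC x) addrK (ger0_norm h0) mulrC. exact.
  have := @derive_lip (f n) (df n) (x+h) x (M n) (fun y _ => Df n y) (fun y _ => dM n y) (x + h) x.
  rewrite lexx gerDl (ltW h0) (ltr0_norm h0) distrC.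
  have -> : x - (x + h) = - h by ring.
  rewrite mulrC. exact.
have chM : cvgn (series (fun n => `|h| * M n)).
  exact: (@is_cvg_seriesZ _ _ `|h| cM).
have Elim : limn (series (fun n => `|h| * M n)) = `|h| * limn (series M).
  exact: (@lim_seriesZ _ _ `|h| cM).
have Es : series (fun n => `|h| * M n) N = `|h| * series M N.
  by rewrite /series /= mulr_sumr.
have T1 := series_tail_le N lipf chM.
have Ed : limn (series (fun n => f n (x + h) - f n x)) =
   limn (series (f^~ (x + h))) - limn (series (f^~ x)).
  by rewrite -(lim_seriesB (cf _) (cf _)).
have T2 := series_tail_le N (dM^~ x) cM.
move: T1 T2 HN Hh; rewrite Ed Elim Es -mulrBr.
have -> : series (fun n => f n (x + h) - f n x) N = series (f^~ (x + h)) N - series (f^~ x) N.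
  by rewrite /series /= sumrB.
set A := limn _; set B := limn _; set C := limn _; set D := limn _.
set A' := series _ _; set B' := series _ _; set C' := series _ _; set D' := series _ _.
move=> T1 T2 HN Hh.
have -> : A - B - h * D = (A - B - (A' - B')) + (A' - B' - h * D') - h * (D - D') by ring.
apply: le_trans (ler_normB _ _) _.
apply: le_trans (lerD (ler_normD _ _) (lexx _)) _.
rewrite normrM.
have X1 : `|h| * (C - C') <= `|h| * (e / 3) by apply: ler_wpM2l.
have X2 : `|h| * `|D - D'| <= `|h| * (e / 3).
  by apply: ler_wpM2l => //; apply: le_trans T2 HN.
lra.
Qed.
End Calculus.

(** * Integrals of continuous functions over segments *)

Section Integrals.
Set Implicit Arguments.
Unset Strict Implicit.
Context {R : realType}.
Implicit Types (f g F G : R -> R) (a b c x y : R).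
Local Notation mu := (@lebesgue_measure R).

Definition itg a b f : R := \int[mu]_(x in `[a, b]) f x.

Lemma itg_integrable a b f : cont_on a b f -> mu.-integrable `[a, b] (EFin \o f).
Proof.
move=> cf; apply: continuous_compact_integrable; first exact: segment_compact.
exact: cont_on_within.
Qed.

Lemma eq_itg a b f g : (forall x, a <= x <= b -> f x = g x) -> itg a b f = itg a b g.
Proof. by move=> H; apply: eq_Rintegral => x /set_mem /=; rewrite in_itv /=; exact: H. Qed.

Lemma itgD a b f g : cont_on a b f -> cont_on a b g ->
  itg a b (fun x => f x + g x) = itg a b f + itg a b g.
Proof. by move=> cf cg; apply: RintegralD => //; exact: itg_integrable. Qed.

Lemma itgB a b f g : cont_on a b f -> cont_on a b g ->
  itg a b (fun x => f x - g x) = itg a b f - itg a b g.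
Proof. by move=> cf cg; apply: RintegralB => //; exact: itg_integrable. Qed.

Lemma itgZ a b f k : cont_on a b f -> itg a b (fun x => k * f x) = k * itg a b f.
Proof. by move=> cf; apply: RintegralZl => //; exact: itg_integrable. Qed.

Lemma itgN a b f : cont_on a b f -> itg a b (fun x => - f x) = - itg a b f.
Proof.
move=> cf; rewrite -[RHS]mulN1r -itgZ//; apply: eq_itg => x _.
by rewrite mulN1r.
Qed.

Lemma itg_cst a b k : a <= b -> itg a b (fun=> k) = k * (b - a).
Proof.
move=> ab; rewrite /itg Rintegral_cst//= lebesgue_measure_itv /= lte_fin.
move: ab; rewrite le_eqVlt => /predU1P[->|->]; last by [].
by rewrite ltxx subrr mulr0.
Qed.

Lemma itg_le a b f g : cont_on a b f -> cont_on a b g ->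
  (forall x, a <= x <= b -> f x <= g x) -> itg a b f <= itg a b g.
Proof.
move=> cf cg H; apply: le_Rintegral; [by []|exact: itg_integrable cf|exact: itg_integrable cg|].
by move=> x /=; rewrite in_itv /=; exact: H.
Qed.

Lemma itg_norm a b f : cont_on a b f -> `|itg a b f| <= itg a b (fun x => `|f x|).
Proof. by move=> cf; apply: le_normr_Rintegral => //; exact: itg_integrable. Qed.

Lemma cont_onD a b f g : cont_on a b f -> cont_on a b g -> cont_on a b (fun x => f x + g x).
Proof. by move=> cf cg x h; apply: continuousD; [exact: cf|exact: cg]. Qed.
Lemma cont_onB a b f g : cont_on a b f -> cont_on a b g -> cont_on a b (fun x => f x - g x).
Proof. by move=> cf cg x h; apply: continuousB; [exact: cf|exact: cg]. Qed.
Lemma cont_onM a b f g : cont_on a b f -> cont_on a b g -> cont_on a b (fun x => f x * g x).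
Proof. by move=> cf cg x h; apply: continuousM; [exact: cf|exact: cg]. Qed.
Lemma cont_onN a b f : cont_on a b f -> cont_on a b (fun x => - f x).
Proof. by move=> cf x h; apply: continuousN; exact: cf. Qed.
Lemma cont_on_norm a b f : cont_on a b f -> cont_on a b (fun x => `|f x|).
Proof. by move=> cf x h; apply: (@cvg_norm _ R^o); exact: cf. Qed.
Lemma cont_on_cst a b k : cont_on a b (fun=> k).
Proof. by move=> x _; exact: cvg_cst. Qed.

Lemma ctsM (f g : R -> R) : continuous f -> continuous g -> continuous (fun y => f y * g y).
Proof. by move=> cf cg y; apply: continuousM; [exact: cf|exact: cg]. Qed.

Lemma ctsZ (k : R) (f : R -> R) : continuous f -> continuous (fun y => k * f y).
Proof. by move=> cf; apply: ctsM => // y; exact: cvg_cst. Qed.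

Lemma ctsN (f : R -> R) : continuous f -> continuous (fun y => - f y).
Proof. by move=> cf y; apply: (@continuousN _ _ _ f); exact: cf. Qed.

Lemma ctsD (f g : R -> R) : continuous f -> continuous g -> continuous (fun y => f y + g y).
Proof. by move=> cf cg y; apply: continuousD; [exact: cf|exact: cg]. Qed.

Lemma ctsB (f g : R -> R) : continuous f -> continuous g -> continuous (fun y => f y - g y).
Proof. by move=> cf cg; apply: ctsD => //; exact: ctsN. Qed.

Lemma ctsC (k : R) : continuous (fun _ : R => k).
Proof. by move=> y; exact: cvg_cst. Qed.

Lemma cts_reflect (c : R) (f : R -> R) : continuous f -> continuous (fun y => f (c - y)).
Proof.
move=> cf y; apply: (@continuous_comp _ _ _ (fun y => c - y) f); last exact: cf.
by apply: cvgB; [exact: cvg_cst|exact: cvg_id].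
Qed.

Lemma cont_on_bounded a b f : a <= b -> cont_on a b f ->
  exists2 B : R, 0 <= B & forall x : R, a <= x <= b -> `|f x| <= B.
Proof.
move=> ab cf.
have [c _ H] := EVT_max ab (cont_on_within (cont_on_norm cf)).
by exists `|f c| => // x h; apply: H; rewrite in_itv.
Qed.

Lemma itg_norm_le a b f B : a <= b -> cont_on a b f ->
  (forall x, a <= x <= b -> `|f x| <= B) -> `|itg a b f| <= B * (b - a).
Proof.
move=> ab cf H; apply: le_trans (itg_norm cf) _; rewrite -itg_cst//.
by apply: itg_le => //; [exact: cont_on_norm|exact: cont_on_cst].
Qed.

Lemma itg_FTC2 a b f F : a <= b ->
  (forall x, a <= x <= b -> is_derive x 1 F (f x)) -> cont_on a b f ->
  itg a b f = F b - F a.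
Proof.
move=> ab dF cf; move: ab; rewrite le_eqVlt => /predU1P[E|ab].
  by rewrite -E /itg set_itv1 Rintegral_set1 subrr.
have D x : a <= x <= b -> {for x, continuous F} by move=> /dF /is_derive_cont.
rewrite /itg /Rintegral (continuous_FTC2 ab (cont_on_within cf) (F := F)) //=.
- split => //.
  + by move=> x; rewrite in_itv /= => /andP[/ltW h1 /ltW h2]; have [] := dF x; rewrite ?h1 ?h2.
  + by apply: cvg_at_right_filter; apply: D; rewrite lexx ltW.
  + by apply: cvg_at_left_filter; apply: D; rewrite lexx ltW.
- move=> x; rewrite in_itv /= => /andP[/ltW h1 /ltW h2].
  have dx : is_derive x 1 F (f x) by apply: dF; rewrite h1 h2.
  by rewrite derive1E; have [_ ->] := dx.
Qed.

(** The open interval leaves room on both sides of the points at which the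
    primitive is differentiated. *)
Lemma primitive_ex A B f : A < B -> cont_on A B f ->
  exists F, forall x, A < x < B -> is_derive x 1 F (f x).
Proof.
move=> AB cf; exists (fun x => \int[mu]_(t in `[A, x]) f t) => x /andP[Ax xB].
have fx : {for x, continuous f} by apply: cf; rewrite !ltW.
have [D E] := continuous_FTC1_closed xB (itg_integrable cf) Ax fx.
by split => //; rewrite -derive1E.
Qed.

Lemma itg_split a c b f : a <= c -> c <= b -> cont_on a b f ->
  itg a b f = itg a c f + itg c b f.
Proof.
move=> ac cb cf.
have I : mu.-integrable `[c, b] (EFin \o f).
  by apply: itg_integrable; exact: cont_sub cf.
have I' : mu.-integrable `]c, b] (EFin \o f).
  by apply: integrableS I => //; exact: subset_itv_oc_cc.
have := Rintegral_itvB (itg_integrable cf) (x := c); rewrite !bnd_simp => /(_ ac cb).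
rewrite Rintegral_itv_obnd_cbnd// /itg => <-; ring.
Qed.

(** Both sides are increments of one primitive of f. *)
Lemma itg_shift a b c f : a <= b -> continuous f ->
  itg a b (fun x => f (x + c)) = itg (a + c) (b + c) f.
Proof.
move=> ab cf.
have L : a + c - 1 < b + c + 1 by lra.
have [F HF] := primitive_ex L (@contW R _ _ _ cf).
have -> : itg (a + c) (b + c) f = F (b + c) - F (a + c).
  apply: itg_FTC2; first by rewrite lerD2r.
    by move=> x /andP[h1 h2]; apply: HF; apply/andP; split; lra.
  exact: contW.
apply: (@itg_FTC2 a b _ (fun x => F (x + c))) => //.
- move=> x /andP[h1 h2].
  have Fd : is_derive (x + c) 1 F (f (x + c)) by apply: HF; apply/andP; split; lra.
  have i : is_derive x 1 (fun x => x + c) 1.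
    by apply: is_derive_eq; rewrite addr0.
  by have := @is_derive1_comp _ F (fun x => x + c) x _ _ Fd i; rewrite mulr1.
- by move=> x _; apply: (@continuous_comp _ _ _ (fun x => x + c) f); [|exact: cf];
    apply: cvgD; [exact: cvg_id|exact: cvg_cst].
Qed.

Lemma itg_opp a b f : a <= b -> continuous f ->
  itg a b (fun x => f (- x)) = itg (- b) (- a) f.
Proof.
move=> ab cf; rewrite /itg /Rintegral integration_by_substitution_oppr//.
by apply: cont_on_within; exact: contW.
Qed.

(** Differentiation under the integral sign; k only needs to be C^1 on the
    segment swept by x - y for x close to x0. *)
Lemma derive_conv (k dk v : R -> R) (a b x0 rho : R) : a <= b -> 0 < rho ->
  (forall z : R, x0 - rho - b <= z <= x0 + rho - a -> is_derive z 1 k (dk z)) ->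
  cont_on (x0 - rho - b) (x0 + rho - a) dk -> cont_on a b v ->
  is_derive x0 1 (fun x => itg a b (fun y => k (x - y) * v y))
    (itg a b (fun y => dk (x0 - y) * v y)).
Proof.
move=> ab r0 Dk cdk cv.
have L : x0 - rho - b <= x0 + rho - a by lra.
have bnd (x y : R) : x0 - rho <= x <= x0 + rho -> a <= y <= b ->
    x0 - rho - b <= x - y <= x0 + rho - a.
  by move=> /andP[? ?] /andP[? ?]; apply/andP; split; lra.
have [B1 B10 H1] := cont_on_bounded L cdk.
have [B2 B20 H2] := cont_on_bounded ab cv.
have ck : cont_on (x0 - rho - b) (x0 + rho - a) k.
  by move=> z /Dk /is_derive_cont.
pose f x y := k (x - y) * v y.
have csub (h : R -> R) (x : R) : cont_on (x0 - rho - b) (x0 + rho - a) h -> x0 - rho <= x <= x0 + rho ->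
   cont_on a b (fun y => h (x - y)).
  move=> ch /andP[x1 x2] y /andP[y1 y2].
  apply: (@continuous_comp _ _ _ (fun y => x - y) h).
    by apply: cvgB; [exact: cvg_cst|exact: cvg_id].
  by apply: ch; apply/andP; split; lra.
have Df (x y : R) : x0 - rho <= x <= x0 + rho -> a <= y <= b ->
    is_derive x 1 (f ^~ y) (dk (x - y) * v y).
  move=> /andP[x1 x2] /andP[y1 y2].
  have kd : is_derive (x - y) 1 k (dk (x - y)) by apply: Dk; apply/andP; split; lra.
  have i : is_derive x 1 (fun x => x - y) 1.
    by apply: is_derive_eq; rewrite subr0.
  have kc := @is_derive1_comp _ k (fun x => x - y) x _ _ kd i.
  rewrite /f; apply: is_derive_eq.
  by rewrite scaler0 add0r /GRing.scale /= mulr1 mulrC.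
have II x : `]x0 - rho, x0 + rho[%classic x -> x0 - rho <= x <= x0 + rho.
  by rewrite /= in_itv /= => /andP[/ltW -> /ltW ->].
have YY y : `[a, b]%classic y -> a <= y <= b by rewrite /= in_itv.
have d1E (x y : R) : x0 - rho <= x <= x0 + rho -> a <= y <= b ->
    partial1of2 f x y = dk (x - y) * v y.
  by move=> hx hy; rewrite partial1of2E; have [_] := Df x y hx hy.
have I0 : `]x0 - rho, x0 + rho[%classic x0 by rewrite /= in_itv /=; apply/andP; split; lra.
have I0' := II _ I0.
have h1 x : `]x0 - rho, x0 + rho[%classic x -> mu.-integrable `[a, b] (EFin \o f x).
  move=> /II hx; apply: itg_integrable; apply: cont_onM => //; exact: csub.
have h2 (x y : R) : `]x0 - rho, x0 + rho[%classic x -> `[a, b]%classic y -> derivable (f ^~ y) x 1.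
  by move=> /II hx /YY hy; have [] := Df x y hx hy.
have h3 (y : R) : 0 <= (fun=> B1 * B2) y by rewrite mulr_ge0.
have h4 : mu.-integrable `[a, b] (EFin \o (fun=> B1 * B2 : R)).
  by apply: itg_integrable; exact: cont_on_cst.
have h5 (x y : R) : `]x0 - rho, x0 + rho[%classic x -> `[a, b]%classic y ->
    `|partial1of2 f x y| <= B1 * B2.
  move=> /II hx /YY hy; rewrite d1E// normrM ler_pM ?H2// H1//.
  exact: bnd.
have mab : measurable (`[a, b]%classic : set (measurableTypeR R)) by [].
split; first exact: (derivable_under_integral mab I0 h1 h2 h3 h4 h5).
rewrite -derive1E (differentiation_under_integral mab I0 h1 h2 h3 h4 h5).
by apply: eq_itg => y hy; exact: d1E.
Qed.

(** Uniform convergence of the series suffices, since the segment has finite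
    length. *)
Lemma itg_series (f : nat -> R -> R) (M : nat -> R) a b : a <= b ->
  (forall n, continuous (f n)) -> (forall n y, `|f n y| <= M n) -> cvgn (series M) ->
  series (fun n => itg a b (f n)) @ \oo --> itg a b (fun y => limn (series (f^~ y))).
Proof.
move=> ab cf fM cM.
have cS : continuous (fun y => limn (series (f ^~ y))).
  by move=> y; apply: (Mtest_cont (M := M)) => // n; exact: cf.
have cN N : continuous (fun y => series (f^~ y) N).
  by move=> y; apply: cont_partial => n; exact: cf.
have E N : series (fun n => itg a b (f n)) N = itg a b (fun y => series (f^~ y) N).
  elim: N => [|N IH].
    rewrite /series /= big_geq// (@eq_itg _ _ _ (fun=> 0)) ?itg_cst ?mul0r//.
    by move=> x _; rewrite big_geq.
  rewrite (@eq_itg _ _ _ (fun y => series (f^~ y) N + f N y)).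
    rewrite itgD -?IH; [by rewrite /series /= big_nat_recr|exact: contW..].
  by move=> z _; rewrite /series /= big_nat_recr.
apply/cvgrPdist_le => /= e e0.
have e1 : 0 < e / (b - a + 1) by rewrite divr_gt0//; lra.
near=> N.
rewrite E -itgB; [|exact: contW..].
apply: le_trans (_ : e / (b - a + 1) * (b - a) <= e); last first.
  by rewrite mulrAC ler_pdivrMr ?ler_pM2l//; lra.
apply: itg_norm_le => //; first by apply: cont_onB; exact: contW.
move=> x _; apply: le_trans (series_tail_le N (fM^~ x) cM) _.
near: N.
move/cvgrPdist_le : cM => /(_ _ e1) [N _ HN]; exists N => // n Nn.
exact: le_trans (ler_norm _) (HN _ Nn).
Unshelve. all: by end_near. Qed.

End Integrals.

(** * Completely monotone sequences *)

Section CompletelyMonotone.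
Set Implicit Arguments.
Unset Strict Implicit.
Context {R : realType}.
Implicit Types (f : nat -> R -> R) (a b : nat -> R) (x y : R).

Lemma summable_bounded a B : (forall n, 0 <= a n) -> (forall N, series a N <= B) ->
  cvgn (series a).
Proof.
move=> a0 aB; apply: nondecreasing_is_cvgn.
  by apply: nondecreasing_series => n _ _; exact: a0.
by exists B => _ [N _ <-].
Qed.

Lemma series_leB a : (forall n, 0 <= a n) -> cvgn (series a) ->
  forall N, series a N <= limn (series a).
Proof.
by move=> a0 ca N; apply: nondecreasing_cvgn_le => //; apply: nondecreasing_series => n _ _; exact: a0.
Qed.

(** The members of the family are, up to alternating signs, the successive
    derivatives of f 0, which is therefore completely monotone on the
    positive half-line. *)
Definition cm_family f := forall m x, 0 < x ->
  0 < f m x /\ is_derive x 1 (f m) (- f m.+1 x).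

Lemma cm_meanvalue f m x : cm_family f -> 0 < x ->
  exists2 y, x < y < x + 1 & f m x - f m (x + 1) = f m.+1 y.
Proof.
move=> cf x0.
have L : x < x + 1 by lra.
have [y hy E] := @MVT_is_derive _ (f m) (fun z => - f m.+1 z) x (x + 1) L
  (fun z hz => (cf m z (lt_le_trans x0 (proj1 (andP hz)))).2).
exists y => //; rewrite -[LHS]opprB E; ring.
Qed.

Lemma cm_decr f m x y : cm_family f -> 0 < x -> x <= y -> f m y <= f m x.
Proof.
move=> cf x0; rewrite le_eqVlt => /predU1P[->//|xy].
have [z hz E] := @MVT_is_derive _ (f m) (fun z => - f m.+1 z) x y xy
  (fun z hz => (cf m z (lt_le_trans x0 (proj1 (andP hz)))).2).
rewrite -subr_le0 E mulNr oppr_le0 mulr_ge0 ?subr_ge0 ?ltW//.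
have z0 : 0 < z by case/andP: hz => h _; exact: lt_trans x0 h.
by have [] := cf m.+1 z z0.
Qed.

(** Each f m is decreasing with derivative - f m.+1, so the differences f m
    x - f m (x + 1) form a family of the same kind. Iterating this gives the
    sign of all finite differences without computing any. *)
Lemma cm_diff f : cm_family f -> cm_family (fun m x => f m x - f m (x + 1)).
Proof.
move=> cf m x x0; split.
  have [y /andP[xy _] ->] := cm_meanvalue m cf x0.
  by have [] := cf m.+1 y (lt_trans x0 xy).
have x10 : 0 < x + 1 by lra.
have [_ d1] := cf m x x0.
have [_ d2] := cf m (x + 1) x10.
have i : is_derive x 1 (fun x => x + 1) 1.
  by apply: is_derive_eq; rewrite addr0.
have d3 := @is_derive1_comp _ (f m) (fun x => x + 1) x _ _ d2 i.
apply: is_derive_eq; ring.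
Qed.

(** Applying the mean value theorem twice evaluates a second difference as a
    second derivative, which yields both its sign and its size. *)
Lemma cm_diff2 f x : cm_family f -> 0 < x ->
  exists2 y, x < y & f 0%N x - f 0%N (x + 1) - (f 0%N (x + 1) - f 0%N (x + 1 + 1)) = f 2%N y.
Proof.
move=> cf x0.
have [y /andP[xy _] E] := cm_meanvalue 0 (cm_diff cf) x0.
rewrite E.
have [z /andP[yz _] ->] := cm_meanvalue 1 cf (lt_trans x0 xy).
by exists z => //; exact: lt_trans yz.
Qed.

(** Up to sign, the m-th derivative of x^(-s). *)
Definition pow_family (s : R) (m : nat) (x : R) : R :=
  \prod_(i < m) (s + i%:R) * x `^ (- s - m%:R).

Lemma pow_family_cm (s : R) : 0 < s -> cm_family (pow_family s).
Proof.
move=> s0 m x x0; split.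
  rewrite /pow_family mulr_gt0 ?powR_gt0//; apply: prodr_gt0 => i _.
  by rewrite ltr_wpDr.
rewrite /pow_family.
have d := is_derive1_powR (- s - m%:R) x0.
apply: is_derive_eq.
rewrite big_ord_recr /= /GRing.scale /= -natr1 opprD addrA.
ring.
Qed.

(** The backward sign convention makes every iterate nonnegative on
    completely monotone sequences. *)
Definition Dseq a : nat -> R := fun k => a k - a k.+1.

Definition cmseq a := forall j k, 0 <= iter j Dseq a k.

Lemma cm_family_seq f : cm_family f -> cmseq (fun k => f 0%N (k%:R + 1)).
Proof.
move=> + j; elim: j f => [|j IH] f cf k /=.
  by apply: ltW; have [] := cf 0%N (k%:R + 1) (ltr_wpDl (ler0n _ _) ltr01).
have := IH _ (cm_diff cf) k.
rewrite -iterS iterSr /=.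
rewrite (_ : Dseq _ = (fun k => f 0%N (k%:R + 1) - f 0%N (k%:R + 1 + 1)))//.
by apply/funext => i; rewrite /Dseq -natr1.
Qed.

Lemma cmseq_D a : cmseq a -> cmseq (Dseq a).
Proof. by move=> ca j k; rewrite -iterSr; exact: ca. Qed.

(** Summation by parts; the last term is the boundary contribution at 0,
    present only for j = 0. *)
Lemma Abel_weight (j : nat) b N :
  series (fun k => k.+1%:R ^+ j * Dseq b k) N =
  series (fun k => (k.+1%:R ^+ j - k%:R ^+ j) * b k) N - N%:R ^+ j * b N + 0 ^+ j * b 0%N.
Proof.
elim: N => [|N IH]; first by rewrite /series /= !big_geq// add0r addrC subrr.
rewrite !seriesSr IH /Dseq; ring.
Qed.

(** Summing by parts moves the weight from degree j + 1 on the (j + 2)-nd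
    difference to degree j on the (j + 1)-st one, and the boundary term has
    the favourable sign. So the decay of high differences comes for free
    from complete monotonicity. *)
Lemma cmseq_summable a : cmseq a ->
  forall j, cvgn (series (fun k => k.+1%:R ^+ j * iter j.+1 Dseq a k)).
Proof.
move=> ca; elim => [|j IH].
  apply: (@summable_bounded _ (a 0%N)) => [n|N].
    by rewrite expr0 mul1r; exact: ca.
  rewrite /= Abel_weight !expr0 !mul1r /series /= big1 ?sub0r.
    by rewrite gerDr oppr_le0; exact: (ca 0%N).
  by move=> i _; rewrite !expr0 subrr mul0r.
apply: (@summable_bounded _ (j.+1%:R * limn (series (fun k => k.+1%:R ^+ j * iter j.+1 Dseq a k)))) => [n|N].
  by rewrite mulr_ge0 ?exprn_ge0//; exact: ca.
rewrite iterS Abel_weight expr0n mul0r addr0.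
apply: le_trans (_ : series (fun k => (k.+1%:R ^+ j.+1 - k%:R ^+ j.+1) * iter j.+1 Dseq a k) N <= _).
  by rewrite gerBl mulr_ge0 ?exprn_ge0//; exact: ca.
apply: le_trans (_ : j.+1%:R * series (fun k => k.+1%:R ^+ j * iter j.+1 Dseq a k) N <= _); last first.
  rewrite ler_pM2l ?ltr0n//; apply: series_leB => // n.
  by rewrite mulr_ge0 ?exprn_ge0//; exact: ca.
rewrite /series /= mulr_sumr; apply: ler_sum => k _.
rewrite mulrA; apply: ler_wpM2r; first exact: (ca j.+1 k).
rewrite subrXX -natr1 addrAC subrr add0r mul1r.
have -> : j.+1%:R * (k%:R + 1) ^+ j = \sum_(i < j.+1) (k%:R + 1) ^+ j :> R.
  by rewrite sumr_const card_ord mulr_natl.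
apply: ler_sum => i _ /=.
have ij : (i <= j)%N by rewrite -ltnS.
rewrite -[X in _ <= _ ^+ X](subnK ij) exprD ler_wpM2l ?exprn_ge0 ?addr_ge0//.
by rewrite lerXn2r ?nnegrE ?addr_ge0// lerDl.
Qed.

(** The terms are dominated by the telescoping differences of x^(-t). *)
Lemma p_series (t : R) : 0 < t -> cvgn (series (fun k => k.+1%:R `^ (- 1 - t) : R)).
Proof.
move=> t0; apply: (@summable_bounded _ (1 + t^-1)) => [n|N]; first exact: powR_ge0.
have cf := pow_family_cm t0.
suff H : series (fun k => k.+1%:R `^ (- 1 - t)) N.+1 <= 1 + t^-1 * (1 - pow_family t 0 N.+1%:R).
  apply: le_trans (_ : series (fun k => k.+1%:R `^ (- 1 - t)) N.+1 <= _).
    by rewrite seriesSr lerDl powR_ge0.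
  apply: le_trans H _; rewrite lerD2l ler_piMr ?invr_ge0 ?(ltW t0)// gerBl.
  by apply: ltW; have [] := cf 0%N N.+1%:R (ltr0Sn _ _).
elim: N => [|N IH].
  rewrite seriesSr /series /= big_geq// add0r powR1 /pow_family big_ord0 powR1 mul1r.
  by rewrite subrr mulr0 addr0.
rewrite seriesSr; apply: le_trans (lerD IH (lexx _)) _.
rewrite -addrA lerD2l.
have [y /andP[Ny yN]] := cm_meanvalue 0 cf (ltr0Sn R N).
rewrite natr1 => E.
have y0 : 0 < y by apply: lt_trans Ny; exact: ltr0Sn.
have := cm_decr 1 cf y0 (ltW yN); rewrite natr1 -E {1}/pow_family big_ord_recl big_ord0 /= addr0 mulr1.
rewrite (_ : - t - 1 = - 1 - t); last by ring.
rewrite mulrC -ler_pdivlMr// mulrC => H; apply: le_trans (lerD (lexx _) H) _.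
by rewrite -mulrDr subrKA.
Qed.

End CompletelyMonotone.

(** * Functions of class C^n on an open set *)

Section SmoothClasses.
Set Implicit Arguments.
Unset Strict Implicit.
Context {R : realType}.
Implicit Types (f g h : R -> R) (A B : set R) (n : nat) (x y c : R).

Lemma is_derive_d1 f x l : is_derive x 1 f l -> (derive1 f) x = l.
Proof. by move=> d; rewrite derive1E; have [_] := d. Qed.

Lemma derivable_d1 f x : derivable f x 1 -> is_derive x 1 f ((derive1 f) x).
Proof. by move=> d; split => //; rewrite derive1E. Qed.

(** Defined by recursion on the derivative, so that regularity can be
    propagated one order at a time through an expression for the first
    derivative. *)
Fixpoint Cn n A f : Prop :=
  if n is n'.+1 then (forall x, A x -> derivable f x 1) /\ Cn n' A (derive1 f)
  else forall x, A x -> {for x, continuous f}.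

Lemma is_derive_near f g x l : (\forall y \near x, f y = g y) ->
  is_derive x 1 f l -> is_derive x 1 g l.
Proof. by move=> E d; apply: near_eq_is_derive d; rewrite ?oner_eq0//; near do apply/esym. Unshelve. all: by end_near. Qed.

(** Openness makes the class local, so equality on A carries over to all
    derivatives. *)
Lemma Cn_eq n A f g : open A -> (forall x, A x -> f x = g x) -> Cn n A f -> Cn n A g.
Proof.
move=> oA; have nA x : A x -> \forall y \near x, A y by move=> Ax; exact: open_nbhs_nbhs.
elim: n f g => [|n IH] f g E /=.
  move=> H x Ax; have := H x Ax; rewrite /prop_for /continuous_at -E// => Hx.
  apply: cvg_trans Hx.
  by apply: near_eq_cvg; near=> y; apply: E; near: y; exact: nA.
have D x : A x -> derivable f x 1 -> is_derive x 1 g ((derive1 f) x).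
  move=> Ax df; apply: is_derive_near (derivable_d1 df).
  by near=> y; apply: E; near: y; exact: nA.
move=> [df Cf]; split; first by move=> x Ax; have [] := D x Ax (df x Ax).
apply: IH Cf => x Ax; apply/esym/is_derive_d1; apply: D => //; exact: df.
Unshelve. all: by end_near. Qed.

(** The only way regularity is ever raised below: exhibit the derivative and
    control it. *)
Lemma Cn_S n A f g : open A -> (forall x, A x -> is_derive x 1 f (g x)) ->
  Cn n A g -> Cn n.+1 A f.
Proof.
move=> oA d Cg; split; first by move=> x /d [].
by apply: Cn_eq Cg => // x Ax; apply/esym/is_derive_d1; exact: d.
Qed.

Lemma Cn_sub n A B f : B `<=` A -> Cn n A f -> Cn n B f.
Proof.
move=> BA; elim: n f => [|n IH] f /=; first by move=> H x /BA; exact: H.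
by move=> [d C]; split; [move=> x /BA; exact: d|exact: IH].
Qed.

Lemma Cn_pred n A f : Cn n.+1 A f -> Cn n A f.
Proof.
elim: n f => [|n IH] f /=.
  by move=> [d _] x Ax; exact: is_derive_cont (derivable_d1 (d x Ax)).
by move=> [d C]; split => //; exact: IH.
Qed.

Lemma Cn_le m n A f : (m <= n)%N -> Cn n A f -> Cn m A f.
Proof.
elim: n => [|n IH]; first by rewrite leqn0 => /eqP ->.
rewrite leq_eqVlt => /predU1P[->//|mn] /Cn_pred; exact: IH.
Qed.

Lemma Cn_cont n A f x : Cn n A f -> A x -> {for x, continuous f}.
Proof. by move=> /(Cn_le (leq0n n)); exact. Qed.

Lemma Cn_cst n A c : open A -> Cn n A (fun=> c).
Proof.
elim: n c => [|n IH] c oA; first by move=> x _; exact: cvg_cst.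
by apply: (@Cn_S _ _ _ (fun=> 0)) => //; exact: IH.
Qed.

Lemma CnD n A f g : open A -> Cn n A f -> Cn n A g -> Cn n A (fun x => f x + g x).
Proof.
move=> oA; elim: n f g => [|n IH] f g.
  by move=> cf cg x Ax; apply: continuousD; [exact: cf|exact: cg].
move=> [df Cf] [dg Cg]; apply: (@Cn_S _ _ _ (fun x => (derive1 f) x + (derive1 g) x)) => //; last exact: IH.
move=> x Ax; have := derivable_d1 (df x Ax); have := derivable_d1 (dg x Ax) => d1 d2.
exact: is_deriveD.
Qed.

Lemma CnM n A f g : open A -> Cn n A f -> Cn n A g -> Cn n A (fun x => f x * g x).
Proof.
move=> oA; elim: n f g => [|n IH] f g.
  by move=> cf cg x Ax; apply: continuousM; [exact: cf|exact: cg].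
move=> Cf' Cg'; have := Cf'; have := Cg' => -[dg Cg] [df Cf].
apply: (@Cn_S _ _ _ (fun x => f x * (derive1 g) x + (derive1 f) x * g x)) => //.
  move=> x Ax; have := derivable_d1 (df x Ax); have := derivable_d1 (dg x Ax) => d1 d2.
  by apply: is_derive_eq; rewrite /GRing.scale /= [in X in _ + X]mulrC.
by apply: CnD => //; apply: IH => //; exact: Cn_pred.
Qed.

Lemma CnZ n A f c : open A -> Cn n A f -> Cn n A (fun x => c * f x).
Proof. by move=> oA Cf; apply: CnM => //; exact: Cn_cst. Qed.

Lemma CnB n A f g : open A -> Cn n A f -> Cn n A g -> Cn n A (fun x => f x - g x).
Proof.
move=> oA Cf Cg; apply: CnD => //; apply: (@Cn_eq _ _ (fun x => -1 * g x)) => //.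
  by move=> x _; rewrite mulN1r.
exact: CnZ.
Qed.

Lemma CnV n A f : open A -> (forall x, A x -> f x != 0) -> Cn n A f -> Cn n A (fun x => (f x)^-1).
Proof.
move=> oA f0; elim: n f f0 => [|n IH] f f0.
  by move=> cf x Ax; apply: cvgV; [exact: f0|exact: cf].
move=> Cf'; have := Cf' => -[df Cf].
apply: (@Cn_S _ _ _ (fun x => -1 * ((f x)^-1 * ((f x)^-1 * (derive1 f) x)))) => //.
  move=> x Ax; have d1 := derivable_d1 (df x Ax).
  apply: (is_derive_eq (is_deriveV (f0 x Ax) d1)).
  by rewrite /GRing.scale /= expr2 invfM; ring.
have Ci : Cn n A (fun x => (f x)^-1) by apply: IH => //; exact: Cn_pred.
by apply: CnZ => //; apply: CnM => //; apply: CnM.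
Qed.

Lemma Cn_shift n A B f c : open A -> open B -> (forall x, B x -> A (x - c)) ->
  Cn n A f -> Cn n B (fun x => f (x - c)).
Proof.
move=> oA oB BA; elim: n f => [|n IH] f.
  move=> cf x /BA Ax; apply: (@continuous_comp _ _ _ (fun x => x - c) f); last exact: cf.
  by apply: cvgB; [exact: cvg_id|exact: cvg_cst].
move=> [df Cf]; apply: (@Cn_S _ _ _ (fun x => (derive1 f) (x - c))) => //; last exact: IH.
move=> x /BA Ax; have d1 := derivable_d1 (df _ Ax).
have i : is_derive x 1 (fun x => x - c) 1.
  by apply: is_derive_eq; rewrite subr0.
by have := @is_derive1_comp _ f (fun x => x - c) x _ _ d1 i; rewrite mulr1.
Qed.

Lemma Cn_smooth A f : (forall n, Cn n A f) -> smooth_on A f.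
Proof.
move=> H n; elim: n f H => [|n IH] f H; first by move=> x; have [d _] := H 1%N; exact: d.
move=> x Ax; rewrite derive1Sn; apply: (IH _ _ x Ax) => k.
by have [] := H k.+1.
Qed.

End SmoothClasses.

(** * Trigonometric series with completely monotone coefficients *)

Section TrigSeries.
Set Implicit Arguments.
Unset Strict Implicit.
Context {R : realType}.
Implicit Types (a : nat -> R) (w z : R) (m n : nat).

(** The phase w lets one family cover cosine and sine series, since
    differentiating adds pi / 2 to it; the offset m absorbs the index shifts
    that multiplication by 2 - 2 cos z produces. *)
Definition trigS a m w z : R :=
  limn (series (fun k => a k * cos ((k + m)%:R * z + w))).

Lemma trigS_term_le a m w k z : `|a k * cos ((k + m)%:R * z + w)| <= `|a k|.
Proof. by rewrite normrM ler_piMr// cos_max. Qed.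

Lemma is_derive_cos_lin (p w z : R) :
  is_derive z 1 (fun z => cos (p * z + w)) (p * cos (p * z + (w + pi / 2))).
Proof.
have i : is_derive z 1 (fun z => p * z + w) p.
  by apply: is_derive_eq; rewrite addr0 /GRing.scale /= mulr1.
have := @is_derive1_comp _ cos (fun z => p * z + w) z _ _ (is_derive_cos _) i.
by rewrite addrA cosDpihalf mulrC.
Qed.

Lemma Cn_cos_lin n (p w : R) : Cn n setT (fun z => cos (p * z + w)).
Proof.
elim: n w => [|n IH] w.
  by move=> x _; exact: is_derive_cont (is_derive_cos_lin p w x).
apply: (@Cn_S _ _ _ _ (fun z => p * cos (p * z + (w + pi / 2)))).
- exact: openT.
- by move=> z _; exact: is_derive_cos_lin.
- by apply: CnZ; [exact: openT|exact: IH].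
Qed.

Lemma trigS_derive a m w z : cvgn (series (fun k => k.+1%:R * `|a k|)) ->
  is_derive z 1 (trigS a m w) (trigS (fun k => (k + m)%:R * a k) m (w + pi / 2) z).
Proof.
move=> ca.
apply: (@Mtest_derive _ (fun k z => a k * cos ((k + m)%:R * z + w))
  (fun k z => (k + m)%:R * a k * cos ((k + m)%:R * z + (w + pi / 2)))
  (fun k => m.+1%:R * (k.+1%:R * `|a k|))).
- move=> n y; have d := is_derive_cos_lin (n + m)%:R w y.
  by apply: is_derive_eq; rewrite /GRing.scale /=; ring.
- move=> n y; apply: le_trans (trigS_term_le (fun k => (k + m)%:R * a k) m _ n y) _.
  rewrite normrM normr_nat mulrA ler_wpM2r// -natrM ler_nat; nia.
- exact: (@is_cvg_seriesZ _ _ m.+1%:R ca).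
- move=> y; apply: (summable_le (trigS_term_le a m w ^~ y)).
  apply: (@series_le_cvg _ _ (fun k => k.+1%:R * `|a k|)) => // k.
  by rewrite ler_peMl// ler1n.
Qed.

Lemma trigS_Cn n a m w : cvgn (series (fun k => k.+1%:R ^+ n * `|a k|)) ->
  Cn n setT (trigS a m w).
Proof.
elim: n a w => [|n IH] a w ca.
  move=> x _; apply: (@Mtest_cont _ (fun k z => a k * cos ((k + m)%:R * z + w)) (fun k => `|a k|)).
  - move=> k; have d := is_derive_cos_lin (k + m)%:R w x.
    by apply: continuousM; [exact: cvg_cst|exact: is_derive_cont d].
  - by move=> k y; exact: trigS_term_le.
  - by move: ca; under eq_fun do rewrite expr0 mul1r.
apply: (@Cn_S _ _ _ _ (trigS (fun k => (k + m)%:R * a k) m (w + pi / 2))).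
- exact: openT.
- move=> x _; apply: trigS_derive.
  apply: series_le_cvg ca => k; rewrite ?mulr_ge0 ?exprn_ge0//.
  by rewrite ler_wpM2r// exprS ler_peMr// exprn_ege1// ler1n.
- apply: IH.
  apply: (@series_le_cvg _ _ (fun k => m.+1%:R * (k.+1%:R ^+ n.+1 * `|a k|))) => [k|k|k|].
  + by rewrite mulr_ge0 ?exprn_ge0.
  + by rewrite !mulr_ge0 ?exprn_ge0.
  + rewrite normrM normr_nat exprSr !mulrA ler_wpM2r//.
    rewrite [_ * _%:R ^+ _]mulrC -!mulrA ler_wpM2l ?exprn_ge0// -natrM ler_nat; nia.
  + exact: (@is_cvg_seriesZ _ _ m.+1%:R ca).
Qed.

Lemma cmseq_D2_le a k : cmseq a -> iter 2 Dseq a k <= a k.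
Proof.
move=> cma; have := cma 1%N k.+1; have := cma 0%N k.+1; rewrite /= /Dseq; lra.
Qed.

(** Multiplication by 2 - 2 cos z acts on the coefficients as minus the
    second difference; the first two coefficients leave a trigonometric
    polynomial. *)
Lemma trigS_rec a m w z : cmseq a -> cvgn (series (fun k => `|a k|)) ->
  (2 - 2 * cos z) * trigS a m.+1 w z =
  - trigS (iter 2 Dseq a) m.+2 w z +
  (a 0%N * (2 * cos (m.+1%:R * z + w) - cos (m%:R * z + w)) - a 1%N * cos (m.+1%:R * z + w)).
Proof.
move=> cma ca.
pose c k := cos (k%:R * z + w).
have crec k : 2 * cos z * c k.+1 = c k.+2 + c k.
  rewrite /c -[k.+2%:R]natr1 -[k.+1%:R]natr1.
  have -> : (k%:R + 1 + 1) * z + w = ((k%:R + 1) * z + w) + z by ring.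
  have -> : k%:R * z + w = ((k%:R + 1) * z + w) - z by ring.
  by move: ((k%:R + 1) * z + w) => t; rewrite cosD cosB; ring.
pose X n := - a n * (2 * c (n + m).+1 - c (n + m)%N) + a n.+1 * c (n + m).+1.
have E n : (2 - 2 * cos z) * series (fun k => a k * cos ((k + m.+1)%:R * z + w)) n =
   - series (fun k => iter 2 Dseq a k * cos ((k + m.+2)%:R * z + w)) n
   + (a 0%N * (2 * c m.+1 - c m) - a 1%N * c m.+1) + X n.
  elim: n => [|n IH].
    by rewrite /series /= !big_geq// /X add0n; ring.
  rewrite !seriesSr mulrDr IH /X /= /Dseq !addnS -!/(c _) !addSn.
  have -> : (2 - 2 * cos z) * (a n * c (n + m).+1) =
    a n * (2 * c (n + m).+1 - (c (n + m).+2 + c (n + m)%N)) by rewrite -crec; ring.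
  ring.
have a0 : a n @[n --> \oo] --> 0.
  have := cvg_series_cvg_0 ca; exact: norm_cvg0.
have a1 : a n.+1 @[n --> \oo] --> 0 by have := a0; rewrite -(cvg_shiftS a).
have X0 : X n @[n --> \oo] --> 0.
  apply: (@squeeze_cvgr _ _ _ _ (fun n => - (3 * `|a n| + `|a n.+1|)) (fun n => 3 * `|a n| + `|a n.+1|)).
  - near=> n; rewrite -ler_norml.
    apply: le_trans (ler_normD _ _) _; rewrite !normrM normrN mulrC.
    apply: lerD; last by rewrite ler_piMr// cos_max.
    rewrite ler_wpM2r//; apply: le_trans (ler_normB _ _) _.
    rewrite normrM normr_nat; have := @cos_max R ((n + m).+1%:R * z + w).
    have := @cos_max R ((n + m)%:R * z + w); rewrite -/(c _) -/(c _); lra.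
  - rewrite -oppr0; apply: cvgN; rewrite -[0]addr0 -{1}(mulr0 3); apply: cvgD.
      by apply: cvgM; [exact: cvg_cst|rewrite -(normr0 R); exact: cvg_norm].
    by rewrite -(normr0 R); exact: cvg_norm.
  - rewrite -[0]addr0 -{1}(mulr0 3); apply: cvgD.
      by apply: cvgM; [exact: cvg_cst|rewrite -(normr0 R); exact: cvg_norm].
    by rewrite -(normr0 R); exact: cvg_norm.
have cD : cvgn (series (fun k => `|iter 2 Dseq a k|)).
  apply: series_le_cvg ca => // k.
  rewrite !ger0_norm; [|exact: (cma 0%N)|exact: (cma 2%N)].
  exact: cmseq_D2_le.
have L1 : series (fun k => a k * cos ((k + m.+1)%:R * z + w)) n @[n --> \oo] --> trigS a m.+1 w z.
  exact: (summable_le (trigS_term_le a m.+1 w ^~ z) ca).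
have L2 : series (fun k => iter 2 Dseq a k * cos ((k + m.+2)%:R * z + w)) n @[n --> \oo] -->
     trigS (iter 2 Dseq a) m.+2 w z.
  exact: (summable_le (trigS_term_le (iter 2 Dseq a) m.+2 w ^~ z) cD).
have R1 : (2 - 2 * cos z) * series (fun k => a k * cos ((k + m.+1)%:R * z + w)) n @[n --> \oo]
   --> (2 - 2 * cos z) * trigS a m.+1 w z by apply: cvgM => //; exact: cvg_cst.
have R2 := cvgD (cvgD (cvgN L2) (cvg_cst (a 0%N * (2 * c m.+1 - c m) - a 1%N * c m.+1))) X0.
rewrite addr0 in R2; apply: cvg_unique R1 _ => //=.
by under eq_fun do rewrite E; exact: R2.
Unshelve. all: by end_near. Qed.

Definition cos_ne1 : set R := [set z | cos z != 1].

Lemma open_cos_ne1 : open cos_ne1.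
Proof.
rewrite (_ : cos_ne1 = (@cos R) @^-1` [set x | x != 1]); last by [].
apply: open_comp; first by move=> x _; exact: continuous_cos.
exact: open_neq.
Qed.

(** Dividing the previous recursion by 2 - 2 cos z, which is nonzero here,
    trades the coefficients for their second differences. After enough steps
    the weighted summability of high differences makes the series C^n on the
    whole line. *)
Lemma trigS_off a m w n : cmseq a -> cvgn (series (fun k => `|a k|)) ->
  Cn n cos_ne1 (trigS a m.+1 w).
Proof.
have oA := open_cos_ne1.
suff H j : forall a m, cmseq a -> cvgn (series (fun k => `|a k|)) ->
    cvgn (series (fun k => k.+1%:R ^+ n * `|iter j.*2 Dseq a k|)) ->
    Cn n cos_ne1 (trigS a m.+1 w).
  move=> cma ca; apply: (H n.+1) => //.
  apply: series_le_cvg (@cmseq_summable _ a cma n.*2.+1) => k.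
  - by rewrite mulr_ge0 ?exprn_ge0.
  - by rewrite mulr_ge0 ?exprn_ge0//; exact: cma.
  - rewrite doubleS ger0_norm; last exact: cma.
    apply: ler_wpM2r; first exact: (cma n.*2.+2).
    by rewrite ler_weXn2l ?ler1n// -addnn; lia.
elim: j => [|j IH] {}a {}m cma ca cn.
  by apply: (@Cn_sub _ _ setT) => //; exact: trigS_Cn.
pose c k z := cos (k%:R * z + w).
have Cc k : Cn n cos_ne1 (c k).
  by apply: (@Cn_sub _ _ setT) => //; exact: Cn_cos_lin.
have nz z : cos_ne1 z -> 2 - 2 * cos z != 0.
  by move=> /= z1; apply/eqP => h; move/eqP: z1; apply; lra.
pose g z := (2 - 2 * cos z)^-1 * (-1 * trigS (iter 2 Dseq a) m.+2 w z +
  (a 0%N * (2 * c m.+1 z - c m z) - a 1%N * c m.+1 z)).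
apply: (@Cn_eq _ _ _ g) => //.
  move=> z z1; rewrite /g mulN1r -trigS_rec// mulrA mulVf ?mul1r//; exact: nz.
have ccos : Cn n cos_ne1 (fun z : R => 2 - 2 * cos z).
  apply: CnB => //; first exact: Cn_cst.
  apply: CnZ => //; apply: (@Cn_sub _ _ setT) => //.
  apply: Cn_eq (Cn_cos_lin n 1 0); first exact: openT.
  by move=> z _; rewrite mul1r addr0.
apply: CnM => //.
  exact: CnV.
apply: CnD => //.
  apply: CnZ => //; apply: IH.
  - by apply: cmseq_D; exact: cmseq_D.
  - apply: series_le_cvg ca => // k.
    rewrite !ger0_norm; [|exact: (cma 0%N)|exact: (cma 2%N)].
    exact: cmseq_D2_le.
  - by move: cn; rewrite doubleS -[j.*2.+2]addn2 iterD.
apply: CnB => //; apply: CnZ => //.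
by apply: CnB => //; exact: CnZ.
Qed.

End TrigSeries.

(** * Conjugate Fejer kernels *)

Section Fejer.
Set Implicit Arguments.
Unset Strict Implicit.
Context {R : realType}.
Implicit Types (x y z t : R) (n k m : nat).

Lemma cos_half z : 2 - 2 * cos z = 4 * sin (z / 2) ^+ 2.
Proof.
have -> : cos z = cos (z / 2 *+ 2) by congr cos; lra.
rewrite cos_mulr2n; have := cos2Dsin2 (z / 2) => E.
have -> : sin (z / 2) ^+ 2 = 1 - cos (z / 2) ^+ 2 by move: E; lra.
ring.
Qed.

Lemma sin_half z : sin z = 2 * (sin (z / 2) * cos (z / 2)).
Proof.
have -> : sin z = sin (z / 2 *+ 2) by congr sin; lra.
by rewrite sin_mulr2n; ring.
Qed.

Lemma sin_nat_le n z : `|sin (n%:R * z)| <= n%:R * `|sin z|.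
Proof.
elim: n => [|n IH]; first by rewrite mul0r sin0 normr0 mul0r.
rewrite -natr1 mulrDl mul1r sinD; apply: le_trans (ler_normD _ _) _.
rewrite mulrDl mul1r !normrM; apply: lerD.
  by apply: le_trans IH; rewrite ler_piMr// cos_max.
by rewrite ler_piMl// cos_max.
Qed.

Lemma sin_rec k z : 2 * cos z * sin (k.+1%:R * z) = sin (k.+2%:R * z) + sin (k%:R * z).
Proof.
rewrite -[k.+2%:R]natr1 -[k.+1%:R]natr1.
have -> : (k%:R + 1 + 1) * z = ((k%:R + 1) * z) + z by ring.
have -> : k%:R * z = ((k%:R + 1) * z) - z by ring.
by move: ((k%:R + 1) * z) => t; rewrite sinD sinB; ring.
Qed.

(** Cesaro-type double sums of sin(j z): up to normalisation, the conjugate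
    Fejer kernels. *)
Definition cfejer n z : R := \sum_(k < n.+1) \sum_(j < k.+1) sin (j.+1%:R * z).

(** Minus a primitive of the conjugate Fejer kernel. These are the functions
    multiplying the second differences when the series of the kernel is
    summed by parts twice. *)
Definition fejer_prim n z : R :=
  \sum_(k < n.+1) \sum_(j < k.+1) cos (j.+1%:R * z) / j.+1%:R.

Lemma cfejerS n z : cfejer n.+1 z = cfejer n z + \sum_(j < n.+2) sin (j.+1%:R * z).
Proof. by rewrite /cfejer big_ord_recr. Qed.

Lemma is_derive_fejer_prim n z : is_derive z 1 (fejer_prim n) (- cfejer n z).
Proof.
rewrite (_ : fejer_prim n = \sum_(k < n.+1) \sum_(j < k.+1) (fun z => cos (j.+1%:R * z) / j.+1%:R)); last first.
  by apply/funext => y; rewrite fct_sumE; apply: eq_bigr => k _; rewrite fct_sumE.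
rewrite /cfejer -sumrN; apply: is_derive_sum => k; rewrite -sumrN; apply: is_derive_sum => j.
have i : is_derive z 1 (fun z => j.+1%:R * z) j.+1%:R.
  by apply: is_derive_eq; rewrite /GRing.scale /= mulr1.
have d := @is_derive1_comp _ cos (fun z => j.+1%:R * z) z _ _ (is_derive_cos _) i.
by apply: is_derive_eq; rewrite /GRing.scale /=; field.
Qed.

(** The closed form that makes the sign and the size of the kernel visible. *)
Lemma cfejerE n z : (2 - 2 * cos z) * cfejer n z = n.+2%:R * sin z - sin (n.+2%:R * z).
Proof.
have inner k : (2 - 2 * cos z) * (\sum_(j < k.+1) sin (j.+1%:R * z)) =
    sin z + sin (k.+1%:R * z) - sin (k.+2%:R * z).
  elim: k => [|k IH].
    rewrite big_ord_recr big_ord0 /= add0r mul1r.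
    have := sin_rec 0 z; rewrite mul0r sin0 !mul1r addr0 => <-; ring.
  rewrite big_ord_recr /= mulrDr IH; have := sin_rec k.+1 z => E.
  have -> : (2 - 2 * cos z) * sin (k.+2%:R * z) = 2 * sin (k.+2%:R * z) - (2 * cos z * sin (k.+2%:R * z)) by ring.
  by rewrite E; ring.
elim: n => [|n IH].
  rewrite /cfejer big_ord_recr big_ord0 /= add0r inner [1%:R * z]mul1r; ring.
have -> : n.+3%:R * sin z = n.+2%:R * sin z + sin z by rewrite -natr1 mulrDl mul1r.
by rewrite cfejerS mulrDr IH inner; ring.
Qed.

Lemma cfejer_sin n z : `|cfejer n z| * `|sin (z / 2)| <= n.+2%:R.
Proof.
have [->|q0] := eqVneq (sin (z / 2)) 0; first by rewrite normr0 mulr0.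
set q := `|sin (z / 2)|; have q1 : 0 < q by rewrite normr_gt0.
have H : (4 * q ^+ 2) * `|cfejer n z| <= 4 * n.+2%:R * q.
  have -> : 4 * q ^+ 2 = `|2 - 2 * cos z|.
    by rewrite cos_half normrM normrX ger0_norm.
  rewrite -normrM cfejerE; apply: le_trans (ler_normB _ _) _.
  rewrite normrM normr_nat.
  have H1 := sin_nat_le n.+2 z.
  have H2 : `|sin z| <= 2 * q.
    by rewrite sin_half !normrM normr_nat ler_pM2l// ler_piMr// cos_max.
  have H3 : n.+2%:R * `|sin z| <= n.+2%:R * (2 * q) by rewrite ler_wpM2l.
  by move: H1 H3; move: (n.+2%:R * `|sin z|) => A; lra.
have : (4 * q) * (`|cfejer n z| * q) <= (4 * q) * n.+2%:R.
  have -> : 4 * q * (`|cfejer n z| * q) = 4 * q ^+ 2 * `|cfejer n z| by ring.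
  by have -> : 4 * q * n.+2%:R = 4 * n.+2%:R * q by ring.
by rewrite ler_pM2l// mulr_gt0.
Qed.

Lemma cfejer_sq n z : `|cfejer n z| <= n.+2%:R ^+ 2.
Proof.
rewrite /cfejer; apply: le_trans (ler_norm_sum _ _ _) _.
apply: le_trans (_ : \sum_(k < n.+1) n.+2%:R <= _); last first.
  rewrite sumr_const card_ord -mulrnA -natrX ler_nat; nia.
apply: ler_sum => k _; apply: le_trans (ler_norm_sum _ _ _) _.
apply: le_trans (_ : \sum_(j < k.+1) 1 <= _).
  by apply: ler_sum => j _; exact: sin_max.
by rewrite sumr_const card_ord ler_nat; have := ltn_ord k; lia.
Qed.

(** By the closed form, this is the inequality |sin(n z)| <= n |sin z|. *)
Lemma cfejer_ge0 n z : 0 <= z <= pi -> 0 <= cfejer n z.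
Proof.
move=> zpi; have s0 := sin_ge0_pi zpi.
have [z0|z0] := eqVneq z 0.
  by rewrite z0 /cfejer big1// => k _; rewrite big1// => j _; rewrite mulr0 sin0.
have q0 : 0 < sin (z / 2).
  move/andP: zpi => [h1 h2]; have p0 := @pi_gt0 R.
  have z1 : 0 < z by rewrite lt_neqAle eq_sym z0.
  by apply: sin_gt0_pi; apply/andP; split; lra.
have : 0 <= (2 - 2 * cos z) * cfejer n z.
  by rewrite cfejerE subr_ge0; apply: le_trans (ler_norm _) _;
    apply: le_trans (sin_nat_le _ _) _; rewrite ger0_norm.
by rewrite cos_half pmulr_rge0// mulr_gt0// exprn_gt0.
Qed.

Lemma cfejer_odd n z : cfejer n (- z) = - cfejer n z.
Proof.
rewrite /cfejer -sumrN; apply: eq_bigr => k _; rewrite -sumrN; apply: eq_bigr => j _.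
by rewrite mulrN sinN.
Qed.

Lemma trig_per_nat n z : cos (n%:R * (z + 2 * pi)) = cos (n%:R * z) /\
  sin (n%:R * (z + 2 * pi)) = sin (n%:R * z).
Proof.
have -> : n%:R * (z + 2 * pi) = n%:R * z + (pi *+ 2) *+ n.
  by rewrite mulrDr -[(pi *+ 2) *+ n]mulr_natl mulr2n; ring.
by rewrite (periodicn (@cosD2pi R)) (periodicn (@sinD2pi R)).
Qed.

Lemma cfejer_per n z : cfejer n (z + 2 * pi) = cfejer n z.
Proof.
apply: eq_bigr => k _; apply: eq_bigr => j _.
by have [_ ->] := trig_per_nat j.+1 z.
Qed.

Lemma cfejer_cont n : continuous (cfejer n).
Proof.
have c1 (p : R) z : {for z, continuous (fun z => sin (p * z))}.
  apply: (@continuous_comp _ _ _ (fun z => p * z) sin); last exact: continuous_sin.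
  by apply: cvgM; [exact: cvg_cst|exact: cvg_id].
move=> z; rewrite /cfejer.
have c2 k : {for z, continuous (fun z => \sum_(j < k.+1) sin (j.+1%:R * z))}.
  elim: k => [|k IH].
    rewrite (_ : (fun z => _) = (fun z => sin (1%:R * z))); first exact: c1.
    by apply/funext => y; rewrite big_ord_recr big_ord0 /= add0r.
  rewrite (_ : (fun z => _) = (fun z => \sum_(j < k.+1) sin (j.+1%:R * z) + sin (k.+2%:R * z))).
    by apply: continuousD; [exact: IH|exact: c1].
  by apply/funext => y; rewrite big_ord_recr.
elim: n => [|n IH].
  rewrite (_ : (fun z => _) = (fun z => \sum_(j < 1) sin (j.+1%:R * z))); first exact: c2.
  by apply/funext => y; rewrite big_ord_recr big_ord0 /= add0r.
rewrite (_ : (fun z => _) = (fun z => cfejer n z + \sum_(j < n.+2) sin (j.+1%:R * z))).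
  by apply: continuousD; [exact: IH|exact: c2].
by apply/funext => y; rewrite -cfejerS.
Qed.

Section Theta.
Variables (th : R) (th0 : 0 < th) (th1 : th < 1).

Definition pseries : R := limn (series (fun k => k.+1%:R `^ (- 1 - th))).

(** A power bound replaces the logarithm: 1 / j <= n^th j^(- 1 - th) for j
    <= n. *)
Lemma harmonic_le n : \sum_(j < n.+1) (j.+1%:R)^-1 <= pseries * n.+1%:R `^ th.
Proof.
have H := series_leB (fun k => powR_ge0 _ _) (p_series th0) n.+1.
apply: le_trans (_ : series (fun k => k.+1%:R `^ (- 1 - th)) n.+1 * n.+1%:R `^ th <= _); last first.
  by rewrite ler_wpM2r ?powR_ge0.
rewrite /series /= big_mkord mulr_suml; apply: ler_sum => j _.
rewrite powRD; last by rewrite pnatr_eq0 implybT.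
rewrite powR_inv1// powRN -mulrA ler_peMr ?invr_ge0// ler_pdivlMl ?mulr1.
  by apply: (ge0_ler_powR (ltW th0)); rewrite ?nnegrE// ler_nat; have := ltn_ord j; lia.
by rewrite powR_gt0.
Qed.

Lemma pseries_ge0 : 0 <= pseries.
Proof.
by apply: limr_ge; [exact: p_series|near=> n; apply: sumr_ge0 => i _; exact: powR_ge0].
Unshelve. all: by end_near. Qed.

Lemma cos_sum_le n z : `|\sum_(j < n.+1) cos (j.+1%:R * z) / j.+1%:R| <= pseries * n.+1%:R `^ th.
Proof.
apply: le_trans (harmonic_le n); apply: le_trans (ler_norm_sum _ _ _) _.
apply: ler_sum => j _; rewrite normrM normfV normr_nat ler_piMl ?invr_ge0//.
exact: cos_max.
Qed.

Lemma fejer_prim_le n z : `|fejer_prim n z| <= pseries * n.+1%:R `^ (1 + th).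
Proof.
rewrite powRD; last by rewrite pnatr_eq0 implybT.
rewrite powRr1// mulrCA; apply: le_trans (ler_norm_sum _ _ _) _.
apply: le_trans (_ : \sum_(k < n.+1) pseries * n.+1%:R `^ th <= _); last first.
  by rewrite sumr_const card_ord mulr_natl.
apply: ler_sum => k _; apply: le_trans (cos_sum_le k z) _.
rewrite ler_wpM2l ?pseries_ge0//.
by apply: (ge0_ler_powR (ltW th0)); rewrite ?nnegrE// ler_nat; have := ltn_ord k; lia.
Qed.

(** The two bounds n / |sin(z / 2)| and n^2 are interpolated geometrically.
    The exponent 1 + th keeps the sum against the second differences finite,
    and the power th - 1 of the distance to the singularity stays
    integrable. *)
Lemma cfejer_interp n z (q : R) : 0 < q -> q <= `|sin (z / 2)| ->
  `|cfejer n z| <= 4 * n.+1%:R `^ (1 + th) * q `^ (th - 1).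
Proof.
move=> q0 qs.
set X := `|cfejer n z|; have X0 : 0 <= X by exact: normr_ge0.
have A1 : X <= n.+2%:R / q.
  rewrite ler_pdivlMr//; apply: le_trans (cfejer_sin n z).
  exact: ler_wpM2l.
have A2 := cfejer_sq n z; rewrite -/X in A2.
(* geometric interpolation between A1 and A2 *)
have -> : X = X `^ (1 - th) * X `^ th.
  rewrite -powRD ?subrK ?powRr1//.
  by rewrite oner_eq0.
apply: le_trans (_ : (n.+2%:R / q) `^ (1 - th) * (n.+2%:R ^+ 2) `^ th <= _).
  apply: ler_pM; rewrite ?powR_ge0//.
    apply: (@ge0_ler_powR R (1 - th)) => //; first by rewrite subr_ge0 ltW.
    by rewrite nnegrE divr_ge0// ltW.
  by apply: (ge0_ler_powR (ltW th0)); rewrite ?nnegrE.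
rewrite powRM ?invr_ge0 ?(ltW q0)// -(powR_inv1 (ltW q0)) -powRrM.
rewrite -powR_mulrn// -powRrM mulrAC -powRD; last by rewrite pnatr_eq0 implybT.
rewrite mulN1r opprB ler_wpM2r ?powR_ge0//.
have -> : 1 - th + 2%:R * th = 1 + th by ring.
apply: le_trans (_ : (2 * n.+1%:R) `^ (1 + th) <= _).
  apply: ge0_ler_powR; rewrite ?nnegrE//; first by rewrite addr_ge0// ltW.
  by rewrite -natrM ler_nat; lia.
rewrite powRM// ler_wpM2r ?powR_ge0//.
have -> : 4 = 2 `^ 2%:R :> R by rewrite powR_mulrn// expr2 -natrM.
apply: ler_powR; first by rewrite ler1n.
move: th1; lra.
Qed.

End Theta.
End Fejer.

(** * The convolution kernel of L_r *)

Section Kernel.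
Set Implicit Arguments.
Unset Strict Implicit.
Context {R : realType}.
Implicit Types (x y z t : R) (n k m : nat).

Lemma eq_ler x y : x = y -> x <= y.
Proof. by move=> ->. Qed.

Lemma eq_lim_series (f g : nat -> R) : f =1 g -> limn (series f) = limn (series g).
Proof. by move=> /funext ->. Qed.

(** The coefficient (k + 1)^(-s); indices are shifted so that sums start at
    0. *)
Definition pow_coef (s : R) (k : nat) : R := k.+1%:R `^ (- s).

Lemma pow_coefE (s : R) : pow_coef s = (fun k => pow_family s 0 (k%:R + 1)).
Proof.
by apply/funext => k; rewrite /pow_coef /pow_family big_ord0 mul1r subr0 natr1.
Qed.

Lemma pow_coef_cm (s : R) : 0 < s -> cmseq (pow_coef s).
Proof. by move=> s0; rewrite pow_coefE; apply: cm_family_seq; exact: pow_family_cm. Qed.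

Lemma pow_coef_summable (s : R) : 1 < s -> cvgn (series (fun k => `|pow_coef s k|)).
Proof.
move=> s1; have h : 0 < s - 1 by lra.
apply: series_le_cvg (p_series h) => k //.
by rewrite ger0_norm ?powR_ge0// /pow_coef (_ : - 1 - (s - 1) = - s)//; ring.
Qed.

Lemma powRN_cvg0 t : 0 < t -> k.+1%:R `^ (- t) @[k --> \oo] --> (0 : R).
Proof.
move=> t0; apply/cvgrPdist_le => /= e e0.
near=> k.
rewrite sub0r normrN ger0_norm ?powR_ge0// powRN.
rewrite -[e]invrK lef_pV2 ?posrE ?invr_gt0 ?powR_gt0//.
have -> : e^-1 = (e^-1 `^ t^-1) `^ t.
  by rewrite -powRrM mulVf ?gt_eqF// powRr1// invr_ge0 ltW.
apply: (ge0_ler_powR (ltW t0)); rewrite ?nnegrE ?powR_ge0//.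
apply: le_trans (_ : k%:R <= _); last by rewrite ler_nat.
near: k; exact: nbhs_infty_ger.
Unshelve. all: by end_near. Qed.

(** Second differences of (k + 1)^(-s); for s = r - 1 they are the positive
    weights in the expansion of the kernel. *)
Definition dcoef (s : R) : nat -> R := iter 2 Dseq (pow_coef s).

Lemma dcoef_gt0 (s : R) k : 0 < s -> 0 < dcoef s k.
Proof.
move=> s0; have k1 : 0 < k%:R + 1 :> R by rewrite natr1.
have [y xy E] := cm_diff2 (pow_family_cm s0) k1.
have [h _] := pow_family_cm s0 2 (lt_trans k1 xy).
by rewrite /dcoef pow_coefE /= /Dseq -!natr1 E.
Qed.

Lemma dcoef_le (s : R) k : 0 < s -> dcoef s k <= s * (s + 1) * k.+1%:R `^ (- s - 2).
Proof.
move=> s0; have k1 : 0 < k%:R + 1 :> R by rewrite natr1.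
have [y xy E] := cm_diff2 (pow_family_cm s0) k1.
have := cm_decr 2 (pow_family_cm s0) k1 (ltW xy).
rewrite /dcoef pow_coefE /= /Dseq -![in X in _ -> X <= _]natr1 E => /le_trans; apply.
by rewrite /pow_family !big_ord_recr big_ord0 /= mul1r addr0 natr1.
Qed.

Lemma pow_coef_D_le (s : R) k : 0 < s -> Dseq (pow_coef s) k <= s * k.+1%:R `^ (- s - 1).
Proof.
move=> s0; have k1 : 0 < k%:R + 1 :> R by rewrite natr1.
have [y /andP[xy _] E] := cm_meanvalue 0 (pow_family_cm s0) k1.
have := cm_decr 1 (pow_family_cm s0) k1 (ltW xy).
rewrite pow_coefE /Dseq -![in X in _ -> X <= _]natr1 E => /le_trans; apply.
by rewrite /pow_family !big_ord_recr big_ord0 /= mul1r addr0 natr1.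
Qed.

Variables (r th : R).
Hypotheses (hr : 1 < r) (th0 : 0 < th) (th1 : th < 1) (thr : th < r - 1).
Let s := r - 1.
Let s0 : 0 < s. Proof. by rewrite /s subr_gt0. Qed.

(** The kernel K(z) = (1 / pi) sum_(k >= 1) k^(-r) cos(k z) of L_r. *)
Definition Lkernel z : R := pi^-1 * trigS (pow_coef r) 1 0 z.
(** The primitive (1 / pi) sum_(k >= 1) k^(-r-1) sin(k z) of the kernel, the
    sine being written as a shifted cosine. *)
Definition Lkernel_prim z : R := pi^-1 * trigS (pow_coef (r + 1)) 1 (- (pi / 2)) z.

Lemma pi_inv_gt0 : 0 < pi^-1 :> R. Proof. by rewrite invr_gt0 pi_gt0. Qed.

Lemma Lkernel_even z : Lkernel (- z) = Lkernel z.
Proof.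
congr (_ * _); apply: eq_lim_series => k.
by rewrite mulrN !addr0 cosN.
Qed.

Lemma trigS_per a m w z : trigS a m w (z + 2 * pi) = trigS a m w z.
Proof.
apply: eq_lim_series => k.
by rewrite !cosD; have [-> ->] := @trig_per_nat R (k + m) z.
Qed.

Lemma Lkernel_per z : Lkernel (z + 2 * pi) = Lkernel z.
Proof. by rewrite /Lkernel trigS_per. Qed.

Lemma Lkernel_prim_per z : Lkernel_prim (z + 2 * pi) = Lkernel_prim z.
Proof. by rewrite /Lkernel_prim trigS_per. Qed.

Lemma pow_coef_mul (t : R) k : k.+1%:R * pow_coef (t + 1) k = pow_coef t k.
Proof.
rewrite /pow_coef opprD powRD ?pnatr_eq0 ?implybT// powR_inv1// mulrCA mulfV ?mulr1//.
Qed.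

Lemma Lkernel_prim_derive z : is_derive z 1 Lkernel_prim (Lkernel z).
Proof.
have c : cvgn (series (fun k => k.+1%:R * `|pow_coef (r + 1) k|)).
  rewrite (_ : (fun k => _) = (fun k => `|pow_coef r k|)); first exact: pow_coef_summable.
  by apply/funext => k; rewrite -[X in X * _]normr_nat -normrM pow_coef_mul.
have d := @trigS_derive R _ 1 (- (pi / 2)) z c.
apply: is_derive_eq; rewrite /Lkernel /GRing.scale /=; congr (_ * _).
by apply: eq_lim_series => k; rewrite addNr addn1 pow_coef_mul.
Qed.

Lemma Lkernel_cont : continuous Lkernel.
Proof.
have c : cvgn (series (fun k => k.+1%:R ^+ 0 * `|pow_coef r k|)).
  by under eq_fun do rewrite expr0 mul1r; exact: pow_coef_summable.
have C0 : Cn 0 setT Lkernel by apply: CnZ; [exact: openT|exact: trigS_Cn].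
by move=> z; exact: C0.
Qed.

Lemma Lkernel_off n : Cn n cos_ne1 Lkernel.
Proof.
apply: CnZ; first exact: open_cos_ne1.
by apply: trigS_off; [apply: pow_coef_cm; exact: lt_trans hr|exact: pow_coef_summable].
Qed.

(** Two summations by parts, with both boundary terms kept. *)
Lemma Abel_twice (a f : nat -> R) n :
  \sum_(k < n.+1) a k * f k =
  \sum_(k < n.+1) iter 2 Dseq a k * (\sum_(i < k.+1) \sum_(j < i.+1) f j)
  + Dseq a n.+1 * (\sum_(i < n.+1) \sum_(j < i.+1) f j)
  + a n.+1 * (\sum_(j < n.+1) f j).
Proof.
pose S1 n := \sum_(j < n.+1) f j; pose S2 n := \sum_(i < n.+1) S1 i.
have S1S i : S1 i.+1 = S1 i + f i.+1 by rewrite /S1 big_ord_recr.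
have S2S i : S2 i.+1 = S2 i + S1 i.+1 by rewrite /S2 big_ord_recr.
rewrite -/(S1 n) -/(S2 n).
under [X in _ = X + _ + _]eq_bigr => k _ do rewrite -/(S2 k).
elim: n => [|n IH].
  by rewrite !big_ord1 /S2 /S1 !big_ord1 /= /Dseq; ring.
rewrite big_ord_recr IH [in RHS]big_ord_recr /= S2S S1S /Dseq; ring.
Qed.

Lemma powR_nat_D n (p q : R) : n.+1%:R `^ (p + q) = n.+1%:R `^ p * n.+1%:R `^ q.
Proof. by rewrite powRD// pnatr_eq0 implybT. Qed.

Lemma dcoef_summable : cvgn (series (fun n => dcoef s n * n.+1%:R `^ (1 + th))).
Proof.
have h : 0 < s - th by rewrite subr_gt0.
apply: (@series_le_cvg _ _ (fun n => s * (s + 1) * n.+1%:R `^ (- 1 - (s - th)))) => [k|k|k|].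
- by rewrite mulr_ge0 ?powR_ge0// ltW// dcoef_gt0.
- by rewrite mulr_ge0 ?powR_ge0// mulr_ge0//; move: s0; lra.
- have -> : - 1 - (s - th) = (- s - 2) + (1 + th) by ring.
  by rewrite (powR_nat_D _ (- s - 2)) mulrA ler_wpM2r ?powR_ge0// dcoef_le.
- exact: (@is_cvg_seriesZ _ _ _ (p_series h)).
Qed.

Lemma dcoef_fejer_le n z : `|dcoef s n * fejer_prim n z| <=
  pseries th * (dcoef s n * n.+1%:R `^ (1 + th)).
Proof.
rewrite normrM gtr0_norm ?dcoef_gt0// mulrCA ler_pM2l ?dcoef_gt0//.
exact: fejer_prim_le.
Qed.

Lemma dcoef_fejer_cvg z : cvgn (series (fun n => dcoef s n * fejer_prim n z)).
Proof.
apply: (summable_le (dcoef_fejer_le ^~ z)).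
exact: (@is_cvg_seriesZ _ _ _ dcoef_summable).
Qed.

(** Write k^(-r) cos(k z) as k^(1 - r) times cos(k z) / k and sum by parts
    twice. The boundary terms are O(n^(th - (r - 1))), which tends to 0
    because th < r - 1. *)
Lemma Lkernel_fejer z : Lkernel z = pi^-1 * limn (series (fun n => dcoef s n * fejer_prim n z)).
Proof.
congr (_ * _).
pose f j : R := cos (j.+1%:R * z) / j.+1%:R.
have E n : series (fun k => pow_coef r k * cos ((k + 1)%:R * z + 0)) n.+1 =
   series (fun n => dcoef s n * fejer_prim n z) n.+1 +
   (Dseq (pow_coef s) n.+1 * fejer_prim n z + pow_coef s n.+1 * \sum_(j < n.+1) f j).
  rewrite addrA /series /= !big_mkord -Abel_twice; apply: eq_bigr => k _.
  have -> : pow_coef r k = pow_coef s k / k.+1%:R.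
    by rewrite -[pow_coef s k]pow_coef_mul subrK mulrC mulKf// pnatr_eq0.
  by rewrite addr0 addn1 /f mulrAC mulrA.
pose W n : R := pseries th * (s + 1) * n.+1%:R `^ (- (s - th)).
have bd n : `|Dseq (pow_coef s) n.+1 * fejer_prim n z + pow_coef s n.+1 * \sum_(j < n.+1) f j| <= W n.
  apply: le_trans (ler_normD _ _) _.
  have P0 := pseries_ge0 th0.
  have D0 : 0 <= Dseq (pow_coef s) n.+1 := pow_coef_cm s0 1 n.+1.
  have nn (p : R) : 0 <= p -> n.+2%:R `^ (- p) <= n.+1%:R `^ (- p) :> R.
    move=> p0; rewrite !powRN lef_pV2 ?posrE ?powR_gt0//.
    by apply: (ge0_ler_powR p0); rewrite ?nnegrE// ler_nat.
  have H1 : `|Dseq (pow_coef s) n.+1 * fejer_prim n z| <= pseries th * s * n.+1%:R `^ (- (s - th)).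
    rewrite normrM [`|Dseq _ _|]ger0_norm//.
    apply: le_trans (ler_pM D0 (normr_ge0 _) (pow_coef_D_le _ s0) (fejer_prim_le th0 th1 _ _)) _.
    have -> : - (s - th) = - (s + 1) + (1 + th) by ring.
    rewrite (powR_nat_D _ (- (s + 1))) mulrACA [s * pseries th]mulrC ler_wpM2l ?mulr_ge0 ?(ltW s0)//.
    rewrite ler_wpM2r ?powR_ge0// (_ : - s - 1 = - (s + 1)); last by ring.
    by apply: nn; rewrite addr_ge0// ltW.
  have H2 : `|pow_coef s n.+1 * \sum_(j < n.+1) f j| <= pseries th * n.+1%:R `^ (- (s - th)).
    rewrite normrM [`|pow_coef _ _|]ger0_norm ?powR_ge0//.
    apply: le_trans (ler_pM (powR_ge0 _ _) (normr_ge0 _) (nn _ (ltW s0)) (cos_sum_le th0 th1 _ _)) _.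
    by rewrite mulrCA -powR_nat_D (_ : - (s - th) = - s + th)//; ring.
  apply: le_trans (lerD H1 H2) _.
  by apply: eq_ler; rewrite /W; ring.
have W0 : W n @[n --> \oo] --> 0.
  rewrite -[0](mulr0 (pseries th * (s + 1))); apply: cvgM; first exact: cvg_cst.
  by apply: powRN_cvg0; rewrite subr_gt0.
have L1 : cvgn (series (fun k => pow_coef r k * cos ((k + 1)%:R * z + 0))).
  by apply: (summable_le (trigS_term_le (pow_coef r) 1 0 ^~ z)); exact: pow_coef_summable.
have B0 : (Dseq (pow_coef s) n.+1 * fejer_prim n z + pow_coef s n.+1 * \sum_(j < n.+1) f j) @[n --> \oo] --> 0.
  apply: (@squeeze_cvgr _ _ _ _ (fun n => - W n) W) => //.
    by near=> n; rewrite -ler_norml.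
  by rewrite -oppr0; exact: cvgN.
have R1 : series (fun k => pow_coef r k * cos ((k + 1)%:R * z + 0)) n.+1 @[n --> \oo]
   --> trigS (pow_coef r) 1 0 z by rewrite (cvg_shiftS (series _)).
have R2 : series (fun n => dcoef s n * fejer_prim n z) n.+1 @[n --> \oo]
   --> limn (series (fun n => dcoef s n * fejer_prim n z)).
  by rewrite (cvg_shiftS (series _)); exact: dcoef_fejer_cvg.
have R3 := cvgD R2 B0; rewrite addr0 in R3.
apply: cvg_unique R1 _ => //=.
by under eq_fun do rewrite E; exact: R3.
Unshelve. all: by end_near. Qed.

Definition dcoef_wsum : R := limn (series (fun n => dcoef s n * n.+1%:R `^ (1 + th))).

Lemma dcoef_wsum_ge0 : 0 <= dcoef_wsum.
Proof.
apply: limr_ge; first exact: dcoef_summable.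
by near=> n; apply: sumr_ge0 => i _; rewrite mulr_ge0 ?powR_ge0// ltW// dcoef_gt0.
Unshelve. all: by end_near. Qed.

Lemma Lkernel_sub x y : Lkernel y - Lkernel x =
  pi^-1 * limn (series (fun n => dcoef s n * (fejer_prim n y - fejer_prim n x))).
Proof.
rewrite !Lkernel_fejer -mulrBr -lim_seriesB; [|exact: dcoef_fejer_cvg..].
by congr (_ * _); apply: eq_lim_series => n; rewrite mulrBr.
Qed.

(** The mean value inequality for each Phi_n with the interpolated bound on
    its derivative; this stands for |K'(z)| <= C |z|^(th - 1). *)
Lemma Lkernel_lip x y (q : R) : 0 < q -> x <= y -> (forall z, x <= z <= y -> q <= `|sin (z / 2)|) ->
  `|Lkernel y - Lkernel x| <= (pi^-1 * (4 * dcoef_wsum)) * q `^ (th - 1) * (y - x).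
Proof.
move=> q0 xy Hq; rewrite Lkernel_sub normrM gtr0_norm ?pi_inv_gt0// -!mulrA.
rewrite ler_pM2l ?pi_inv_gt0//.
have h n : `|dcoef s n * (fejer_prim n y - fejer_prim n x)| <=
    (4 * q `^ (th - 1) * (y - x)) * (dcoef s n * n.+1%:R `^ (1 + th)).
  rewrite normrM gtr0_norm ?dcoef_gt0// mulrCA ler_pM2l ?dcoef_gt0//.
  have := @derive_lip _ (fejer_prim n) (fun z => - cfejer n z) x y
    (4 * n.+1%:R `^ (1 + th) * q `^ (th - 1)).
  move=> H; apply: le_trans (H _ _ x y _ xy _) _ => //.
  - by move=> z _; exact: is_derive_fejer_prim.
  - by move=> z hz; rewrite normrN; apply: cfejer_interp => //; exact: Hq.
  - by apply: eq_ler; ring.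
apply: le_trans (sum_le h _) _; first exact: (@is_cvg_seriesZ _ _ _ dcoef_summable).
have -> : limn (series (fun n => (4 * q `^ (th - 1) * (y - x)) * (dcoef s n * n.+1%:R `^ (1 + th)))) =
   (4 * q `^ (th - 1) * (y - x)) * dcoef_wsum.
  exact: (@lim_seriesZ _ _ (4 * q `^ (th - 1) * (y - x)) dcoef_summable).
by rewrite [_ * dcoef_wsum]mulrC; rewrite !mulrA [dcoef_wsum * 4]mulrC.
Qed.

(** The coefficient of the first mode Phi_0 = cos in the expansion of the
    kernel. *)
Definition cos_weight : R := pi^-1 * dcoef s 0.

Lemma cos_weight_gt0 : 0 < cos_weight.
Proof. by rewrite mulr_gt0 ?pi_inv_gt0// dcoef_gt0. Qed.

(** Every Phi_n is nonincreasing on [0, pi]; removing the n = 0 term leaves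
    a nonincreasing function. *)
Lemma Lkernel_mono x y : 0 <= x -> x <= y -> y <= pi ->
  Lkernel y - cos_weight * cos y <= Lkernel x - cos_weight * cos x.
Proof.
move=> x0 xy ypi.
rewrite -subr_ge0.
have -> : Lkernel x - cos_weight * cos x - (Lkernel y - cos_weight * cos y) =
   cos_weight * (cos y - cos x) - (Lkernel y - Lkernel x) by ring.
rewrite Lkernel_sub /cos_weight -mulrA -mulrBr mulr_ge0 ?(ltW pi_inv_gt0)// subr_ge0.
pose g n := dcoef s n * (fejer_prim n x - fejer_prim n y).
have g0 n : 0 <= g n.
  rewrite mulr_ge0 ?(ltW (dcoef_gt0 _ s0))// subr_ge0.
  have := @derive_nondecr _ (fun z => - fejer_prim n z) (cfejer n) 0 pi.
  move=> H; rewrite -lerN2; apply: H => // [z _|z hz].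
    have d := is_derive_fejer_prim n z; have := is_deriveN d; rewrite opprK; exact.
  exact: cfejer_ge0.
have cg : cvgn (series g).
  rewrite (_ : g = (fun n => dcoef s n * fejer_prim n x) - (fun n => dcoef s n * fejer_prim n y)).
    by apply: is_cvg_seriesB; exact: dcoef_fejer_cvg.
  by apply/funext => n; rewrite /g mulrBr.
have := series_leB g0 cg 1%N.
rewrite {1}/series /= big_nat1 {1}/g.
have -> : limn (series (fun n => dcoef s n * (fejer_prim n y - fejer_prim n x))) = - limn (series g).
  by rewrite -lim_seriesN//; apply: eq_lim_series => n; rewrite /g -mulrN opprB.
have fz z : fejer_prim 0 z = cos z.
  by rewrite /fejer_prim !big_ord1 /= mul1r divr1.
by rewrite !fz lerNl -mulrN opprB.
Qed.

Lemma cos_Holder k x y : `|cos (k.+1%:R * x) - cos (k.+1%:R * y)| <=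
  2 * (k.+1%:R `^ th * `|x - y| `^ th).
Proof.
rewrite -powRM//.
have H1 : `|cos (k.+1%:R * x) - cos (k.+1%:R * y)| <= 2.
  by apply: le_trans (ler_normB _ _) _; have := @cos_max R (k.+1%:R * x); have := @cos_max R (k.+1%:R * y); lra.
have H2 : `|cos (k.+1%:R * x) - cos (k.+1%:R * y)| <= k.+1%:R * `|x - y|.
  wlog xy : x y {H1} / y <= x => [H|].
    have [yx|xy] := leP y x; first exact: H.
    by rewrite distrC (distrC x); apply: H; exact: ltW.
  have dd z : is_derive z 1 (fun z => cos (k.+1%:R * z)) (k.+1%:R * cos (k.+1%:R * z + pi / 2)).
    have := is_derive_cos_lin k.+1%:R 0 z; rewrite add0r.
    by rewrite (_ : (fun z => cos (k.+1%:R * z + 0)) = (fun z => cos (k.+1%:R * z)))//; apply/funext => u; rewrite addr0.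
  rewrite [`|x - y|]ger0_norm ?subr_ge0//.
  apply: (@derive_lip _ (fun z => cos (k.+1%:R * z)) _ y x k.+1%:R) => // z _.
  by rewrite normrM normr_nat ler_piMr// cos_max.
set t := k.+1%:R * `|x - y|; rewrite -/t in H2.
have t0 : 0 <= t by rewrite mulr_ge0.
have [t1|t1] := leP t 1.
  move: t0; rewrite le_eqVlt => /predU1P[t0|t0].
    by move: H2; rewrite -t0 => /le_trans; apply; rewrite mulr_ge0 ?powR_ge0.
  apply: le_trans H2 _; apply: le_trans (_ : t `^ th <= _); last by rewrite ler_peMl ?powR_ge0// ler1n.
  by apply: ger1_powR; rewrite ?t0// ltW.
apply: le_trans H1 _; rewrite ler_peMr//.
by rewrite -(powRr0 t); apply: ler_powR; exact: ltW.
Qed.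

(** Close to the singularity the Lipschitz bound degenerates; there |cos a -
    cos b| <= 2 |a - b|^th suffices. *)
Lemma Lkernel_Holder : exists2 C : R, 0 <= C & forall x y, `|Lkernel x - Lkernel y| <= C * `|x - y| `^ th.
Proof.
have h : 0 < s - th by rewrite subr_gt0.
pose P := limn (series (fun k => k.+1%:R `^ (- 1 - (s - th)) : R)).
have P0 : 0 <= P.
  by apply: limr_ge; [exact: p_series|near=> n; apply: sumr_ge0 => i _; exact: powR_ge0].
exists (pi^-1 * (2 * P)); first by rewrite !mulr_ge0// ltW// pi_inv_gt0.
move=> x y; rewrite /Lkernel -mulrBr normrM gtr0_norm ?pi_inv_gt0// -!mulrA ler_pM2l ?pi_inv_gt0//.
have cv z : cvgn (series (fun k => pow_coef r k * cos ((k + 1)%:R * z + 0))).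
  by apply: (summable_le (trigS_term_le (pow_coef r) 1 0 ^~ z)); exact: pow_coef_summable.
rewrite /trigS -lim_seriesB//.
have b k : `|((fun k => pow_coef r k * cos ((k + 1)%:R * x + 0)) - (fun k => pow_coef r k * cos ((k + 1)%:R * y + 0))) k|
   <= (2 * `|x - y| `^ th) * k.+1%:R `^ (- 1 - (s - th)).
  have -> : ((fun k => pow_coef r k * cos ((k + 1)%:R * x + 0)) - (fun k => pow_coef r k * cos ((k + 1)%:R * y + 0))) k
     = pow_coef r k * (cos (k.+1%:R * x) - cos (k.+1%:R * y)).
    rewrite -[LHS]/(pow_coef r k * cos ((k + 1)%:R * x + 0) - pow_coef r k * cos ((k + 1)%:R * y + 0)).
    by rewrite !addr0 addn1 mulrBr.
  rewrite normrM ger0_norm ?powR_ge0//.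
  apply: le_trans (ler_wpM2l (powR_ge0 _ _) (cos_Holder k x y)) _.
  have -> : - 1 - (s - th) = - r + th by rewrite /s; ring.
  by rewrite (powR_nat_D _ (- r)) /pow_coef; apply: eq_ler; ring.
apply: le_trans (sum_le b _) _; first exact: (@is_cvg_seriesZ _ _ _ (p_series h)).
have -> : limn (series (fun k => (2 * `|x - y| `^ th) * k.+1%:R `^ (- 1 - (s - th)))) =
   (2 * `|x - y| `^ th) * P.
  exact: (@lim_seriesZ _ _ (2 * `|x - y| `^ th) (p_series h)).
by rewrite mulrAC mulrA.
Unshelve. all: by end_near. Qed.

End Kernel.

(** * Two-sided bounds on reflected differences of the kernel *)

Section KernelBounds.
Set Implicit Arguments.
Unset Strict Implicit.
Context {R : realType}.
Implicit Types (x y z t a : R).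

(** An explicit slope below the sine on [0, 3 pi / 4], the range of z / 2
    for the arguments z that occur. *)
Definition sin_slope : R := cos (3 * pi / 8) ^+ 2.

Lemma cos38_gt0 : 0 < cos (3 * pi / 8) :> R.
Proof. by apply: cos_gt0_pihalf; have := @pi_gt0 R; move=> p0; apply/andP; split; lra. Qed.

Lemma sin_slope_gt0 : 0 < sin_slope.
Proof. by rewrite exprn_gt0// cos38_gt0. Qed.

Lemma cos_decr x y : 0 <= x -> x <= y -> y <= pi -> cos y <= cos x.
Proof.
move=> x0; rewrite le_eqVlt => /predU1P[->//|xy] ypi.
apply: ltW; rewrite ltr_cos// in_itv /=; first by rewrite x0 (le_trans (ltW xy)).
by rewrite ypi (le_trans x0 (ltW xy)).
Qed.

Lemma cos_strict_decr x y : 0 <= x -> x < y -> y <= pi -> cos y < cos x.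
Proof.
move=> x0 xy ypi; rewrite ltr_cos// in_itv /=; first by rewrite x0 (le_trans (ltW xy)).
by rewrite ypi (le_trans x0 (ltW xy)).
Qed.

Lemma sin_lower (w : R) : 0 <= w -> w <= 3 * pi / 4 -> sin_slope * w <= sin w.
Proof.
move=> w0 w1; have p0 := @pi_gt0 R.
have c0 := cos38_gt0.
have cl (v : R) : 0 <= v -> v <= 3 * pi / 8 -> cos (3 * pi / 8) <= cos v.
  move=> v0 v1; apply: (cos_decr v0 v1); lra.
have sl (v : R) : 0 <= v -> v <= 3 * pi / 8 -> cos (3 * pi / 8) * v <= sin v.
  move=> v0 v1.
  have := @derive_nondecr _ (fun v => sin v - cos (3 * pi / 8) * v) (fun v => cos v - cos (3 * pi / 8)) 0 (3 * pi / 8).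
  move=> H; have : sin 0 - cos (3 * pi / 8) * 0 <= sin v - cos (3 * pi / 8) * v.
    apply: H => // [z _|z /andP[z0 z1]].
      by apply: is_derive_eq; rewrite /GRing.scale /= mulr1.
    by rewrite subr_ge0; exact: cl.
  by rewrite sin0 mulr0 subrr subr_ge0.
have h1 : 0 <= w / 2 by lra.
have h2 : w / 2 <= 3 * pi / 8 by lra.
have H1 := sl _ h1 h2; have H2 := cl _ h1 h2.
rewrite sin_half /sin_slope expr2.
have -> : cos (3 * pi / 8) * cos (3 * pi / 8) * w = 2 * ((cos (3 * pi / 8) * (w / 2)) * cos (3 * pi / 8)) by field.
rewrite ler_pM2l//; apply: ler_pM => //; last exact: ltW.
by rewrite mulr_ge0// ltW.
Qed.

Lemma cos_lower x : 0 <= x -> x <= pi -> sin_slope ^+ 2 / 2 * x ^+ 2 <= 1 - cos x.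
Proof.
move=> x0 xpi; have p0 := @pi_gt0 R.
have -> : 1 - cos x = 2 * sin (x / 2) ^+ 2 by have := cos_half x; lra.
have H : sin_slope * (x / 2) <= sin (x / 2) by apply: sin_lower; lra.
have -> : sin_slope ^+ 2 / 2 * x ^+ 2 = 2 * (sin_slope * (x / 2)) ^+ 2 by field.
rewrite ler_pM2l// lerXn2r// ?nnegrE; last first.
  by apply: le_trans H; rewrite mulr_ge0 ?(ltW sin_slope_gt0)//; lra.
by rewrite mulr_ge0 ?(ltW sin_slope_gt0)//; lra.
Qed.

Lemma powR_anti x y p : 0 < x -> x <= y -> p <= 0 -> y `^ p <= x `^ p.
Proof.
move=> x0 xy p0; have y0 := lt_le_trans x0 xy.
rewrite -[p]opprK !(powRN _ (- p)) lef_pV2 ?posrE ?powR_gt0//.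
by apply: ge0_ler_powR; rewrite ?nnegrE ?oppr_ge0// ltW.
Qed.

Variables (r th : R).
Hypotheses (hr : 1 < r) (th0 : 0 < th) (th1 : th < 1) (thr : th < r - 1).

(** K - c cos is even, 2 pi-periodic and nonincreasing on [0, pi], and t - a
    is at least as close to 2 pi Z as t + a; the cosine contributes c (cos(t
    - a) - cos(t + a)) = 2 c sin t sin a. *)
Lemma Lkernel_positive t a : 0 <= t <= pi -> 0 <= a <= pi ->
  2 * cos_weight r * (sin t * sin a) <= Lkernel r (t - a) - Lkernel r (t + a).
Proof.
move=> /andP[t0 tpi] /andP[a0 api].
pose f z := Lkernel r z - cos_weight r * cos z.
have fN z : f (- z) = f z by rewrite /f Lkernel_even cosN.
have fP z : f (2 * pi - z) = f z.
  rewrite -fN opprB /f -(Lkernel_per r) subrK; congr (_ - _ * _).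
  have := @cosD2pi R (z - 2 * pi); rewrite (_ : z - 2 * pi + pi *+ 2 = z)//.
  ring.
suff H : f (t + a) <= f (t - a).
  have E : cos (t - a) - cos (t + a) = 2 * (sin t * sin a) by rewrite cosB cosD; ring.
  rewrite -mulrA mulrCA -E; move: H; rewrite /f; lra.
(* on [0, pi], |t - a| is at most t + a, and at most 2 pi - (t + a) *)
have -> : f (t - a) = f `|t - a|.
  by have [h|h] := leP 0 (t - a); [rewrite ger0_norm|rewrite ltr0_norm ?fN].
have m (x y : R) : 0 <= x -> x <= y -> y <= pi -> f y <= f x.
  exact: (Lkernel_mono hr th0 th1 thr).
have [h|h] := leP (t + a) pi.
  apply: m => //; rewrite ler_norml; apply/andP; split; lra.
rewrite -fP; apply: m => //; last by lra.
rewrite ler_norml; apply/andP; split; lra.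
Qed.

(** When a >= 2 x, both arguments stay at distance of order x + a from the
    singularity and are 2 t apart, so the Lipschitz bound applies. When a <
    2 x, the Holder bound gives O(x^th), which is of the right order because
    x + a <= 3 x. *)
Lemma Lkernel_upper : exists2 C : R, 0 <= C & forall t x a, 0 <= t -> t <= x -> 0 < x -> x <= pi ->
  0 <= a -> a <= pi -> Lkernel r (t - a) - Lkernel r (t + a) <= C * x * (x + a) `^ (th - 1).
Proof.
have p0 := @pi_gt0 R.
have [C2 C20 H2] := Lkernel_Holder hr th0 th1 thr.
have B0 := dcoef_wsum_ge0 hr thr.
have cs := sin_slope_gt0.
have [C1 C1E] : exists C1 : R, C1 = pi^-1 * (4 * dcoef_wsum r th) by exists (pi^-1 * (4 * dcoef_wsum r th)).
have C10 : 0 <= C1 by rewrite C1E mulr_ge0 ?(ltW (@pi_inv_gt0 R))// mulr_ge0.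
exists (2 * C1 * (sin_slope / 8) `^ (th - 1) + C2 * 4 `^ th * 3 `^ (1 - th)).
  by rewrite addr_ge0// mulr_ge0 ?powR_ge0// mulr_ge0 ?powR_ge0//.
move=> t x a t0 tx x0 xpi a0 api.
have thm : th - 1 <= 0 by rewrite subr_le0 ltW.
have Q0 : 0 <= (x + a) `^ (th - 1) by exact: powR_ge0.
have F1 : 0 <= 2 * C1 * (sin_slope / 8) `^ (th - 1) * x * (x + a) `^ (th - 1).
  by rewrite !mulr_ge0 ?powR_ge0// ltW.
have F2 : 0 <= C2 * 4 `^ th * 3 `^ (1 - th) * x * (x + a) `^ (th - 1).
  by rewrite !mulr_ge0 ?powR_ge0// ltW.
rewrite !mulrDl.
have [h|h] := leP (2 * x) a.
  apply: le_trans (_ : 2 * C1 * (sin_slope / 8) `^ (th - 1) * x * (x + a) `^ (th - 1) <= _); last by lra.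
  have q0 : 0 < sin_slope * ((x + a) / 8) by rewrite mulr_gt0//; lra.
  have L : a - t <= a + t by lra.
  have Hq z : a - t <= z <= a + t -> sin_slope * ((x + a) / 8) <= `|sin (z / 2)|.
    move=> /andP[z1 z2].
    apply: le_trans (_ : sin_slope * (z / 2) <= _).
      by rewrite ler_pM2l//; lra.
    by apply: le_trans (ler_norm _); apply: sin_lower; lra.
  have := Lkernel_lip hr th0 th1 thr q0 L Hq.
  have -> : Lkernel r (t - a) - Lkernel r (t + a) = - (Lkernel r (a + t) - Lkernel r (a - t)).
    by rewrite -(Lkernel_even r (t - a)) opprB (addrC t); ring.
  move=> H; apply: le_trans (ler_norm _) _; rewrite normrN; apply: le_trans H _.
  rewrite -C1E.
  have -> : sin_slope * ((x + a) / 8) = (sin_slope / 8) * (x + a) by field.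
  rewrite powRM; [|by apply: divr_ge0 => //; exact: ltW|by lra].
  have -> : a + t - (a - t) = 2 * t by ring.
  have -> : C1 * ((sin_slope / 8) `^ (th - 1) * (x + a) `^ (th - 1)) * (2 * t) =
    (2 * C1 * (sin_slope / 8) `^ (th - 1) * (x + a) `^ (th - 1)) * t by ring.
  by rewrite [_ * x * _]mulrAC ler_wpM2l// !mulr_ge0 ?powR_ge0//.
apply: le_trans (_ : C2 * 4 `^ th * 3 `^ (1 - th) * x * (x + a) `^ (th - 1) <= _); last by lra.
apply: le_trans (ler_norm _) _; apply: le_trans (H2 _ _) _.
rewrite -!mulrA ler_wpM2l//.
have -> : `|t - a - (t + a)| = 2 * a.
  by rewrite (_ : t - a - (t + a) = - (2 * a)); [rewrite normrN ger0_norm//; lra|ring].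
apply: le_trans (_ : (4 * x) `^ th <= _).
  by apply: (ge0_ler_powR (ltW th0)); rewrite ?nnegrE; lra.
rewrite powRM ?(ltW x0)// ler_wpM2l ?powR_ge0//.
apply: le_trans (_ : 3 `^ (1 - th) * (x * (3 * x) `^ (th - 1)) <= _); last first.
  rewrite ler_wpM2l ?powR_ge0// ler_pM2l//; apply: powR_anti => //; lra.
rewrite powRM ?(ltW x0)//.
have -> : 3 `^ (1 - th) * (x * (3 `^ (th - 1) * x `^ (th - 1))) =
  (3 `^ (1 - th) * 3 `^ (th - 1)) * (x * x `^ (th - 1)) by ring.
rewrite -powRD; last by rewrite pnatr_eq0 implybT.
by rewrite addrA subrK subrr powRr0 mul1r mulr_powRB1// ltW.
Qed.

End KernelBounds.

(** * Integration against a nondecreasing function *)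

Section Comparison.
Set Implicit Arguments.
Unset Strict Implicit.
Context {R : realType}.
Implicit Types (f u : R -> R).

(** If u is nondecreasing from u 0 = 0, then f u integrates to the
    superposition, with total mass u b, of the integrals of f over the
    segments [a, b]. The proof is a Riemann-Stieltjes sum over a uniform
    partition: V_i + u(y_i) F(y_i) grows by at most (kappa + B h) times the
    increment of u, where V_i is the integral of f u up to y_i, F the
    integral of f from y_i to b, and h the mesh. *)
Lemma comparison f u (b kappa : R) : 0 < b ->
  continuous f -> continuous u -> u 0 = 0 ->
  (forall x y, 0 <= x -> x <= y -> y <= b -> u x <= u y) ->
  (forall a, 0 <= a <= b -> itg a b f <= kappa) ->
  itg 0 b (fun y => f y * u y) <= kappa * u b.
Proof.
move=> b0 cf cu u0 mu tail.
have [B B0 HB] := @cont_on_bounded R 0 b f (ltW b0) (contW cf).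
have ub0 : 0 <= u b by rewrite -u0; apply: mu => //; exact: ltW.
suff H N : itg 0 b (fun y => f y * u y) <= (kappa + B * (b / N.+1%:R)) * u b.
  apply/ler_addgt0Pl => e e0.
  have [N HN] : exists N : nat, B * (b / N.+1%:R) * u b <= e.
    (* any number of steps above B b u(b) / e makes the discretisation error at most e *)
    pose M := B * b * u b / e.
    exists (Num.truncn M); have := truncnS_gt M; move: (_.+1) (ltr0Sn R (Num.truncn M)) => n n0.
    rewrite /M ltr_pdivrMr// => /ltW H1.
    have -> : B * (b / n%:R) * u b = B * b * u b / n%:R by ring.
    by rewrite ler_pdivrMr// [e * _]mulrC.
  by apply: le_trans (H N) _; rewrite mulrDl addrC lerD2r.
have N0 : 0 < N.+1%:R :> R by rewrite ltr0n.
pose h := b / N.+1%:R; have h0 : 0 < h by rewrite divr_gt0.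
pose y i := i%:R * h.
have yS i : y i.+1 = y i + h by rewrite /y -natr1 mulrDl mul1r.
have y0 i : 0 <= y i by rewrite mulr_ge0// ltW.
have yN : y N.+1 = b by rewrite /y /h mulrC divfK// gt_eqF.
have yb i : (i <= N.+1)%N -> y i <= b.
  by move=> iN; rewrite -yN ler_wpM2r ?(ltW h0)// ler_nat.
have cfu : continuous (fun y => f y * u y).
  by move=> z; apply: continuousM; [exact: cf|exact: cu].
have : forall i, (i <= N.+1)%N ->
   itg 0 (y i) (fun y => f y * u y) + u (y i) * itg (y i) b f <= (kappa + B * h) * u (y i).
  elim => [_|i IH iN].
    have -> : y 0%N = 0 by rewrite /y mul0r.
    by rewrite u0 mulr0 mul0r /itg set_itv1 Rintegral_set1 addr0.
  have {IH} := IH (ltnW iN).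
  have yy : y i <= y i.+1 by rewrite yS lerDl ltW.
  have ybi := yb _ iN.
  have uu : u (y i) <= u (y i.+1) by exact: mu.
  rewrite (@itg_split R 0 (y i) (y i.+1))//; last exact: contW.
  rewrite (@itg_split R (y i) (y i.+1) b)//; last exact: contW.
  set V := itg 0 _ _; set F := itg (y i.+1) b f; set G := itg (y i) (y i.+1) f.
  set W := itg _ _ _.
  have HW : W <= u (y i) * G + B * h * (u (y i.+1) - u (y i)).
    have -> : u (y i) * G = itg (y i) (y i.+1) (fun y' => u (y i) * f y') by rewrite itgZ//; exact: contW.
    have c1 : continuous (fun y' : R => u (y i) * f y').
      by move=> z; apply: continuousM; [exact: cvg_cst|exact: cf].
    rewrite -lerBlDl -itgB; [|exact: contW..].
    apply: le_trans (ler_norm _) _.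
    rewrite mulrAC (_ : h = y i.+1 - y i); last by rewrite yS; ring.
    apply: itg_norm_le => //; first by apply: cont_onB; exact: contW.
    move=> z /andP[z1 z2].
    have -> : f z * u z - u (y i) * f z = f z * (u z - u (y i)) by ring.
    have u1 : u (y i) <= u z by apply: mu => //; exact: le_trans ybi.
    rewrite normrM [`|u z - _|]ger0_norm ?subr_ge0//.
    apply: ler_pM => //; first by rewrite subr_ge0.
      by apply: HB; rewrite (le_trans (y0 i) z1) (le_trans z2 ybi).
    by rewrite lerD2r; apply: mu => //; exact: le_trans z1.
  have HF : F <= kappa by apply: tail; rewrite y0.
  have HF2 : (u (y i.+1) - u (y i)) * F <= (u (y i.+1) - u (y i)) * kappa.
    by rewrite ler_wpM2l// subr_ge0.
  by move: HW HF2; move: (u (y i)) (u (y i.+1)) => p q; nra.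
move=> /(_ N.+1 (leqnn _)); rewrite yN.
by rewrite /itg [X in _ + _ * X](_ : _ = 0) ?mulr0 ?addr0// set_itv1 Rintegral_set1.
Qed.

End Comparison.

(** * Growth of the depth function *)

Section MainInequalities.
Set Implicit Arguments.
Unset Strict Implicit.
Context {R : realType}.
Implicit Types (x y z t a : R).
Variables (r th : R).
Hypotheses (hr : 1 < r) (th0 : 0 < th) (th1 : th < 1) (thr : th < r - 1).
Variable u : R -> R.
Hypotheses (cu : continuous u) (eu : forall x, u (- x) = u x) (u0 : u 0 = 0).
Hypothesis (mu : forall x y, 0 <= x -> x <= y -> y <= pi -> u x <= u y).
Hypothesis (u_ne0 : exists2 x : R, 0 <= x <= pi & u x != 0).
Let L x : R := itg (- pi) pi (fun y => Lkernel r (x - y) * u y).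
Hypothesis (Eq : forall x, 2^-1 * u x ^+ 2 = L x - L 0).

Let p0 : 0 < pi :> R. Proof. exact: pi_gt0. Qed.
Let p0' : 0 <= pi :> R. Proof. exact: ltW. Qed.
Let ph : 0 < pi / 2 :> R. Proof. by rewrite divr_gt0. Qed.
Let ph1 : pi / 2 < pi :> R. Proof. by have := p0; lra. Qed.
Let cK : continuous (Lkernel r). Proof. exact: Lkernel_cont. Qed.

Let cKm x : continuous (fun y => Lkernel r (x - y)).
Proof. exact: cts_reflect. Qed.

Let cKp x : continuous (fun y => Lkernel r (x + y)).
Proof.
move=> y; apply: (@continuous_comp _ _ _ (fun y => x + y) (Lkernel r)); last exact: cK.
by apply: cvgD; [exact: cvg_cst|exact: cvg_id].
Qed.

Lemma Lconv_fold x : L x = itg 0 pi (fun y => (Lkernel r (x - y) + Lkernel r (x + y)) * u y).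
Proof.
rewrite /L (@itg_split _ _ 0) ?oppr_le0//; last by apply: contW; exact: ctsM.
have -> : itg (- pi) 0 (fun y => Lkernel r (x - y) * u y) = itg 0 pi (fun y => Lkernel r (x + y) * u y).
  have := @itg_opp R 0 pi (fun y => Lkernel r (x - y) * u y) p0' (ctsM (@cKm x) cu).
  rewrite oppr0 => <-; apply: eq_itg => y _; by rewrite opprK eu.
rewrite -itgD; [|by apply: contW; exact: ctsM..].
by apply: eq_itg => y _; ring.
Qed.

Let D x x' y := Lkernel r (x - y) + Lkernel r (x + y) - (Lkernel r (x' - y) + Lkernel r (x' + y)).

Let cDD x x' : continuous (D x x').
Proof. by apply: ctsB; apply: ctsD. Qed.

Lemma u_diff x x' : 2^-1 * (u x ^+ 2 - u x' ^+ 2) = itg 0 pi (fun y => D x x' y * u y).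
Proof.
rewrite mulrBr !Eq opprB addrA subrK !Lconv_fold -itgB.
- by apply: eq_itg => y _; rewrite /D; ring.
- by apply: contW; apply: ctsM => //; exact: ctsD.
- by apply: contW; apply: ctsM => //; exact: ctsD.
Qed.

Let g a t := Lkernel_prim r (t - a) - Lkernel_prim r (t + a).

Let g_derive a t : is_derive t 1 (g a) (Lkernel r (t - a) - Lkernel r (t + a)).
Proof.
have d1 := Lkernel_prim_derive hr (t - a); have d2 := Lkernel_prim_derive hr (t + a).
have i1 : is_derive t 1 (fun t => t - a) 1 by apply: is_derive_eq; ring.
have i2 : is_derive t 1 (fun t => t + a) 1 by apply: is_derive_eq; ring.
have e1 := @is_derive1_comp _ _ (fun t => t - a) t _ _ d1 i1.
have e2 := @is_derive1_comp _ _ (fun t => t + a) t _ _ d2 i2.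
have := is_deriveB e1 e2; rewrite !mulr1; exact.
Qed.

(** Integrating in y and using that the primitive of K is 2 pi-periodic
    removes the contribution of the endpoint pi. *)
Lemma kernel_diff_tail x x' a : 0 <= a <= pi -> itg a pi (D x x') = g a x - g a x'.
Proof.
move=> /andP[a0 api].
pose G y := - Lkernel_prim r (x - y) + Lkernel_prim r (x + y) + (Lkernel_prim r (x' - y) - Lkernel_prim r (x' + y)).
have dm c y : is_derive y 1 (fun y => Lkernel_prim r (c - y)) (- Lkernel r (c - y)).
  have d := Lkernel_prim_derive hr (c - y).
  have i : is_derive y 1 (fun y => c - y) (-1) by apply: is_derive_eq; ring.
  by have := @is_derive1_comp _ _ (fun y => c - y) y _ _ d i; rewrite mulrN1.
have dp c y : is_derive y 1 (fun y => Lkernel_prim r (c + y)) (Lkernel r (c + y)).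
  have d := Lkernel_prim_derive hr (c + y).
  have i : is_derive y 1 (fun y => c + y) 1 by apply: is_derive_eq; ring.
  by have := @is_derive1_comp _ _ (fun y => c + y) y _ _ d i; rewrite mulr1.
have dG y : is_derive y 1 G (D x x' y).
  have d1 := dm x y; have d2 := dp x y; have d3 := dm x' y; have d4 := dp x' y.
  by apply: is_derive_eq; rewrite /D; ring.
have Sp c : Lkernel_prim r (c + pi) = Lkernel_prim r (c - pi).
  by rewrite -(Lkernel_prim_per r (c - pi)); congr (Lkernel_prim r _); ring.
rewrite (itg_FTC2 api (fun y _ => dG y) (contW (@cDD x x'))).
by rewrite /G !Sp /g; ring.
Qed.

Let A : R := - itg 0 pi (fun y => cos y * u y).

(** Subtracting the constant u(pi / 2) does not change the moment and makes
    the integrand nonnegative. If the moment vanished, u would be constant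
    on [0, pi], hence identically 0 there. *)
Lemma cos_moment_gt0 : 0 < A.
Proof.
have pp : 0 < pi :> R by exact: pi_gt0.
(* the cosine changes sign exactly where u - u(pi / 2) does *)
pose h y := - cos y * (u y - u (pi / 2)).
have ch : continuous h.
  apply: ctsM; last by apply: ctsB => //; exact: ctsC.
  by move=> y; apply: continuousN; exact: continuous_cos.
have cc : continuous (@cos R) by exact: continuous_cos.
have Ei : A = itg 0 pi h.
  have i1 : itg 0 pi (@cos R) = 0.
    rewrite (itg_FTC2 p0' (fun y _ => is_derive_sin y) (contW cc)).
    by rewrite sinpi sin0 subrr.
  have -> : itg 0 pi h = itg 0 pi (fun y => u (pi / 2) * cos y - cos y * u y).
    by apply: eq_itg => y _; rewrite /h; ring.
  rewrite itgB; [|by apply: contW; apply: ctsZ|by apply: contW; apply: ctsM].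
  rewrite itgZ; last exact: contW.
  by rewrite i1 mulr0 sub0r.
have h0 y : 0 <= y <= pi -> 0 <= h y.
  move=> /andP[y0 ypi]; rewrite /h.
  have [yh|yh] := leP y (pi / 2).
    rewrite mulNr -mulrN opprB mulr_ge0//; last by rewrite subr_ge0 mu// ltW.
    by apply: cos_ge0_pihalf; apply/andP; split; lra.
  rewrite mulr_ge0//; last by rewrite subr_ge0 mu// ltW.
  rewrite oppr_ge0 -cos_pihalf; apply: cos_decr; lra.
have [H Hd] : exists H : R -> R, forall x : R, -1 < x < pi + 1 -> is_derive x 1 H (h x).
  by apply: primitive_ex; [lra|exact: contW].
have FT a b : 0 <= a -> a <= b -> b <= pi -> itg a b h = H b - H a.
  move=> a0 ab bpi; apply: itg_FTC2 => //; last exact: contW.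
  by move=> x /andP[x1 x2]; apply: Hd; apply/andP; split; lra.
have Hm x y : 0 <= x -> x <= y -> y <= pi -> H x <= H y.
  apply: (@derive_nondecr _ H h) => // z /andP[z1 z2]; apply: Hd; apply/andP; split; lra.
rewrite lt_neqAle; apply/andP; split; last by rewrite Ei FT// subr_ge0 Hm.
apply/eqP => A0.
have HE x : 0 <= x <= pi -> H x = H 0.
  move=> /andP[x1 x2].
  have E : H pi = H 0 by apply/eqP; rewrite -subr_eq0 -FT// -Ei -A0.
  have h1 : H 0 <= H x by exact: Hm.
  have h2 : H x <= H pi by exact: Hm.
  by apply/eqP; rewrite eq_le h1 andbT -E.
have hz x : 0 < x < pi -> h x = 0.
  move=> /andP[x1 x2].
  have dx : is_derive x 1 H (h x) by apply: Hd; apply/andP; split; lra.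
  have dc : is_derive x 1 H 0.
    apply: (@is_derive_near _ (fun=> H 0)).
    have : \forall y \near x, y \in `]0, pi[ by apply: near_in_itvoo; rewrite in_itv /= x1.
    apply: filterS => y; rewrite in_itv /= => /andP[/ltW y1 /ltW y2].
    by rewrite HE// y1.
  by rewrite -(is_derive_d1 dx) (is_derive_d1 dc).
have uc x : 0 < x < pi -> u x = u (pi / 2).
  move=> hx; have [->//|xh] := eqVneq x (pi / 2).
  have := hz x hx; rewrite /h => /eqP; rewrite mulf_eq0 oppr_eq0 subr_eq0.
  case/orP => [|/eqP//] /eqP c0; case/eqP: xh; apply: (@cos_inj R).
  - by rewrite in_itv /=; case/andP: hx => /ltW -> /ltW ->.
  - by rewrite in_itv /=; apply/andP; split; lra.
  - by rewrite c0 cos_pihalf.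
have uh0 : u (pi / 2) = 0.
  apply/eqP/negPn/negP => uh.
  have e0 : 0 < `|u (pi / 2)| / 2 by rewrite divr_gt0// normr_gt0.
  have /cvgrPdist_lt /(_ _ e0) [d /= d0 Hd0] := @cu 0.
  pose x := Num.min (d / 2) (pi / 2).
  have x1 : 0 < x by rewrite lt_min !divr_gt0.
  have x2 : x < pi by rewrite gt_min; apply/orP; right; lra.
  have x3 : x < d by rewrite gt_min; apply/orP; left; lra.
  have := Hd0 x; rewrite /ball_ /= sub0r normrN gtr0_norm// => /(_ x3).
  rewrite u0 sub0r normrN uc ?x1//; lra.
have [y /andP[y1 y2] /eqP] := u_ne0; apply.
have [yp|yp] := ltP y pi.
  by move: y1; rewrite le_eqVlt => /predU1P[<-//|y1]; rewrite uc ?y1.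
have {yp y1} -> : y = pi by apply/eqP; rewrite eq_le y2.
apply/eqP/negPn/negP => uh.
have e0 : 0 < `|u pi| / 2 by rewrite divr_gt0// normr_gt0.
have /cvgrPdist_lt /(_ _ e0) [d /= d0 Hd0] := @cu pi.
pose x := pi - Num.min (d / 2) (pi / 2).
have m1 : 0 < Num.min (d / 2) (pi / 2) by rewrite lt_min !divr_gt0.
have m2 : Num.min (d / 2) (pi / 2) < pi by rewrite gt_min; apply/orP; right; lra.
have m3 : Num.min (d / 2) (pi / 2) < d by rewrite gt_min; apply/orP; left; lra.
have := Hd0 x; rewrite /ball_ /= opprB addrC subrK gtr0_norm// => /(_ m3).
have hx : 0 < x < pi by rewrite /x; apply/andP; split; lra.
rewrite (uc x hx) uh0 subr0; lra.
Qed.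

(** Comparison applied to minus D minus a multiple of the cosine: by
    positivity of the kernel all its tails are nonpositive, because the
    integral of the cosine over [a, pi] is - sin a. *)
Lemma sq_diff_lower x x' : 0 <= x' -> x' <= x -> x <= pi ->
  4 * cos_weight r * A * (cos x' - cos x) <= u x ^+ 2 - u x' ^+ 2.
Proof.
move=> x0 xx xpi.
pose k := 2 * cos_weight r * (cos x' - cos x).
pose f y := - D x x' y - k * cos y.
have cc : continuous (fun y : R => k * cos y) by apply: ctsM; [exact: ctsC|exact: continuous_cos].
have cND : continuous (fun y => - D x x' y) by apply: (@ctsN R (D x x')); exact: cDD.
have cf : continuous f by exact: ctsB.
have tf a : 0 <= a <= pi -> itg a pi f <= 0.
  move=> ha; have /andP[a0 api] := ha.
  rewrite itgB; [|exact: contW..].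
  rewrite itgN; last by apply: contW; exact: cDD.
  rewrite kernel_diff_tail// itgZ; last by apply: contW; exact: continuous_cos.
  rewrite (itg_FTC2 api (fun y _ => is_derive_sin y) (contW (@continuous_cos R))).
  rewrite sinpi sub0r mulrN opprK addrC subr_le0.
  have dg t : x' <= t <= x -> is_derive t 1 (fun t => g a t + 2 * cos_weight r * sin a * cos t)
      ((Lkernel r (t - a) - Lkernel r (t + a)) - 2 * cos_weight r * sin a * sin t).
    by move=> _; have d := g_derive a t; apply: is_derive_eq; rewrite /GRing.scale /=; ring.
  have dg0 t : x' <= t <= x -> 0 <= (Lkernel r (t - a) - Lkernel r (t + a)) - 2 * cos_weight r * sin a * sin t.
    move=> /andP[t1 t2].
    have -> : 2 * cos_weight r * sin a * sin t = 2 * cos_weight r * (sin t * sin a) by ring.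
    rewrite subr_ge0; apply: (Lkernel_positive hr th0 th1 thr) => //.
    by rewrite (le_trans x0 t1) (le_trans t2 xpi).
  have := derive_nondecr dg dg0 (lexx _) xx (lexx _).
  rewrite /k; lra.
have := comparison p0 cf cu u0 mu tf.
rewrite mul0r.
have -> : itg 0 pi (fun y => f y * u y) =
   - itg 0 pi (fun y => D x x' y * u y) - k * itg 0 pi (fun y => cos y * u y).
  have c1 : continuous (fun y => D x x' y * u y) by exact: ctsM.
  have c2 : continuous (fun y => cos y * u y) by apply: ctsM => //; exact: continuous_cos.
  have c3 : continuous (fun y => - (D x x' y * u y)) by apply: (@ctsN R (fun y => D x x' y * u y)); exact: c1.
  have c4 : continuous (fun y => k * (cos y * u y)) by apply: ctsM => //; exact: ctsC.
  rewrite -itgN; last exact: contW.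
  rewrite -itgZ; last exact: contW.
  rewrite -itgB; [|exact: contW..].
  by apply: eq_itg => y _; rewrite /f; ring.
rewrite -u_diff -/A => H.
have -> : 4 * cos_weight r * A * (cos x' - cos x) = 2 * (k * A) by rewrite /k; ring.
move: H; rewrite /A mulrN; lra.
Qed.

(** Comparison applied to D - e, where e is minus the y-derivative of the
    majorant C x (x - x') (x + y)^(th - 1) of the tails of D; e gains one
    factor (x + y)^(-1), which the assumed linear bound on u compensates. *)
Lemma sq_diff_upper : exists C1 C2 : R, [/\ 0 <= C1, 0 <= C2 &
  forall x x' M, 0 <= x' -> x' <= x -> 0 < x -> x <= pi -> 0 <= M ->
    (forall y, 0 <= y <= pi -> u y <= M * (x + y)) ->
    2^-1 * (u x ^+ 2 - u x' ^+ 2) <= x * (x - x') * (C1 * M + C2)].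
Proof.
have [C C0 HC] := Lkernel_upper hr th0 th1 thr.
have upi0 : 0 <= u pi by rewrite -u0; apply: mu.
have th10 : 0 <= 1 - th by rewrite subr_ge0 ltW.
exists (C * ((1 - th) * ((pi + pi) `^ th / th))), (C * (pi `^ (th - 1) * u pi)).
split.
- by rewrite !mulr_ge0// ?powR_ge0// invr_ge0 ltW.
- by rewrite !mulr_ge0 ?powR_ge0.
move=> x x' M x'0 xx x0 xpi M0 HM.
have [Q QE Q0] : exists2 Q : R, Q = C * x * (x - x') & 0 <= Q.
  by exists (C * x * (x - x')); rewrite // !mulr_ge0 ?subr_ge0// ltW.
have pc (p : R) : continuous (fun y : R => (x + `|y|) `^ p).
  move=> y; apply: (@continuous_comp _ _ _ (fun y : R => x + `|y|) (powR (R:=R) ^~ p)).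
    by apply: cvgD; [exact: cvg_cst|apply: (@cvg_norm _ R^o); exact: cvg_id].
  have xy : 0 < x + `|y| by rewrite ltr_pwDl.
  exact: is_derive_cont (is_derive1_powR p xy).
(* the absolute value only serves to make e continuous on the whole line *)
pose e y := Q * ((1 - th) * (x + `|y|) `^ (th - 2)).
have ce : continuous e by apply: ctsM; [exact: ctsC|apply: ctsM; [exact: ctsC|exact: pc]].
pose kappa := Q * (x + pi) `^ (th - 1).
pose f y := D x x' y - e y.
have cf : continuous f by apply: ctsB.
have pd (p a : R) : 0 <= a -> is_derive a 1 (fun y => (x + y) `^ p) (p * (x + a) `^ (p - 1)).
  move=> a0; have xa : 0 < x + a by rewrite ltr_pwDl.
  have i : is_derive a 1 (fun y => x + y) 1 by apply: is_derive_eq; ring.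
  have d := is_derive1_powR p xa.
  by have := @is_derive1_comp _ (powR (R:=R) ^~ p) (fun y => x + y) a _ _ d i; rewrite mulr1.
have tf a : 0 <= a <= pi -> itg a pi f <= kappa.
  move=> ha; have /andP[a0 api] := ha.
  rewrite itgB; [|exact: contW..].
  have -> : itg a pi e = - (Q * (x + pi) `^ (th - 1)) - - (Q * (x + a) `^ (th - 1)).
    have de y : a <= y <= pi -> is_derive y 1 (fun y => - (Q * (x + y) `^ (th - 1))) (e y).
      move=> /andP[y1 y2]; have y0 := le_trans a0 y1.
      have d := pd (th - 1) y y0.
      apply: is_derive_eq; rewrite /e ger0_norm// /GRing.scale /=.
      by rewrite (_ : th - 1 - 1 = th - 2); ring.
    exact: (itg_FTC2 api de (contW ce)).
  rewrite kernel_diff_tail// /kappa.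
  have dg t : x' <= t <= x -> is_derive t 1 (fun t => C * x * (x + a) `^ (th - 1) * t - g a t)
      (C * x * (x + a) `^ (th - 1) - (Lkernel r (t - a) - Lkernel r (t + a))).
    by move=> _; have d := g_derive a t; apply: is_derive_eq; rewrite /GRing.scale /=; ring.
  have dg0 t : x' <= t <= x -> 0 <= C * x * (x + a) `^ (th - 1) - (Lkernel r (t - a) - Lkernel r (t + a)).
    by move=> /andP[t1 t2]; rewrite subr_ge0; apply: HC => //; exact: le_trans t1.
  have := derive_nondecr dg dg0 (lexx _) xx (lexx _).
  rewrite QE; lra.
have cuu : continuous (fun y => e y * u y) by exact: ctsM.
have cDu : continuous (fun y => D x x' y * u y) by exact: ctsM.
have := comparison p0 cf cu u0 mu tf.
have -> : itg 0 pi (fun y => f y * u y) =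
   itg 0 pi (fun y => D x x' y * u y) - itg 0 pi (fun y => e y * u y).
  rewrite -itgB; [|exact: contW..].
  by apply: eq_itg => y _; rewrite /f; ring.
rewrite -u_diff lerBlDr => /le_trans; apply.
have H1 : kappa * u pi <= Q * (pi `^ (th - 1) * u pi).
  rewrite /kappa -mulrA ler_wpM2l// ler_wpM2r//; apply: powR_anti => //; last by rewrite subr_le0 ltW.
  by rewrite lerDr ltW.
have H2 : itg 0 pi (fun y => e y * u y) <= Q * ((1 - th) * ((pi + pi) `^ th / th)) * M.
  pose e2 y := Q * ((1 - th) * M) * (x + `|y|) `^ (th - 1).
  have ce2 : continuous e2 by apply: ctsM; [exact: ctsC|exact: pc].
  apply: le_trans (_ : itg 0 pi e2 <= _).
    apply: itg_le; [exact: contW..|] => y hy; have /andP[y0 yp] := hy.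
    rewrite /e /e2 ger0_norm//.
    have xy : 0 < x + y by rewrite ltr_pwDl.
    have -> : (x + y) `^ (th - 1) = (x + y) `^ (th - 2) * (x + y).
      have -> : th - 1 = (th - 2) + 1 by ring.
      by rewrite powRD ?(gt_eqF xy) ?implybT// powRr1 ?(ltW xy).
    have -> : Q * ((1 - th) * M) * ((x + y) `^ (th - 2) * (x + y)) =
      Q * ((1 - th) * (x + y) `^ (th - 2)) * (M * (x + y)) by ring.
    by rewrite ler_wpM2l ?HM// !mulr_ge0 ?powR_ge0//.
  have -> : itg 0 pi e2 = Q * ((1 - th) * M) * ((x + pi) `^ th / th) - Q * ((1 - th) * M) * ((x + 0) `^ th / th).
    have de y : 0 <= y <= pi -> is_derive y 1 (fun y => Q * ((1 - th) * M) * ((x + y) `^ th / th)) (e2 y).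
      move=> /andP[y1 y2]; have d := pd th y y1.
      apply: is_derive_eq; rewrite /e2 ger0_norm// /GRing.scale /=; field.
      by rewrite gt_eqF.
    exact: (itg_FTC2 p0' de (contW ce2)).
  apply: le_trans (_ : Q * ((1 - th) * M) * ((x + pi) `^ th / th) <= _).
    by rewrite gerBl !mulr_ge0 ?powR_ge0// invr_ge0 ltW.
  have -> : Q * ((1 - th) * ((pi + pi) `^ th / th)) * M = Q * ((1 - th) * M) * ((pi + pi) `^ th / th) by ring.
  rewrite ler_wpM2l ?mulr_ge0// ler_wpM2r ?invr_ge0 ?(ltW th0)//.
  by apply: (ge0_ler_powR (ltW th0)); rewrite ?nnegrE ?lerD2r// addr_ge0// ltW.
apply: le_trans (lerD H1 H2) _; apply: eq_ler; rewrite QE; ring.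
Qed.

Lemma u_ge0 x : 0 <= x <= pi -> 0 <= u x.
Proof. by move=> /andP[x1 x2]; rewrite -u0; apply: mu. Qed.

Lemma u_lower : exists2 c : R, 0 < c & forall x, 0 <= x <= pi -> c * x <= u x.
Proof.
have A0 := cos_moment_gt0; have k0 := cos_weight_gt0 hr; have s0 := @sin_slope_gt0 R.
pose q := 4 * cos_weight r * A * (sin_slope ^+ 2 / 2).
have k1 : 0 < 4 * cos_weight r * A by rewrite mulr_gt0// mulr_gt0.
have q0 : 0 < q by rewrite mulr_gt0// divr_gt0// exprn_gt0.
exists (Num.sqrt q); first by rewrite sqrtr_gt0.
move=> x hx; have /andP[x0 xpi] := hx.
have H := @sq_diff_lower x 0 (lexx _) x0 xpi.
rewrite u0 expr0n subr0 cos0 in H.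
have H2 := cos_lower x0 xpi.
rewrite -(@ler_pXn2r _ 2)//; last first.
- by rewrite nnegrE u_ge0.
- by rewrite nnegrE mulr_ge0// sqrtr_ge0.
rewrite exprMn sqr_sqrtr ?(ltW q0)//; apply: le_trans H.
have -> : q * x ^+ 2 = (4 * cos_weight r * A) * (sin_slope ^+ 2 / 2 * x ^+ 2) by rewrite /q !mulrA.
by rewrite (ler_pM2l k1).
Qed.

Lemma u_strict x x' : 0 <= x' -> x' < x -> x <= pi -> u x' < u x.
Proof.
move=> x0 xx xpi.
have := sq_diff_lower x0 (ltW xx) xpi.
have P : 0 < 4 * cos_weight r * A * (cos x' - cos x).
  have k1 : 0 < 4 * cos_weight r * A by rewrite mulr_gt0 ?cos_moment_gt0// mulr_gt0// cos_weight_gt0.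
  by rewrite mulr_gt0// subr_gt0; exact: cos_strict_decr.
move=> /(lt_le_trans P); rewrite subr_gt0 ltr_pXn2r// nnegrE u_ge0//.
  by rewrite x0 (le_trans (ltW xx)).
by rewrite (le_trans x0 (ltW xx)).
Qed.

(** At a maximiser xs of u(y) / y over [y, pi], with maximum M, monotonicity
    gives u(z) <= M (xs + z) on all of [0, pi]. The previous estimate with
    x' = 0 then bounds M^2 linearly in M, with constants that do not depend
    on y. *)
Lemma u_upper : exists2 M : R, 0 <= M & forall x, 0 <= x <= pi -> u x <= M * x.
Proof.
have [C1 [C2 [C10 C20 H]]] := sq_diff_upper.
exists (2 * C1 + 2 * C2 + 1); first by rewrite !addr_ge0// mulr_ge0.
move=> y /andP[]; rewrite le_eqVlt => /predU1P[<-|y0 ypi]; first by rewrite u0 mulr0.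
have cq : cont_on y pi (fun x => u x / x).
  move=> x /andP[x1 x2]; apply: continuousM; first exact: cu.
  by apply: cvgV; [rewrite gt_eqF// (lt_le_trans y0)|exact: cvg_id].
have [xs] := EVT_max ypi (cont_on_within cq).
rewrite in_itv /= => /andP[x1 x2] Hm.
have xs0 := lt_le_trans y0 x1.
set M := u xs / xs in Hm.
have ux : u xs = M * xs by rewrite /M divfK// gt_eqF.
have M0 : 0 <= M by rewrite divr_ge0 ?(ltW xs0)// u_ge0// (ltW xs0).
have HM z : 0 <= z <= pi -> u z <= M * (xs + z).
  move=> /andP[z0 zpi]; have [zy|zy] := leP y z.
    have zp := lt_le_trans y0 zy.
    have : u z / z <= M by apply: Hm; rewrite in_itv /= zy.
    rewrite ler_pdivrMr// => /le_trans; apply.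
    by rewrite mulrDr lerDr mulr_ge0// ltW.
  apply: le_trans (_ : u xs <= _).
    by apply: mu => //; apply: le_trans x1; exact: ltW.
  by rewrite ux mulrDr lerDl mulr_ge0.
have := H xs 0 M (lexx _) (ltW xs0) xs0 x2 M0 HM.
rewrite u0 expr0n subr0 subr0 ux => HH.
have {}HH : M ^+ 2 <= 2 * (C1 * M + C2).
  have : xs ^+ 2 * M ^+ 2 <= xs ^+ 2 * (2 * (C1 * M + C2)) by move: HH; nra.
  by rewrite ler_pM2l// exprn_gt0.
have MB : M <= 2 * C1 + 2 * C2 + 1.
  rewrite leNgt; apply/negP => MB.
  (* then C2 <= C2 M, so M^2 <= 2 (C1 M + C2) would give M <= 2 C1 + 2 C2 *)
  have M1 : 1 <= M by lra.
  have : M * (2 * C1 + 2 * C2 + 1) <= M * M by rewrite ler_wpM2l// ltW.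
  have : C2 <= C2 * M by rewrite ler_peMr.
  move: HH; rewrite expr2; nra.
have : u y / y <= M by apply: Hm; rewrite in_itv /= lexx.
rewrite ler_pdivrMr// => /le_trans; apply; rewrite ler_wpM2r//; exact: ltW.
Qed.

(** The factor x in the bound for u(x)^2 - u(x')^2 is absorbed by u(x) +
    u(x') >= c x. *)
Lemma u_lip : exists2 Lp : R, 0 <= Lp & forall x x', 0 <= x' -> x' <= x -> x <= pi ->
  u x - u x' <= Lp * (x - x').
Proof.
have [C1 [C2 [C10 C20 H]]] := sq_diff_upper.
have [M M0 HM] := u_upper.
have [c c0 Hc] := u_lower.
pose B := C1 * M + C2; have B0 : 0 <= B by rewrite addr_ge0// mulr_ge0.
exists (2 * B / c); first by rewrite divr_ge0 ?mulr_ge0// ltW.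
move=> x x' x'0; rewrite le_eqVlt => /predU1P[->|xx xpi]; first by rewrite !subrr mulr0.
have x0 := le_lt_trans x'0 xx.
have HMx y : 0 <= y <= pi -> u y <= M * (x + y).
  move=> hy; apply: le_trans (HM y hy) _.
  by rewrite mulrDr lerDr mulr_ge0// ltW.
have H1 := H x x' M x'0 (ltW xx) x0 xpi M0 HMx; rewrite -/B in H1.
have hx : 0 <= x <= pi by rewrite (ltW x0).
have hx' : 0 <= x' <= pi by rewrite x'0 (le_trans (ltW xx)).
have H2 := Hc x hx; have H3 := u_ge0 hx'; have H4 := mu x'0 (ltW xx) xpi.
have : (c * x) * (u x - u x') <= (u x + u x') * (u x - u x').
  by rewrite ler_wpM2r ?subr_ge0//; lra.
have -> : (u x + u x') * (u x - u x') = u x ^+ 2 - u x' ^+ 2 by ring.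
move=> H5; have : (c * x) * (u x - u x') <= (c * x) * (2 * B / c * (x - x')).
  have -> : (c * x) * (2 * B / c * (x - x')) = 2 * (x * (x - x') * B) by field; rewrite gt_eqF.
  lra.
by rewrite ler_pM2l// mulr_gt0.
Qed.

End MainInequalities.

(** * Periodic integrals and the part of a convolution away from the singularity *)

Section Periodic.
Set Implicit Arguments.
Unset Strict Implicit.
Context {R : realType}.
Implicit Types (f v k : R -> R) (a b c d x y z : R).

(** With F a primitive of f, the derivative of F(c + 2 pi) - F(c) in c is
    zero. *)
Lemma itg_period f c : continuous f -> (forall x, f (x + 2 * pi) = f x) ->
  itg c (c + 2 * pi) f = itg 0 (2 * pi) f.
Proof.
move=> cf pf; have p0 : 0 < pi :> R by exact: pi_gt0.
pose A := - `|c| - 1; pose B := `|c| + 2 * pi + 1.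
have c1 := ler_norm c; have c2 := ler_norm (- c); rewrite normrN in c2.
have AB : A < B by rewrite /A /B; lra.
have [F HF] := primitive_ex AB (contW (a := A) (b := B) cf).
have FT x : - `|c| <= x <= `|c| -> itg x (x + 2 * pi) f = F (x + 2 * pi) - F x.
  move=> /andP[x1 x2]; apply: itg_FTC2; [by lra| |exact: contW].
  by move=> y /andP[y1 y2]; apply: HF; apply/andP; rewrite /A /B; split; lra.
have d x : - `|c| <= x <= `|c| -> is_derive x 1 (fun x => F (x + 2 * pi) - F x) 0.
  move=> /andP[x1 x2].
  have d1 : is_derive x 1 F (f x) by apply: HF; apply/andP; rewrite /A /B; split; lra.
  have d2 : is_derive (x + 2 * pi) 1 F (f (x + 2 * pi)).
    by apply: HF; apply/andP; rewrite /A /B; split; lra.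
  have i : is_derive x 1 (fun x => x + 2 * pi) 1 by apply: is_derive_eq; ring.
  have e := @is_derive1_comp _ F (fun x => x + 2 * pi) x _ _ d2 i.
  by have := is_deriveB e d1; rewrite mulr1 pf subrr.
have lp := @derive_lip _ (fun x => F (x + 2 * pi) - F x) (fun=> 0) (- `|c|) `|c| 0 d.
have n0 := normr_ge0 c.
rewrite -[2 * pi in RHS]add0r !FT; [|by apply/andP; split; lra..].
have {}lp x y : - `|c| <= x -> x <= y -> y <= `|c| ->
    F (y + 2 * pi) - F y = F (x + 2 * pi) - F x.
  move=> h1 h2 h3; apply/eqP; rewrite -subr_eq0 -normr_le0.
  by rewrite -(mul0r (y - x)); apply: lp => // z _; rewrite normr0.
by have [h|h] := leP 0 c; [apply: lp|apply/esym; apply: lp]; lra.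
Qed.

Lemma cos_ne1_itv z : 0 < z -> z < 2 * pi -> cos_ne1 z.
Proof.
move=> z0 zp; rewrite /cos_ne1 /=; apply/eqP => c1.
have s0 : 0 < sin (z / 2) by apply: sin_gt0_pi; apply/andP; split; lra.
by have := cos_half z; rewrite c1 mulr1 subrr => /esym/eqP; rewrite mulf_eq0 expf_eq0 /= gt_eqF ?orbF//= gt_eqF.
Qed.

Lemma cos_ne1N z : cos_ne1 z -> cos_ne1 (- z).
Proof. by rewrite /cos_ne1 /= cosN. Qed.

Lemma Cn_local n (A : set R) f :
  (forall x, A x -> exists B : set R, [/\ open B, B x & Cn n B f]) -> Cn n A f.
Proof.
elim: n f => [|n IH] f H.
  by move=> x Ax; have [B [_ Bx C]] := H x Ax; exact: C.
split.
  by move=> x Ax; have [B [_ Bx [d _]]] := H x Ax; exact: d.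
by apply: IH => x Ax; have [B [oB Bx [_ C]]] := H x Ax; exists B.
Qed.

(** Away from the singularity the derivative falls on the kernel, whose
    regularity on cos_ne1 is available at every order. *)
Lemma Cn_conv_far n k v c d (B : set R) : c <= d -> open B -> Cn n.+1 cos_ne1 k -> cont_on c d v ->
  (forall x, B x -> exists2 rho : R, 0 < rho & forall z, x - rho - d <= z <= x + rho - c -> cos_ne1 z) ->
  Cn n B (fun x => itg c d (fun y => k (x - y) * v y)).
Proof.
move=> cd oB + cv HB.
have D k' x : Cn 1 cos_ne1 k' -> B x ->
    is_derive x 1 (fun x => itg c d (fun y => k' (x - y) * v y))
       (itg c d (fun y => derive1 k' (x - y) * v y)).
  move=> [dk ck] Bx; have [rho r0 Hr] := HB x Bx.
  have h1 z : x - rho - d <= z <= x + rho - c -> is_derive z 1 k' (derive1 k' z).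
    by move=> hz; apply: derivable_d1; apply: dk; exact: Hr.
  have h2 : cont_on (x - rho - d) (x + rho - c) (derive1 k').
    by move=> z hz; apply: ck; exact: Hr.
  exact: (derive_conv cd r0 h1 h2 cv).
elim: n k => [|n IH] k Ck.
  by move=> x Bx; exact: is_derive_cont (D k x Ck Bx).
apply: (@Cn_S _ _ _ _ (fun x => itg c d (fun y => derive1 k (x - y) * v y))) => //.
  by move=> x Bx; apply: D => //; apply: Cn_le Ck.
by apply: IH; case: Ck.
Qed.

(** Extending by the boundary values lets statements about global bounded
    continuous functions apply to functions given on a segment only. *)
Lemma clamp_ext v a b : a <= b -> cont_on a b v ->
  exists w : R -> R, [/\ continuous w, forall y, a <= y <= b -> w y = v y &
     exists2 V : R, 0 <= V & forall y, `|w y| <= V].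
Proof.
move=> ab cv; pose cl y := Num.max a (Num.min b y).
have clP y : a <= cl y <= b.
  by rewrite /cl le_max lexx /= ge_max ab ge_min lexx.
exists (v \o cl); split.
- move=> y; apply: continuous_comp; last exact: cv.
  apply: (@continuous_max _ _ (fun=> a)); first exact: cvg_cst.
  by apply: (@continuous_min _ _ (fun=> b)); [exact: cvg_cst|exact: cvg_id].
- move=> y /andP[y1 y2] /=; congr v; rewrite /cl.
  by rewrite min_r// max_r.
- by have [V V0 HV] := cont_on_bounded ab cv; exists V => // y; apply: HV.
Qed.

End Periodic.

(** * Convolution with the kernel gains one derivative *)

Section Gain.
Set Implicit Arguments.
Unset Strict Implicit.
Context {R : realType}.
Implicit Types (v : R -> R) (a b x y z : R).

Lemma Cn_bigsum m n (A : set R) (F : nat -> R -> R) : open A ->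
  (forall i, Cn m A (F i)) -> Cn m A (fun z => \sum_(i < n) F i z).
Proof.
move=> oA H; elim: n => [|n IH].
  by apply: Cn_eq (Cn_cst m 0 oA) => // x _; rewrite big_ord0.
apply: (@Cn_eq _ _ _ (fun z => \sum_(i < n) F i z + F n z)) => //.
  by move=> x _; rewrite big_ord_recr.
exact: CnD.
Qed.

Lemma cfejer_Cn m n : Cn m setT (@cfejer R n).
Proof.
apply: (@Cn_bigsum _ _ _ (fun k z => \sum_(j < k.+1) sin (j.+1%:R * z))); first exact: openT.
move=> k; apply: (@Cn_bigsum _ _ _ (fun j z => sin (j.+1%:R * z))); first exact: openT.
move=> j; apply: Cn_eq (Cn_cos_lin m j.+1%:R (- (pi / 2))); first exact: openT.
by move=> z _; rewrite cosBpihalf.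
Qed.

Lemma fejer_prim_cont n : continuous (@fejer_prim R n).
Proof. by move=> z; exact: is_derive_cont (is_derive_fejer_prim n z). Qed.

(** By periodicity the integral does not depend on x; by oddness and
    positivity it equals twice the increment of Phi_n over [0, pi], so no
    singular integral has to be estimated. *)
Lemma cfejer_L1 (th : R) n x : 0 < th -> th < 1 ->
  itg 0 (2 * pi) (fun y => `|cfejer n (x - y)|) <= 4 * pseries th * n.+1%:R `^ (1 + th).
Proof.
move=> th0 th1; have p0 : 0 < pi :> R by exact: pi_gt0.
have cf := @cfejer_cont R n.
have cn : continuous (fun y : R => `|cfejer n y|).
  by move=> y; apply: (@cvg_norm _ R^o); exact: cf.
have -> : itg 0 (2 * pi) (fun y => `|cfejer n (x - y)|) = itg 0 (2 * pi) (fun y => `|cfejer n (y + - x)|).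
  by apply: eq_itg => y _; rewrite -opprB cfejer_odd normrN.
rewrite (@itg_shift R 0 (2 * pi) (- x) (fun y => `|cfejer n y|))//; last by lra.
rewrite add0r [2 * pi - x]addrC.
have per y : `|cfejer n (y + 2 * pi)| = `|cfejer n y| by rewrite cfejer_per.
rewrite (@itg_period R (fun y => `|cfejer n y|))//.
rewrite -(@itg_period R (fun y => `|cfejer n y|) (- pi))//.
have -> : - pi + 2 * pi = pi :> R by ring.
rewrite (@itg_split R (- pi) 0)//; [|lra|lra|exact: contW].
have -> : itg (- pi) 0 (fun y => `|cfejer n y|) = itg 0 pi (fun y => `|cfejer n y|).
  have := @itg_opp R 0 pi (fun y => `|cfejer n y|) (ltW p0) cn.
  by rewrite oppr0 => <-; apply: eq_itg => y _; rewrite cfejer_odd normrN.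
have -> : itg 0 pi (fun y => `|cfejer n y|) = itg 0 pi (cfejer n).
  by apply: eq_itg => y hy; rewrite ger0_norm// cfejer_ge0.
have -> : itg 0 pi (cfejer n) = - fejer_prim n (pi : R) - - fejer_prim n (0 : R).
  have de y : 0 <= y <= pi -> is_derive y 1 (fun y => - fejer_prim n y) (cfejer n y).
    by move=> _; have d := is_derive_fejer_prim n y; have := is_deriveN d; rewrite opprK.
  exact: (itg_FTC2 (ltW p0) de (contW cf)).
have := fejer_prim_le th0 th1 n (pi : R); have := fejer_prim_le th0 th1 n (0 : R).
move=> /(le_trans (ler_norm _)) h1 h2.
have := le_trans (ler_norm (- fejer_prim n (pi : R))) _; rewrite normrN => /(_ _ h2).
move: h1; rewrite -!mulrA; lra.
Qed.

Variables (r th : R).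
Hypotheses (hr : 1 < r) (th0 : 0 < th) (th1 : th < 1) (thr : th < r - 1).

Let d := dcoef (r - 1).
Let d0 n : 0 < d n. Proof. by apply: dcoef_gt0; rewrite subr_gt0. Qed.
Let W n := d n * n.+1%:R `^ (1 + th).
Let cW : cvgn (series W). Proof. exact: dcoef_summable. Qed.

Variables (a b : R).
Hypotheses (a0 : 0 <= a) (ab : a <= b) (b2 : b <= 2 * pi).

(** Termwise derivative of the convolution of v with the kernel over [a, b]. *)
Definition conv_deriv v x : R :=
  - (pi^-1 * limn (series (fun n => d n * itg a b (fun y => cfejer n (x - y) * v y)))).

Lemma conv_deriv_term_le v V n x : cont_on a b v -> 0 <= V -> (forall y, a <= y <= b -> `|v y| <= V) ->
  `|d n * itg a b (fun y => cfejer n (x - y) * v y)| <= (4 * pseries th * V) * W n.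
Proof.
move=> cv V0 HV.
have cs : continuous (fun y => cfejer n (x - y)) by apply: cts_reflect; exact: cfejer_cont.
have cn : continuous (fun y => `|cfejer n (x - y)|).
  by move=> y; apply: (@cvg_norm _ R^o); exact: cs.
have cV : continuous (fun y => V * `|cfejer n (x - y)|).
  exact: ctsZ.
rewrite normrM gtr0_norm// /W mulrCA ler_pM2l//.
have ccv : cont_on a b (fun y => cfejer n (x - y) * v y) by apply: cont_onM => //; exact: contW.
apply: le_trans (itg_norm ccv) _.
apply: le_trans (_ : itg a b (fun y => V * `|cfejer n (x - y)|) <= _).
  apply: itg_le; [exact: cont_on_norm|exact: contW|].
  by move=> y hy; rewrite normrM mulrC ler_wpM2r// HV.
rewrite itgZ; last exact: contW.
rewrite mulrAC [_ * V]mulrC ler_wpM2l//.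
apply: le_trans (cfejer_L1 n x th0 th1).
rewrite (@itg_split R 0 a (2 * pi))//; [|exact: le_trans b2|exact: contW].
rewrite (@itg_split R a b (2 * pi))//; last exact: contW.
have n1 : 0 <= itg 0 a (fun y => `|cfejer n (x - y)|) by exact: Rintegral_ge0.
have n2 : 0 <= itg b (2 * pi) (fun y => `|cfejer n (x - y)|) by exact: Rintegral_ge0.
by rewrite -[X in X <= _]add0r lerD// lerDl.
Qed.

(** The expansion of the kernel integrated term by term. *)
Lemma conv_series v x : cont_on a b v ->
  series (fun n => d n * itg a b (fun y => fejer_prim n (x - y) * v y)) n @[n --> \oo] -->
  pi * itg a b (fun y => Lkernel r (x - y) * v y).
Proof.
move=> cv; have [w [cw wv [V V0 HV]]] := clamp_ext ab cv.
have E k : itg a b (fun y => k (x - y) * v y) = itg a b (fun y => k (x - y) * w y).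
  by apply: eq_itg => y hy; rewrite wv.
pose f n y := d n * (fejer_prim n (x - y) * w y).
have cfw n : continuous (fun y => fejer_prim n (x - y) * w y).
  by apply: ctsM => //; apply: cts_reflect; exact: fejer_prim_cont.
have cf n : continuous (f n).
  exact: ctsZ.
have fM n y : `|f n y| <= (pseries th * V) * W n.
  rewrite /f mulrA normrM [X in _ <= X]mulrAC.
  by apply: ler_pM => //; exact: dcoef_fejer_le.
have := itg_series ab cf fM (@is_cvg_seriesZ _ _ (pseries th * V) cW).
have -> : itg a b (fun y => limn (series (f ^~ y))) = pi * itg a b (fun y => Lkernel r (x - y) * v y).
  rewrite E -itgZ; last first.
    by apply: contW; apply: ctsM => //; apply: cts_reflect; exact: Lkernel_cont.
  apply: eq_itg => y _; rewrite (Lkernel_fejer hr th0 th1 thr) !mulrA mulfV ?gt_eqF ?pi_gt0// mul1r.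
  have cF := @dcoef_fejer_cvg R r th hr th0 th1 thr (x - y).
  have EZ : limn (series (fun n => w y * (dcoef (r - 1) n * fejer_prim n (x - y)))) =
     w y * limn (series (fun n => dcoef (r - 1) n * fejer_prim n (x - y))).
    exact: (lim_seriesZ (w y) cF).
  rewrite mulrC -EZ; apply: eq_lim_series => n; rewrite /f /d; ring.
have -> : (fun n => d n * itg a b (fun y => fejer_prim n (x - y) * v y)) = (fun n => itg a b (f n)).
  by apply/funext => n; rewrite E -itgZ//; exact: contW.
exact.
Qed.

(** The L^1 bounds on the Fejer kernels are summable against d_n, which is
    where th < r - 1, hence r > 1, enters: convolution with the kernel gains
    a full derivative even for merely continuous v. *)
Lemma conv_derive v x : cont_on a b v ->
  is_derive x 1 (fun x => itg a b (fun y => Lkernel r (x - y) * v y)) (conv_deriv v x).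
Proof.
move=> cv; have [V V0 HV] := cont_on_bounded ab cv.
have ip : pi^-1 * (pi : R) = 1 by rewrite mulVf// gt_eqF// pi_gt0.
have EJ : (fun x => itg a b (fun y => Lkernel r (x - y) * v y)) =
  (fun x => pi^-1 * limn (series (fun n => d n * itg a b (fun y => fejer_prim n (x - y) * v y)))).
  apply/funext => z; have := cvg_lim (@Rhausdorff R) (conv_series (x := z) cv) => ->.
  by rewrite mulrA ip mul1r.
rewrite EJ.
have D : is_derive x 1 (fun x => limn (series (fun n => d n * itg a b (fun y => fejer_prim n (x - y) * v y))))
   (limn (series (fun n => - (d n * itg a b (fun y => cfejer n (x - y) * v y))))).
  apply: (@Mtest_derive R (fun n x => d n * itg a b (fun y => fejer_prim n (x - y) * v y))
     (fun n x => - (d n * itg a b (fun y => cfejer n (x - y) * v y)))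
     (fun n => (4 * pseries th * V) * W n)).
  - move=> n y.
    have D1 : is_derive y 1 (fun x => itg a b (fun y => fejer_prim n (x - y) * v y))
        (itg a b (fun y' => - cfejer n (y - y') * v y')).
      have h1 z : y - 1 - b <= z <= y + 1 - a -> is_derive z 1 (fejer_prim n) (- cfejer n z).
        by move=> _; exact: is_derive_fejer_prim.
      have h2 : cont_on (y - 1 - b) (y + 1 - a) (fun z => - cfejer n z).
        by apply: cont_onN; apply: contW; exact: cfejer_cont.
      exact: (derive_conv ab ltr01 h1 h2 cv).
    have -> : - (d n * itg a b (fun y' => cfejer n (y - y') * v y')) =
        d n * itg a b (fun y' => - cfejer n (y - y') * v y').
      rewrite -mulrN -itgN.
        by congr (_ * _); apply: eq_itg => z _; rewrite mulNr.
      by apply: cont_onM => //; apply: contW; apply: cts_reflect; exact: cfejer_cont.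
    by apply: is_derive_eq; rewrite /GRing.scale /=; ring.
  - by move=> n y; rewrite normrN; apply: conv_deriv_term_le.
  - exact: (@is_cvg_seriesZ _ _ _ cW).
  - by move=> y; apply/cvg_ex; eexists; exact: conv_series.
have cs : cvgn (series (fun n => d n * itg a b (fun y => cfejer n (x - y) * v y))).
  apply: (summable_le (M := fun n => (4 * pseries th * V) * W n)).
    by move=> n; exact: conv_deriv_term_le.
  exact: (@is_cvg_seriesZ _ _ _ cW).
have := lim_seriesN cs => EN.
apply: is_derive_eq; rewrite /conv_deriv /GRing.scale /= -mulrN; congr (_ * _).
exact: EN.
Qed.

Lemma conv_deriv_cont v : cont_on a b v -> continuous (conv_deriv v).
Proof.
move=> cv; have [V V0 HV] := cont_on_bounded ab cv.
apply: ctsN; apply: ctsZ => x.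
apply: (@Mtest_cont R (fun n x => d n * itg a b (fun y => cfejer n (x - y) * v y))
  (fun n => (4 * pseries th * V) * W n)).
- move=> n; apply: (@ctsZ R (d n) (fun x => itg a b (fun y => cfejer n (x - y) * v y))) => {}x.
  have [dc cc] := cfejer_Cn 1 n.
  have D1 : is_derive x 1 (fun x => itg a b (fun y => cfejer n (x - y) * v y))
        (itg a b (fun y' => derive1 (cfejer n) (x - y') * v y')).
    have h1 z : x - 1 - b <= z <= x + 1 - a -> is_derive z 1 (cfejer n) (derive1 (cfejer n) z).
      by move=> _; apply: derivable_d1; exact: dc.
    have h2 : cont_on (x - 1 - b) (x + 1 - a) (derive1 (cfejer n)) by move=> z _; exact: cc.
    exact: (derive_conv ab ltr01 h1 h2 cv).
  exact: is_derive_cont D1.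
- by move=> n y; exact: conv_deriv_term_le.
- exact: (@is_cvg_seriesZ _ _ _ cW).
Qed.

(** When v is C^1 the derivative can be moved onto v. This is proved
    termwise, where everything is smooth, and costs two boundary terms. *)
Lemma conv_deriv_parts v x : (forall y, a <= y <= b -> derivable v y 1) -> cont_on a b (derive1 v) ->
  conv_deriv v x = itg a b (fun y => Lkernel r (x - y) * derive1 v y) - Lkernel r (x - b) * v b + Lkernel r (x - a) * v a.
Proof.
move=> dv cdv.
have cv : cont_on a b v by move=> y /dv /derivable_d1 /is_derive_cont.
have p0 : pi != 0 :> R by rewrite gt_eqF// pi_gt0.
have parts n : d n * itg a b (fun y => cfejer n (x - y) * v y) =
   v b * (d n * fejer_prim n (x - b)) - v a * (d n * fejer_prim n (x - a))
   - d n * itg a b (fun y => fejer_prim n (x - y) * derive1 v y).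
  have c1 : cont_on a b (fun y => cfejer n (x - y) * v y).
    by apply: cont_onM => //; apply: contW; apply: cts_reflect; exact: cfejer_cont.
  have c2 : cont_on a b (fun y => fejer_prim n (x - y) * derive1 v y).
    by apply: cont_onM => //; apply: contW; apply: cts_reflect; exact: fejer_prim_cont.
  have E : itg a b (fun y => cfejer n (x - y) * v y + fejer_prim n (x - y) * derive1 v y) =
     fejer_prim n (x - b) * v b - fejer_prim n (x - a) * v a.
    have de y : a <= y <= b -> is_derive y 1 (fun y => fejer_prim n (x - y) * v y)
        (cfejer n (x - y) * v y + fejer_prim n (x - y) * derive1 v y); last first.
      exact: (itg_FTC2 ab de (cont_onD c1 c2)).
    move=> hy; have d1 := derivable_d1 (dv y hy).
    have d2 := is_derive_fejer_prim n (x - y).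
    have i : is_derive y 1 (fun y => x - y) (-1) by apply: is_derive_eq; ring.
    have d3 := @is_derive1_comp _ (fejer_prim n) (fun y => x - y) y _ _ d2 i.
    by apply: is_derive_eq; rewrite /GRing.scale /=; ring.
  rewrite itgD// in E.
  have -> : itg a b (fun y => cfejer n (x - y) * v y) = fejer_prim n (x - b) * v b - fejer_prim n (x - a) * v a
     - itg a b (fun y => fejer_prim n (x - y) * derive1 v y) by rewrite -E addrK.
  ring.
have Sb := @dcoef_fejer_cvg R r th hr th0 th1 thr (x - b).
have Sa := @dcoef_fejer_cvg R r th hr th0 th1 thr (x - a).
have Kf z : limn (series (fun n => d n * fejer_prim n z)) = pi * Lkernel r z.
  by rewrite (Lkernel_fejer hr th0 th1 thr z) mulrA mulfV// mul1r.
have L : series (fun n => d n * itg a b (fun y => cfejer n (x - y) * v y)) n @[n --> \oo] -->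
   v b * (pi * Lkernel r (x - b)) - v a * (pi * Lkernel r (x - a))
   - pi * itg a b (fun y => Lkernel r (x - y) * derive1 v y).
  have -> : series (fun n => d n * itg a b (fun y => cfejer n (x - y) * v y)) =
    (fun n => v b * series (fun n => d n * fejer_prim n (x - b)) n
      - v a * series (fun n => d n * fejer_prim n (x - a)) n
      - series (fun n => d n * itg a b (fun y => fejer_prim n (x - y) * derive1 v y)) n).
    apply/funext => n; rewrite /series /= !mulr_sumr -!sumrB.
    by apply: eq_bigr => k _; exact: parts.
  apply: cvgB; last exact: conv_series.
  rewrite -!Kf; apply: cvgB; (apply: cvgM; first exact: cvg_cst).
  - exact: Sb.
  - exact: Sa.
rewrite /conv_deriv (cvg_lim (@Rhausdorff R) L) !(mulrCA _ pi) -!mulrBr mulKf//; ring.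
Qed.

(** Induction on n: the derivative of the convolution is the convolution of
    v' plus boundary terms that are smooth inside ]a, b[, because the kernel
    is smooth off 2 pi Z. *)
Lemma Cn_conv_near n v : 0 < a -> b < 2 * pi -> Cn n (`]0, 2 * pi[%classic : set R) v ->
  Cn n.+1 (`]a, b[%classic : set R) (fun x => itg a b (fun y => Lkernel r (x - y) * v y)).
Proof.
move=> a1 b1.
have I y : a <= y <= b -> (`]0, 2 * pi[%classic : set R) y.
  by move=> /andP[y1 y2]; rewrite /= in_itv /= (lt_le_trans a1 y1) (le_lt_trans y2 b1).
have oI : open (`]a, b[%classic : set R) by exact: interval_open.
elim: n v => [|n IH] v Cv.
  have cv : cont_on a b v by move=> y /I; exact: Cv.
  have D x : (`]a, b[%classic : set R) x ->
      is_derive x 1 (fun x => itg a b (fun y => Lkernel r (x - y) * v y)) (conv_deriv v x).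
    by move=> _; exact: conv_derive.
  have C : Cn 0 (`]a, b[%classic : set R) (conv_deriv v) by move=> x _; exact: conv_deriv_cont.
  exact: (Cn_S oI D C).
have [dv Cdv] := Cv.
have cv : cont_on a b v by move=> y /I hy; exact: (Cn_cont Cv hy).
have cdv : cont_on a b (derive1 v) by move=> y /I hy; exact: (Cn_cont Cdv hy).
have sh c : (forall x, (`]a, b[%classic : set R) x -> cos_ne1 (x - c)) ->
    Cn n.+1 (`]a, b[%classic : set R) (fun x => Lkernel r (x - c)).
  move=> H; have CK := Lkernel_off hr n.+1.
  exact: (Cn_shift (@open_cos_ne1 R) oI H CK).
pose G x := itg a b (fun y => Lkernel r (x - y) * derive1 v y)
   - v b * Lkernel r (x - b) + v a * Lkernel r (x - a).
have D x : (`]a, b[%classic : set R) x ->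
    is_derive x 1 (fun x => itg a b (fun y => Lkernel r (x - y) * v y)) (G x).
  move=> _.
  have dvI y : a <= y <= b -> derivable v y 1 by move=> /I; exact: dv.
  have -> : G x = conv_deriv v x by rewrite (conv_deriv_parts x dvI cdv) /G; ring.
  exact: conv_derive.
have CI := IH _ Cdv.
have Cb : Cn n.+1 (`]a, b[%classic : set R) (fun x => v b * Lkernel r (x - b)).
  apply: (CnZ _ oI); apply: sh => x; rewrite /= in_itv /= => /andP[x1 x2].
  by rewrite -opprB; apply: cos_ne1N; apply: cos_ne1_itv; lra.
have Ca : Cn n.+1 (`]a, b[%classic : set R) (fun x => v a * Lkernel r (x - a)).
  apply: (CnZ _ oI); apply: sh => x; rewrite /= in_itv /= => /andP[x1 x2].
  by apply: cos_ne1_itv; lra.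
exact: (Cn_S oI D (CnD oI (CnB oI CI Cb) Ca)).
Qed.

End Gain.

(** * Smoothness of the depth function off the crest *)

Section Bootstrap.
Set Implicit Arguments.
Unset Strict Implicit.
Context {R : realType}.
Variables (r th : R).
Hypotheses (hr : 1 < r) (th0 : 0 < th) (th1 : th < 1) (thr : th < r - 1).
Variable u : R -> R.
Hypotheses (cu : continuous u) (pu : forall x, u (x + 2 * pi) = u x).
Hypothesis (upos : forall x, 0 < x < 2 * pi -> 0 < u x).
Variable c0 : R.
Hypothesis (Eq : forall x, 2^-1 * u x ^+ 2 = itg (- pi) pi (fun y => Lkernel r (x - y) * u y) + c0).

(** The period is cut into [0, e], [e, 2 pi - e] and [2 pi - e, 2 pi]: for x
    in the middle the outer pieces are smooth and the inner one is one order
    better than u. Then u = sqrt(2 (L + c0)) with u > 0 gives u' = L' / u. *)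
Lemma bootstrap n : Cn n (`]0, 2 * pi[%classic : set R) u.
Proof.
have p0 : 0 < pi :> R by exact: pi_gt0.
pose L x := itg 0 (2 * pi) (fun y => Lkernel r (x - y) * u y).
have cKu x : continuous (fun y => Lkernel r (x - y) * u y).
  by apply: ctsM => //; apply: cts_reflect; exact: Lkernel_cont.
have EL x : 2^-1 * u x ^+ 2 = L x + c0.
  rewrite Eq; congr (_ + _).
  have per y : Lkernel r (x - (y + 2 * pi)) * u (y + 2 * pi) = Lkernel r (x - y) * u y.
    by rewrite pu -(Lkernel_per r (x - (y + 2 * pi))); congr (Lkernel r _ * _); ring.
  rewrite /L -(itg_period (- pi) (@cKu x) per).
  by have -> : - pi + 2 * pi = pi :> R by ring.
have Eu x : 2 * (L x + c0) = u x ^+ 2 by rewrite -EL; field.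
have oI : open (`]0, 2 * pi[%classic : set R) by exact: interval_open.
elim: n => [|n IH]; first by move=> x _; exact: cu.
have CL : Cn n.+1 (`]0, 2 * pi[%classic : set R) L.
  apply: Cn_local => x; rewrite /= in_itv /= => /andP[x1 x2].
  (* half the distance from x to the endpoints of the period *)
  pose e := Num.min x (2 * pi - x) / 2.
  have m0 : 0 < Num.min x (2 * pi - x) by rewrite lt_min x1 subr_gt0.
  have m1 : Num.min x (2 * pi - x) <= x by rewrite ge_min lexx.
  have m2 : Num.min x (2 * pi - x) <= 2 * pi - x by rewrite ge_min lexx orbT.
  have [e1 e2 e3] : [/\ 0 < e, e < x & x < 2 * pi - e] by rewrite /e; split; lra.
  pose B := (`]e, 2 * pi - e[%classic : set R).
  have oB : open B by exact: interval_open.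
  exists B; split => //; first by rewrite /B /= in_itv /= e2.
  have el : 0 <= e by exact: ltW.
  have ee : e <= 2 * pi - e by exact: ltW (lt_trans e2 e3).
  have el2 : 2 * pi - e <= 2 * pi by rewrite gerBl.
  have E z : B z -> itg 0 e (fun y => Lkernel r (z - y) * u y) +
    itg e (2 * pi - e) (fun y => Lkernel r (z - y) * u y) +
    itg (2 * pi - e) (2 * pi) (fun y => Lkernel r (z - y) * u y) = L z.
    move=> _; rewrite /L (@itg_split R 0 e (2 * pi))//; [|exact: le_trans el2|exact: contW].
    by rewrite (@itg_split R e (2 * pi - e) (2 * pi))// ?addrA//; exact: contW.
  apply: (Cn_eq (n := n.+1) oB E).
  apply: CnD => //; first apply: CnD => //.
  - apply: Cn_conv_far => //; [exact: Lkernel_off|exact: contW|].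
    move=> z; rewrite /B /= in_itv /= => /andP[z1 z2].
    exists (Num.min (z - e) (2 * pi - z) / 2).
      by rewrite divr_gt0// lt_min !subr_gt0 z1; lra.
    have m3 : Num.min (z - e) (2 * pi - z) <= z - e by rewrite ge_min lexx.
    have m4 : Num.min (z - e) (2 * pi - z) <= 2 * pi - z by rewrite ge_min lexx orbT.
    by move=> t /andP[t1 t2]; apply: cos_ne1_itv; lra.
  - apply: (Cn_conv_near hr th0 th1 thr) => //; lra.
  - apply: Cn_conv_far => //; [exact: Lkernel_off|exact: contW|].
    move=> z; rewrite /B /= in_itv /= => /andP[z1 z2].
    exists (Num.min z (2 * pi - e - z) / 2).
      by rewrite divr_gt0// lt_min subr_gt0 z2 andbT; lra.
    have m3 : Num.min z (2 * pi - e - z) <= z by rewrite ge_min lexx.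
    have m4 : Num.min z (2 * pi - e - z) <= 2 * pi - e - z by rewrite ge_min lexx orbT.
    by move=> t /andP[t1 t2]; rewrite -[t]opprK; apply: cos_ne1N; apply: cos_ne1_itv; lra.
have [dL CdL] := CL.
have D x : (`]0, 2 * pi[%classic : set R) x -> is_derive x 1 u (derive1 L x * (u x)^-1).
  move=> Ix; have ux : 0 < u x by apply: upos; move: Ix; rewrite /= in_itv.
  have d1 := derivable_d1 (dL x Ix).
  have g0 : 0 < 2 * (L x + c0) by rewrite Eu exprn_gt0.
  have i : is_derive x 1 (fun x => 2 * (L x + c0)) (2 * derive1 L x).
    by apply: is_derive_eq; rewrite /GRing.scale /=; ring.
  have d2 := @is_derive1_comp _ Num.sqrt (fun x => 2 * (L x + c0)) x _ _ (is_derive1_sqrt g0) i.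
  have E : (2 * Num.sqrt (2 * (L x + c0)))^-1 * (2 * derive1 L x) = derive1 L x * (u x)^-1.
    rewrite Eu sqrtr_sqr gtr0_norm//; field.
    by rewrite gt_eqF.
  rewrite E in d2; apply: is_derive_near d2.
  have : \forall y \near x, y \in `]0, 2 * pi[ by apply: near_in_itvoo.
  apply: filterS => y; rewrite in_itv /= => hy.
  by rewrite /= Eu sqrtr_sqr gtr0_norm// upos.
have un0 x : (`]0, 2 * pi[%classic : set R) x -> u x != 0.
  by rewrite /= in_itv /= => hx; rewrite gt_eqF// upos.
exact: (Cn_S oI D (CnM oI CdL (CnV oI un0 IH))).
Qed.

End Bootstrap.

(** * L_r as a convolution *)

Section FourierSide.
Set Implicit Arguments.
Unset Strict Implicit.
Context {R : realType}.
Implicit Types (f g : R -> R) (x y : R).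
Local Notation mu1 := (@lebesgue_measure R).
Local Notation I := (`[- pi, pi]%classic : set R).

(** A positive element of R[i] is a positive real, so convergence in R[i] of
    real sequences reduces to convergence in R. *)
Lemma lim_real_complex (s : nat -> R) (l : R) : s n @[n --> \oo] --> l ->
  limn (fun n => (s n)%:C : R[i]^o) = l%:C.
Proof.
move=> sl; apply: cvg_lim; first exact: norm_hausdorff.
apply/cvgrPdist_lt => /= e e0.
have [e1 e2] : 0 < complex.Re e /\ e = (complex.Re e)%:C.
  move: e0; rewrite ltcE /= => /andP[/eqP i0 r0]; split => //.
  by case: e i0 r0 => a b /= -> _.
move/cvgrPdist_lt : sl => /(_ _ e1); apply: filterS => n H.
have -> : (l%:C - (s n)%:C : R[i]) = (l - s n)%:C by rewrite -rmorphB.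
rewrite e2 normc_def /= expr0n /= addr0 sqrtr_sqr ltcR; exact: H.
Qed.

Variables (f : R -> R).
Hypotheses (mf : measurable_fun I f) (V : R) (HV : forall x, `|f x| <= V).

Lemma I_fin : (mu1 I < +oo)%E.
Proof. by rewrite lebesgue_measure_itv /=; case: ifPn => // _; rewrite -EFinB ltry. Qed.

Lemma int_fg g : continuous g -> mu1.-integrable I (EFin \o (fun y => f y * g y)).
Proof.
move=> cg; apply: measurable_bounded_integrable => //; first exact: I_fin.
  apply: measurable_funM => //; apply: measurable_funTS.
  exact: continuous_measurable_fun.
have p0 : - pi <= pi :> R by have := @pi_gt0 R; lra.
have [B B0 HB] := cont_on_bounded p0 (contW cg).
exists (V * B); split; first exact: num_real.
move=> z Vz y /=; rewrite in_itv /= => hy; apply: le_trans (ltW Vz).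
by rewrite normrM; apply: ler_pM => //; exact: HB.
Qed.

Lemma int_fg_bound g B : continuous g -> (forall y, `|g y| <= B) ->
  `|\int[mu1]_(y in I) (f y * g y)| <= V * B * (2 * pi).
Proof.
move=> cg HB; have p0 := @pi_gt0 R.
apply: le_trans (le_normr_Rintegral _ (int_fg cg)) _ => //.
apply: le_trans (_ : \int[mu1]_(y in I) (V * B) <= _).
  apply: le_Rintegral => //.
  - have := int_fg cg => /integrable_norm; apply: eq_integrable => //.
  - apply: itg_integrable; exact: cont_on_cst.
  - by move=> y _; rewrite normrM; apply: ler_pM.
have := @itg_cst R (- pi) pi (V * B); rewrite /itg => ->; last by lra.
by rewrite opprK mulr2n mulrDl mul1r.
Qed.

Lemma int_fgZ g c : continuous g ->
  c * \int[mu1]_(y in I) (f y * g y) = \int[mu1]_(y in I) (f y * (c * g y)).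
Proof.
by move=> cg; rewrite -RintegralZl; [apply: eq_Rintegral => y _; rewrite mulrCA|by []|exact: int_fg].
Qed.

Lemma int_fgD g h : continuous g -> continuous h ->
  \int[mu1]_(y in I) (f y * g y) + \int[mu1]_(y in I) (f y * h y) =
  \int[mu1]_(y in I) (f y * (g y + h y)).
Proof.
move=> cg ch; rewrite -RintegralD; [|by []|exact: int_fg|exact: int_fg].
by apply: eq_Rintegral => y _; rewrite mulrDr.
Qed.

(** The k-th Fourier mode of f written as a convolution; it is pi times the
    sum of the terms of index k and -k of the Fourier series. *)
Definition fcos (k : nat) x : R := \int[mu1]_(y in I) (f y * cos (k%:R * (x - y))).

Lemma cont_cos_lin (p w : R) : continuous (fun y : R => cos (p * y + w)).
Proof. by move=> y; exact: is_derive_cont (is_derive_cos_lin p w y). Qed.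

Lemma cont_cosk (p : R) : continuous (fun y : R => cos (p * y)).
Proof. by have := @cont_cos_lin p 0; under eq_fun do rewrite addr0. Qed.

Lemma cont_sink (p : R) : continuous (fun y : R => sin (p * y)).
Proof. by have := @cont_cos_lin p (- (pi / 2)); under eq_fun do rewrite cosBpihalf. Qed.

Lemma fcosE k x : fcos k x = cos (k%:R * x) * \int[mu1]_(y in I) (f y * cos (k%:R * y))
  + sin (k%:R * x) * \int[mu1]_(y in I) (f y * sin (k%:R * y)).
Proof.
have cc := @cont_cosk k%:R; have cs := @cont_sink k%:R.
rewrite !int_fgZ// int_fgD; [|exact: ctsZ..].
by apply: eq_Rintegral => y _; rewrite mulrBr cosB.
Qed.

Lemma fourier_coefE (p : int) : fourier_coef f p =
  (((2 * pi)^-1 * \int[mu1]_(y in I) (f y * cos (p%:~R * y))) +i*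
   ((2 * pi)^-1 * - \int[mu1]_(y in I) (f y * sin (p%:~R * y))))%C.
Proof.
have is_ := int_fg (@cont_sink p%:~R).
rewrite /fourier_coef /cintegral /expi.
have -> : \int[mu1]_(x in I) complex.Re ((f x)%:C * (cos (- (p%:~R * x)) +i* sin (- (p%:~R * x)))%C)
   = \int[mu1]_(y in I) (f y * cos (p%:~R * y)).
  by apply: eq_Rintegral => y _ /=; rewrite mul0r subr0 cosN.
have -> : \int[mu1]_(x in I) complex.Im ((f x)%:C * (cos (- (p%:~R * x)) +i* sin (- (p%:~R * x)))%C)
   = - \int[mu1]_(y in I) (f y * sin (p%:~R * y)).
  rewrite -[RHS]mulN1r -RintegralZl//.
  by apply: eq_Rintegral => y _ /=; rewrite mul0r addr0 sinN; ring.
by apply/eqP; rewrite eq_complex /= !mul0r subr0 addr0 !eqxx.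
Qed.

Lemma Lterm_pair r k x : Lterm r f x k.+1%:Z + Lterm r f x (- k.+1%:Z) =
  (pow_coef r k * (pi^-1 * fcos k.+1 x))%:C.
Proof.
have p0 : pi != 0 :> R by rewrite gt_eqF// pi_gt0.
rewrite fcosE /Lterm !fourier_coefE /expi /pow_coef.
rewrite mulrNz !normrN !mulNr !cosN !sinN.
have -> : `|k.+1%:~R| = k.+1%:R :> R by rewrite normr_nat.
set A := \int[mu1]_(y in I) (f y * cos (k.+1%:R * y)).
set S := \int[mu1]_(y in I) (f y * sin (k.+1%:R * y)).
have -> : \int[mu1]_(y in I) (f y * cos (- k.+1%:~R * y)) = A.
  by apply: eq_Rintegral => y _; rewrite mulNr cosN.
have -> : \int[mu1]_(y in I) (f y * sin (- k.+1%:~R * y)) = - S.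
  rewrite -[RHS]mulN1r -RintegralZl//; last exact: int_fg (@cont_sink k.+1%:R).
  by apply: eq_Rintegral => y _; rewrite mulNr sinN; ring.
have -> : k.+1%:~R = k.+1%:R :> R by [].
move: (k.+1%:R `^ (- r)) (cos (k.+1%:R * x)) (sin (k.+1%:R * x)) A S => q c s {}A {}S.
move: (pi : R) p0 => P p0.
apply/eqP; rewrite eq_complex /=; apply/andP; split; apply/eqP; field; exact: p0.
Qed.

(** The symmetric partial sums are real: the terms of index k and -k are
    conjugate. They are integrals of f against the partial sums of the
    kernel, which converge uniformly. *)
Lemma Lop_real r x : 1 < r ->
  Lop r f x = (\int[mu1]_(y in I) (f y * Lkernel r (x - y)))%:C.
Proof.
move=> hr; have p0 := @pi_gt0 R.
have V0 : 0 <= V by apply: le_trans (HV 0).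
pose s N := \sum_(k < N) (pow_coef r k * (pi^-1 * fcos k.+1 x)).
have -> : Lop r f x = limn (fun n => (s n)%:C : R[i]^o).
  rewrite /Lop (_ : (fun N : nat => _) = (fun n => (s n)%:C : R[i]^o))//; apply/funext => N.
  rewrite big_add1 /= big_mkord /s rmorph_sum /=.
  by apply: eq_bigr => k _; rewrite Lterm_pair.
apply: lim_real_complex.
have cs c : continuous (fun y : R => cos (c * (x - y))).
  rewrite (_ : (fun y => _) = (fun y => cos (- c * y + c * x))); first exact: cont_cos_lin.
  by apply/funext => y; congr cos; ring.
pose KN N y := pi^-1 * series (fun k => pow_coef r k * cos ((k + 1)%:R * y + 0)) N.
have cKN N : continuous (fun y => KN N (x - y)).
  apply: ctsZ => y; apply: (@cont_partial _ (fun k y => pow_coef r k * cos ((k + 1)%:R * (x - y) + 0))) => k.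
  apply: (@ctsZ R (pow_coef r k) (fun y => cos ((k + 1)%:R * (x - y) + 0))).
  by under eq_fun do rewrite addr0; exact: cs.
have cK : continuous (fun y => Lkernel r (x - y)).
  by apply: cts_reflect; exact: Lkernel_cont.
have Es N : s N = \int[mu1]_(y in I) (f y * KN N (x - y)).
  elim: N => [|N IH].
    rewrite /s big_ord0 /KN /series /=; under eq_Rintegral do rewrite big_geq// mulr0 mulr0.
    by rewrite Rintegral_cst// mul0r.
  rewrite /s big_ord_recr /= -/(s N) IH /fcos.
  have c1 := cs N.+1%:R; have c2 := ctsZ (k := pi^-1) c1; have c3 := ctsZ (k := pow_coef r N) c2.
  rewrite (int_fgZ _ c1) (int_fgZ _ c2) int_fgD; [|exact: cKN|exact: c3].
  by apply: eq_Rintegral => y _; rewrite /KN seriesSr addr0 addn1; ring.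
have tail N y : `|Lkernel r y - KN N y| <= pi^-1 * (limn (series (fun k => `|pow_coef r k|)) - series (fun k => `|pow_coef r k|) N).
  rewrite /Lkernel /KN -mulrBr normrM gtr0_norm ?invr_gt0// ler_pM2l ?invr_gt0//.
  exact: (series_tail_le N (trigS_term_le (pow_coef r) 1 0 ^~ y) (pow_coef_summable hr)).
apply/cvgrPdist_le => /= e e0.
pose B := V * pi^-1 * (2 * pi) + 1.
have B0 : 0 < B by rewrite ltr_wpDl// !mulr_ge0// ?invr_ge0 ltW.
have eB : 0 < e / B by rewrite divr_gt0.
have [N HN] := summable_tail (pow_coef_summable hr) eB.
near=> n.
have -> : \int[mu1]_(y in I) (f y * Lkernel r (x - y)) - s n =
  \int[mu1]_(y in I) (f y * (Lkernel r (x - y) - KN n (x - y))).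
  rewrite Es -RintegralB; [|by []|exact: int_fg|exact: int_fg].
  by apply: eq_Rintegral => y _; ring.
have cd : continuous (fun y => Lkernel r (x - y) - KN n (x - y)).
  exact: ctsB.
apply: le_trans (int_fg_bound cd (fun y => tail n (x - y))) _.
have Hn : limn (series (fun k => `|pow_coef r k|)) - series (fun k => `|pow_coef r k|) n <= e / B.
  apply: le_trans HN; rewrite lerD2l lerN2.
  have Nn : (N <= n)%N by near: n; exists N.
  by apply: nondecreasing_series => // k _ _; exact: normr_ge0.
apply: le_trans (_ : V * (pi^-1 * (e / B)) * (2 * pi) <= _).
  by rewrite ler_wpM2r ?mulr_ge0 ?(ltW p0)// ler_wpM2l// ler_wpM2l// invr_ge0 ltW.
have -> : V * (pi^-1 * (e / B)) * (2 * pi) = (V * pi^-1 * (2 * pi)) * e / B by ring.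
by rewrite ler_pdivrMr// mulrC ler_pM2l// /B lerDl.
Unshelve. all: by end_near. Qed.

End FourierSide.

(** * The highest wave *)

Section Assembly.
Set Implicit Arguments.
Unset Strict Implicit.
Context {R : realType}.
Implicit Types (f : R -> R) (x y z : R).

Lemma periodic_int f (p : R) (m : int) x : periodic f p -> f (x - m%:~R * p) = f x.
Proof.
move=> pf; case: m => n.
  rewrite -[in RHS](subrK (n%:R * p) x) mulr_natl.
  by rewrite (periodicn pf).
by rewrite NegzE mulrNz mulNr opprK mulr_natl (periodicn pf).
Qed.

Lemma circle_rep x : exists m : int, `|x - m%:~R * (2 * pi)| <= pi.
Proof.
have p0 := @pi_gt0 R.
pose t := x / (2 * pi) + 2^-1.
have tE : x = (t - 2^-1) * (2 * pi).
  by rewrite /t addrK divfK// gt_eqF// mulr_gt0.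
exists (Num.floor t).
have := floor_le t; have := floorD1_gt t; rewrite intrD.
move: ((Num.floor t)%:~R : R) => m m1 m2.
rewrite ler_norml tE; apply/andP; split.
  have : 0 <= (t - m) * (2 * pi) by rewrite mulr_ge0 ?subr_ge0// mulr_ge0// ltW.
  lra.
have : (t - m) * (2 * pi) <= 1 * (2 * pi).
  by rewrite ler_wpM2r ?mulr_ge0 ?(ltW p0)// lerBlDr addrC ltW.
lra.
Qed.

Lemma circle_rep_min z (k : int) : `|z| <= pi -> `|z| <= `|z - k%:~R * (2 * pi)|.
Proof.
move=> zp; have p0 := @pi_gt0 R; have [->|k0] := eqVneq k 0; first by rewrite mul0r subr0.
have k1 : 1 <= `|k%:~R| :> R by rewrite -intr_norm ler1z -gtz0_ge1 normr_gt0.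
have : 2 * pi <= `|k%:~R * (2 * pi)| :> R.
  have p2 : 0 < 2 * pi :> R by rewrite mulr_gt0.
  by rewrite normrM (gtr0_norm p2) ler_peMl// ltW.
have := ler_normB z (z - k%:~R * (2 * pi)); rewrite subKr; lra.
Qed.

Lemma off_zero_rep x : off_zero x -> exists m : int, 0 < x - m%:~R * (2 * pi) < 2 * pi.
Proof.
move=> ox; have p0 := @pi_gt0 R; have p2 : 0 < 2 * pi :> R by rewrite mulr_gt0.
pose t := x / (2 * pi).
have tE : x = t * (2 * pi) by rewrite /t divfK// gt_eqF.
exists (Num.floor t).
have := floor_le t; have := floorD1_gt t; rewrite intrD.
have : t != (Num.floor t)%:~R.
  by apply/eqP => tm; have /eqP := ox (Num.floor t); apply; rewrite -tm.
move: ((Num.floor t)%:~R : R) => m tm m1; rewrite le_eqVlt eq_sym (negbTE tm) /= => m2.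
rewrite tE -mulrBl; apply/andP; split; first by rewrite mulr_gt0// subr_gt0.
by rewrite -[X in _ < X]mul1r ltr_pM2r// ltrBlDr addrC.
Qed.

(** On [-b, b] the function is the composition of - |x| with a function that
    is monotone on the whole line. *)
Lemma monotone_even_measurable f (b : R) : (forall x, f (- x) = f x) -> 0 <= b ->
  {in `[- b, 0] &, {homo f : x y / x <= y}} -> measurable_fun (`[- b, b]%classic : set R) f.
Proof.
move=> ef b0 mf.
pose cl x := Num.min (Num.max x (- b)) 0.
have clI x : cl x \in `[- b, 0].
  by rewrite in_itv /= /cl ge_min lexx orbT andbT le_min le_max lexx orbT /= oppr_le0.
have nd : nondecreasing_fun (f \o cl).
  move=> x y xy /=; apply: mf => //; rewrite /cl.
  have h : Num.max x (- b) <= Num.max y (- b).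
    by rewrite ge_max !le_max xy lexx !orbT.
  by rewrite le_min !ge_min h lexx orbT.
apply: (eq_measurable_fun (f \o cl \o (fun x => - `|x|))).
  move=> x; rewrite inE /= in_itv /= => /andP[x1 x2].
  have xb : `|x| <= b by rewrite ler_norml x1.
  have -> : cl (- `|x|) = - `|x|.
    have h1 : - b <= - `|x| by rewrite lerN2.
    have h2 : - `|x| <= 0 by rewrite oppr_le0.
    by rewrite /cl (max_l h1) (min_l h2).
  by rewrite /=; have [x0|x0] := leP 0 x; rewrite ?(ger0_norm x0) ?(ltr0_norm x0) ?opprK ?ef.
apply: measurable_funTS; apply: measurableT_comp.
  exact: nondecreasing_measurable.
by apply: measurableT_comp => //; exact: measurableT_comp.
Qed.

End Assembly.

Theorem theorem4p7 (R : realType) (r mu : R) (phi : R -> R)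
  (hr : 1 < r) (hmu : 0 < mu)
  (hle : forall x, phi x <= mu)
  (heven : forall x, phi (- x) = phi x)
  (hper : periodic phi (2 * pi))
  (hbnd : [bounded phi x | x in [set: R]])
  (hmean : \int[@lebesgue_measure R]_(x in `[- pi, pi]) phi x = 0)
  (heq : forall x : R,
     (2^-1 * (mu - phi x) ^+ 2)%:C
     = (2^-1 * mu ^+ 2)%:C - Lop r phi x
       + (2^-1)%:C * fourier_coef (fun y => phi y ^+ 2) 0)
  (hmono : {in `[- pi, 0] &, {homo phi : x y / x <= y}})
  (hmax : forall x, phi x <= phi 0)
  (h0 : phi 0 = mu) :
  [/\ smooth_on off_zero phi
        /\ {in `]- pi, 0[ &, {homo phi : x y / x < y}},
      lipschitz phi
    & exists c C delta : R,
        [/\ 0 < c, c <= C, 0 < delta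
          & forall x, `|x| < delta ->
              c * `|x| <= mu - phi x <= C * `|x|]].
Proof.
have p0 := @pi_gt0 R.
(* any exponent with 0 < th < 1 and th < r - 1 would do *)
pose th := Num.min (r - 1) 1 / 2.
have rm0 : 0 < Num.min (r - 1) 1 by rewrite lt_min subr_gt0 hr ltr01.
have rm1 : Num.min (r - 1) 1 <= 1 by rewrite ge_min lexx orbT.
have rm2 : Num.min (r - 1) 1 <= r - 1 by rewrite ge_min lexx.
have th0 : 0 < th by rewrite divr_gt0.
have th1 : th < 1 by rewrite /th; lra.
have thr : th < r - 1 by rewrite /th; lra.
have [V HV] : exists V : R, forall x, `|phi x| <= V.
  have [M [_ HM]] := hbnd; exists (M + 1) => x.
  by apply: HM => //; rewrite ltrDl.
have V0 : 0 <= V by apply: le_trans (HV 0).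
have mphi : measurable_fun (`[- pi, pi]%classic : set R) phi.
  by apply: monotone_even_measurable => //; exact: ltW.
pose I : set R := `[- pi, pi]%classic.
pose l x := \int[@lebesgue_measure R]_(y in I) (phi y * Lkernel r (x - y)).
have [c1 Hc1] : exists c1 : R, forall x, 2^-1 * (mu - phi x) ^+ 2 = c1 - l x.
  exists (2^-1 * mu ^+ 2 + complex.Re ((2^-1)%:C * fourier_coef (fun y => phi y ^+ 2) 0)) => x.
  have := heq x; rewrite (Lop_real mphi HV x hr) -/(l x) => /(congr1 (@complex.Re R)).
  case: (_ * fourier_coef _ _) => a b /= ->; ring.
have cKx x : continuous (fun y => Lkernel r (x - y)).
  by apply: cts_reflect; exact: Lkernel_cont.
have cl : continuous l.
  have [C C0 HC] := Lkernel_Holder hr th0 th1 thr.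
  move=> x; apply/cvgrPdist_le => /= e e0.
  pose B := V * C * (2 * pi) + 1.
  have B0 : 0 < B by rewrite ltr_wpDl// !mulr_ge0// ltW.
  have eB : 0 < e / B by rewrite divr_gt0.
  have dB : 0 < (e / B) `^ th^-1 by rewrite powR_gt0.
  near=> y.
  have xy : `|x - y| <= (e / B) `^ th^-1.
    by apply: ltW; near: y; apply: (@cvgr_dist_lt _ _ _ _ _ id) => //; exact: cvg_id.
  have xyt : `|x - y| `^ th <= e / B.
    apply: le_trans (_ : ((e / B) `^ th^-1) `^ th <= _).
      by apply: (ge0_ler_powR (ltW th0)); rewrite ?nnegrE// ltW.
    by rewrite -powRrM mulVf ?gt_eqF// powRr1// ltW.
  have -> : l x - l y = \int[@lebesgue_measure R]_(z in I) (phi z * (Lkernel r (x - z) - Lkernel r (y - z))).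
    rewrite /l -RintegralB; [|exact: measurable_itv|exact: (int_fg mphi HV (cKx x))|exact: (int_fg mphi HV (cKx y))].
    by apply: eq_Rintegral => z _; rewrite mulrBr.
  have bd z : `|Lkernel r (x - z) - Lkernel r (y - z)| <= C * (e / B).
    apply: le_trans (HC _ _) _; rewrite ler_wpM2l//.
    by rewrite (_ : x - z - (y - z) = x - y)//; ring.
  apply: le_trans (int_fg_bound mphi HV (ctsB (cKx x) (cKx y)) bd) _.
  have -> : V * (C * (e / B)) * (2 * pi) = V * C * (2 * pi) * e / B by ring.
  by rewrite ler_pdivrMr// mulrC ler_pM2l// /B lerDl.
pose u x := mu - phi x.
have u00 : u 0 = 0 by rewrite /u h0 subrr.
have un x : 0 <= u x by rewrite /u subr_ge0.
(* the convolution is continuous for phi merely bounded and measurable,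
   and the equation passes this on to u *)
have cu : continuous u.
  have -> : u = (fun x => Num.sqrt (2 * (c1 - l x))).
    apply/funext => x; rewrite -Hc1 -/(u x).
    by rewrite mulrA mulfV// mul1r sqrtr_sqr ger0_norm.
  move=> x; apply: (@continuous_comp _ _ _ (fun x => 2 * (c1 - l x)) Num.sqrt).
    by apply: ctsZ; apply: ctsB => // y; exact: cvg_cst.
  exact: sqrt_continuous.
have eu x : u (- x) = u x by rewrite /u heven.
have pu : periodic u (2 * pi) by move=> x; rewrite /u hper.
have mu_ x y : 0 <= x -> x <= y -> y <= pi -> u x <= u y.
  move=> x0 xy yp; rewrite -eu -(eu y) /u lerD2l lerN2.
  by apply: hmono; rewrite ?in_itv /= ?lerN2 ?oppr_le0 ?x0 ?yp ?(le_trans x0 xy) ?(le_trans xy yp).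
have une : exists2 x : R, 0 <= x <= pi & u x != 0.
  apply: contrapT => H.
  have phimu x : - pi <= x <= pi -> phi x = mu.
    have phi0 y : 0 <= y <= pi -> phi y = mu.
      move=> hy; apply/esym/eqP; rewrite -subr_eq0 -/(u y); apply/negPn/negP => uy.
      by apply: H; exists y.
    move=> /andP[x1 x2]; have [x0|x0] := leP 0 x; first by apply: phi0; rewrite x0.
    by rewrite -heven phi0//; apply/andP; split; lra.
  have := hmean; have := @eq_itg R (- pi) pi phi (fun=> mu) phimu; rewrite /itg => ->.
  have := @itg_cst R (- pi) pi mu; rewrite /itg => ->; last by lra.
  apply/eqP; rewrite gt_eqF// mulr_gt0//; lra.
pose L x := itg (- pi) pi (fun y => Lkernel r (x - y) * u y).
have lL x : l x = - L x.
  (* the kernel has mean zero, so replacing phi by u only changes the sign *)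
  have K0 : itg (- pi) pi (fun y => Lkernel r (x - y)) = 0.
    have dm y : - pi <= y <= pi -> is_derive y 1 (fun y => - Lkernel_prim r (x - y)) (Lkernel r (x - y)).
      move=> _; have d := Lkernel_prim_derive hr (x - y).
      have i : is_derive y 1 (fun y => x - y) (-1) by apply: is_derive_eq; ring.
      have e := @is_derive1_comp _ _ (fun y => x - y) y _ _ d i.
      have := is_deriveN e; rewrite mulrN1 opprK; exact.
    have pp : - pi <= pi :> R by lra.
    rewrite (itg_FTC2 pp dm (contW (cKx x))).
    have -> : Lkernel_prim r (x - - pi) = Lkernel_prim r (x - pi).
      by rewrite -(Lkernel_prim_per r (x - pi)); congr (Lkernel_prim r _); ring.
    by ring.
  have c2 : continuous (fun y => mu * Lkernel r (x - y)) by exact: ctsZ.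
  have c3 : continuous (fun y => Lkernel r (x - y) * u y) by exact: ctsM.
  have -> : l x = itg (- pi) pi (fun y => mu * Lkernel r (x - y) - Lkernel r (x - y) * u y).
    by rewrite /l; apply: eq_itg => y _; rewrite /u; ring.
  rewrite itgB; [|exact: contW..].
  by rewrite itgZ ?K0 ?mulr0 ?sub0r//; exact: contW.
have c1E : c1 = - L 0.
  have := Hc1 0; rewrite h0 subrr expr0n mulr0 lL opprK => /esym/eqP.
  by rewrite addr_eq0 => /eqP.
have Eq x : 2^-1 * u x ^+ 2 = L x - L 0 by rewrite -/(u x) Hc1 lL opprK c1E addrC.
have [c c0 Hc] := u_lower hr th0 th1 thr cu eu u00 mu_ une Eq.
have [M M0 HM] := u_upper hr th0 th1 thr cu eu u00 mu_ Eq.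
have [Lp Lp0 HLp] := u_lip hr th0 th1 thr cu eu u00 mu_ une Eq.
have ust := u_strict hr th0 th1 thr cu eu u00 mu_ une Eq.
have upos x : 0 < x < 2 * pi -> 0 < u x.
  move=> /andP[x1 x2]; have pos y : 0 < y -> y <= pi -> 0 < u y.
    by move=> y0 yp; apply: lt_le_trans (Hc y _); rewrite ?mulr_gt0// (ltW y0).
  have [xp|xp] := leP x pi; first exact: pos.
  by rewrite -eu -pu; apply: pos; lra.
have smooth n : Cn n (`]0, 2 * pi[%classic : set R) u.
  exact: (bootstrap hr th0 th1 thr cu pu upos Eq).
split; first split.
- apply: Cn_smooth => n; apply: Cn_local => x /off_zero_rep [m hm].
  pose B := (`](m%:~R * (2 * pi)), (m%:~R * (2 * pi) + 2 * pi)[%classic : set R).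
  have oB : open B by exact: interval_open.
  exists B; split => //.
    by rewrite /B /= in_itv /=; case/andP: hm => h1 h2; apply/andP; split; lra.
  have oI : open (`]0, 2 * pi[%classic : set R) by exact: interval_open.
  have BI y : B y -> (`]0, 2 * pi[%classic : set R) (y - m%:~R * (2 * pi)).
    by rewrite /B /= !in_itv /= => /andP[h1 h2]; apply/andP; split; lra.
  have Cs := Cn_shift oI oB BI (smooth n).
  have E y : B y -> mu - u (y - m%:~R * (2 * pi)) = phi y.
    by move=> _; rewrite (periodic_int m y pu) /u subKr.
  exact: (Cn_eq oB E (CnB oB (Cn_cst n mu oB) Cs)).
- move=> x y; rewrite !in_itv /= => /andP[x1 x2] /andP[y1 y2] xy.
  have h1 : 0 <= - y by lra.
  have h2 : - y < - x by lra.
  have h3 : - x <= pi by lra.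
  by have := ust _ _ h1 h2 h3; rewrite !eu /u ltrD2l ltrN2.
- have ua x : u x = u `|x| by have [x0|x0] := leP 0 x; rewrite ?(ger0_norm x0) ?(ltr0_norm x0) ?eu.
  have key x y : u y - u x <= Lp * `|x - y|.
    have [m hm] := circle_rep x; have [k hk] := circle_rep y.
    have -> : u x = u `|x - m%:~R * (2 * pi)| by rewrite -ua periodic_int.
    have -> : u y = u `|y - k%:~R * (2 * pi)| by rewrite -ua periodic_int.
    set p := `|x - m%:~R * (2 * pi)|; set q := `|y - k%:~R * (2 * pi)|.
    have [qp|pq] := leP q p.
      have h1 : 0 <= Lp * `|x - y| by rewrite mulr_ge0.
      by apply: le_trans h1; rewrite subr_le0; exact: (mu_ q p (normr_ge0 _) qp hm).
    apply: le_trans (HLp q p (normr_ge0 _) (ltW pq) hk) _.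
    rewrite ler_wpM2l// lerBlDr.
    have := circle_rep_min (m - k) hk.
    have -> : y - k%:~R * (2 * pi) - (m - k)%:~R * (2 * pi) = y - m%:~R * (2 * pi).
      by rewrite intrB; ring.
    move=> /le_trans; apply.
    have -> : y - m%:~R * (2 * pi) = (y - x) + (x - m%:~R * (2 * pi)) by ring.
    by apply: le_trans (ler_normD _ _) _; rewrite distrC.
  rewrite /lipschitz_on; near=> N; case=> x y _ /=.
  have LN : Lp <= N by near: N; apply: nbhs_pinfty_ge; exact: num_real.
  apply: le_trans (_ : Lp * `|x - y| <= _); last by rewrite ler_wpM2r.
  have -> : phi x - phi y = u y - u x by rewrite /u; ring.
  rewrite ler_norml key andbT lerNl opprB.
  by rewrite distrC; exact: key.
- exists c, M, pi; split => //.
    have pI : 0 <= (pi : R) <= pi by rewrite lexx ltW.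
    by have := le_trans (Hc pi pI) (HM pi pI); rewrite ler_pM2r.
  move=> x xp; have xI : 0 <= `|x| <= pi by rewrite normr_ge0 ltW.
  have ua : mu - phi x = u `|x| by rewrite -/(u x); have [x0|x0] := leP 0 x; rewrite ?(ger0_norm x0) ?(ltr0_norm x0) ?eu.
  by rewrite ua Hc//= HM.
Unshelve. all: by end_near. Qed.
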